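(* Let $d$ be a constant and let $\mathcal{P}$ be a set of $n$ uncertain points in $\mathbb{R}^d$ with existential uncertainty (in general position, with $p_v\in(0,1)$ for all $v$). For any $\varepsilon>0$, an $\varepsilon$-exp-kernel of size $O(1/\varepsilon^{(d-1)/2})$ for $\mathcal{P}$ can be constructed in $O\!\left(\frac{1}{\varepsilon^{d-1}}\,n\log n\right)$ time.
   Context: Existential uncertainty model: each $v\in\mathcal{P}$ is present in a random realization $P\sim\mathcal{P}$ independently with probability $p_v$. For a finite point set $P$, $f(P,u)=\max_{p\in P}\langle u,p\rangle$ (with $f(\emptyset,u)=0$) and $\omega(P,u)=f(P,u)+f(P,-u)$; $\omega(\mathcal{P},u)=\mathbb{E}_{P\sim\mathcal{P}}[\omega(P,u)]$. A set $S$ of points is an $\varepsilon$-exp-kernel of $\mathcal{P}$ if $(1-\varepsilon)\omega(\mathcal{P},u)\le\omega(S,u)\le\omega(\mathcal{P},u)$ for all $u\in\mathbb{R}^d$. *)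

(* Defs.v *)
From mathcomp Require Import all_boot all_order all_algebra.
From mathcomp Require Import all_reals exp.

Set Implicit Arguments.
Unset Strict Implicit.
Unset Printing Implicit Defensive.

Import Order.TTheory GRing.Theory Num.Theory.
Local Open Scope ring_scope.

Section Geometry.
Variables (R : realType) (d : nat).
Implicit Types (S : seq 'rV[R]_d) (u : 'rV[R]_d).

Definition dotp u (q : 'rV[R]_d) : R := \sum_(j < d) u 0 j * q 0 j.

(* A finite point set is given by a listing of its points; extent S u is
   f(S, u) = max_(q in S) <u, q>, with f(empty, u) = 0. *)
Definition extent S u : R :=
  if S is q0 :: S' then \big[Num.max/dotp u q0]_(q <- S') dotp u q else 0.

Definition width S u : R := extent S u + extent S (- u).

Variable n : nat.
Implicit Types (v : 'I_n -> 'rV[R]_d) (p : 'I_n -> R).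

(* Any at most d+1 of the points are affinely independent; for d > 0 this
   makes v injective. *)
Definition general_position v : Prop :=
  forall A : {set 'I_n}, (#|A| <= d.+1)%N ->
  forall c : 'I_n -> R,
    \sum_(i in A) c i = 0 -> \sum_(i in A) c i *: v i = 0 ->
  forall i, i \in A -> c i = 0.

(* A realization is the set A of indices of the points that are present. *)
Definition realization_prob p (A : {set 'I_n}) : R :=
  (\prod_(i in A) p i) * \prod_(i in ~: A) (1 - p i).

Definition realization_points v (A : {set 'I_n}) : seq 'rV[R]_d :=
  [seq v i | i <- enum A].

Definition expected_width v p u : R :=
  \sum_(A : {set 'I_n}) realization_prob p A * width (realization_points v A) u.

Definition is_exp_kernel (eps : R) v p S : Prop :=
  forall u : 'rV[R]_d,
    (1 - eps) * expected_width v p u <= width S u <= expected_width v p u.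

End Geometry.

(* The real RAM, presented as a structured language.  There are two unbounded
   memories, one of natural numbers (addresses and counters) and one of exact
   real numbers, both with indirect addressing, and a write-only output tape
   of reals.  The only operations on reals are the four field operations and
   comparison: no rounding, roots or transcendental functions. *)

Inductive nexp : Type :=
| NNum of nat
| NLoad of nexp
| NAdd of nexp & nexp
| NSub of nexp & nexp.

Inductive rexp : Type :=
| RNat of nexp
| RLoad of nexp
| RAdd of rexp & rexp
| RSub of rexp & rexp
| RMul of rexp & rexp
| RDiv of rexp & rexp.

Inductive test : Type :=
| NLt of nexp & nexp
| RLt of rexp & rexp.

Inductive cmd : Type :=
| Skip
| NStore of nexp & nexp
| RStore of nexp & rexp
| Write of rexp
| Seq of cmd & cmd
| If of test & cmd & cmd
| While of test & cmd.

(* Unit cost: one per constant, memory access, arithmetic operation or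
   comparison. *)
Fixpoint ncost (e : nexp) : nat :=
  match e with
  | NNum _ => 1
  | NLoad e1 => (ncost e1).+1
  | NAdd e1 e2 | NSub e1 e2 => (ncost e1 + ncost e2).+1
  end.

Fixpoint rcost (e : rexp) : nat :=
  match e with
  | RNat e1 | RLoad e1 => (ncost e1).+1
  | RAdd e1 e2 | RSub e1 e2 | RMul e1 e2 | RDiv e1 e2 =>
      (rcost e1 + rcost e2).+1
  end.

Definition tcost (b : test) : nat :=
  match b with
  | NLt e1 e2 => (ncost e1 + ncost e2).+1
  | RLt e1 e2 => (rcost e1 + rcost e2).+1
  end.

Section Semantics.
Variable R : realType.

Record state : Type := State {
  nmem : nat -> nat;
  rmem : nat -> R;
  tape : seq R }.

Definition update (T : Type) (m : nat -> T) (a : nat) (x : T) : nat -> T :=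
  fun b => if b == a then x else m b.

(* NSub is truncated subtraction. *)
Fixpoint neval (s : state) (e : nexp) : nat :=
  match e with
  | NNum k => k
  | NLoad e1 => nmem s (neval s e1)
  | NAdd e1 e2 => (neval s e1 + neval s e2)%N
  | NSub e1 e2 => (neval s e1 - neval s e2)%N
  end.

(* Division by zero returns 0. *)
Fixpoint reval (s : state) (e : rexp) : R :=
  match e with
  | RNat e1 => (neval s e1)%:R
  | RLoad e1 => rmem s (neval s e1)
  | RAdd e1 e2 => reval s e1 + reval s e2
  | RSub e1 e2 => reval s e1 - reval s e2
  | RMul e1 e2 => reval s e1 * reval s e2
  | RDiv e1 e2 => reval s e1 / reval s e2
  end.

Definition teval (s : state) (b : test) : bool :=
  match b with
  | NLt e1 e2 => (neval s e1 < neval s e2)%N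
  | RLt e1 e2 => reval s e1 < reval s e2
  end.

(* exec c s t s': started in s, the command c terminates in s' after t unit
   operations. *)
Inductive exec : cmd -> state -> nat -> state -> Prop :=
| ExecSkip s : exec Skip s 1 s
| ExecNStore a e s :
    exec (NStore a e) s (ncost a + ncost e).+1
      (State (update (nmem s) (neval s a) (neval s e)) (rmem s) (tape s))
| ExecRStore a e s :
    exec (RStore a e) s (ncost a + rcost e).+1
      (State (nmem s) (update (rmem s) (neval s a) (reval s e)) (tape s))
| ExecWrite e s :
    exec (Write e) s (rcost e).+1
      (State (nmem s) (rmem s) (rcons (tape s) (reval s e)))
| ExecSeq c1 c2 s1 s2 s3 t1 t2 :
    exec c1 s1 t1 s2 -> exec c2 s2 t2 s3 ->
    exec (Seq c1 c2) s1 (t1 + t2) s3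
| ExecIf b c1 c2 s t s' :
    exec (if teval s b then c1 else c2) s t s' ->
    exec (If b c1 c2) s (tcost b + t) s'
| ExecWhileDone b c s :
    ~~ teval s b -> exec (While b c) s (tcost b) s
| ExecWhileStep b c s1 s2 s3 t1 t2 :
    teval s1 b -> exec c s1 t1 s2 -> exec (While b c) s2 t2 s3 ->
    exec (While b c) s1 (tcost b + t1 + t2) s3.

Variables d n : nat.

(* Real memory on input: eps, followed for each point by its d coordinates and
   its presence probability, then zeros. *)
Definition input_reals (eps : R) (v : 'I_n -> 'rV[R]_d) (p : 'I_n -> R)
  : seq R :=
  eps :: flatten [seq rcons [seq v i 0 j | j <- enum 'I_d] (p i)
                 | i <- enum 'I_n].

(* Cell 0 of the natural-number memory holds n; everything else is 0. *)
Definition initial_state eps v p : state :=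
  State (fun a => if a == 0%N then n else 0%N)
        (nth 0 (input_reals eps v p)) [::].

Definition coordinates (S : seq 'rV[R]_d) : seq R :=
  flatten [seq [seq q 0 j | j <- enum 'I_d] | q : 'rV[R]_d <- S].

(* On input (eps, v, p), prog halts after t unit operations, having written
   the points of S one after the other. *)
Definition outputs_in (prog : cmd) eps v p (S : seq 'rV[R]_d) (t : nat)
  : Prop :=
  exists2 s : state,
    exec prog (initial_state eps v p) t s & tape s = coordinates S.

End Semantics.

(* Main.v *)
(* The expected width w is the support function of a symmetric convex body K,
   and sorting the points by <u, .> gives a point of K extreme in direction u in
   O(n log n) time.  A Gauss-Jordan elimination driven by at most d such points
   produces functionals a_1, ..., a_d in whose coordinates K lies between the
   unit cross-polytope and a cube of side O(2^d), up to directions in which K is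
   flat.  In these coordinates it suffices to treat the directions
   u_t = a_i + sum_l t_l a_l with t in [-1, 1]^(d-1).  Let x_t be extreme for
   u_t.  For t in a grid of step O(eps), the pairs (t, x_t) are distributed over
   O(eps^(-(d-1)/2)) cells of side O(sqrt eps) by the vector with entries
   t_l + <a_l, x_t>, and one sample is kept per cell: if t and t' share a cell
   then <u_t, x_t - x_t'> <= sum_l (t_l - t'_l) <a_l, x_t - x_t'>, which is at
   most a quarter of the squared distance of the two vectors, that is O(eps).
   Since t_l + <a_l, x_t> is nondecreasing along the l-th axis of the grid, a
   walk along the grid lines finds all cell numbers in amortised constant time,
   with neither a floor function nor a logarithmic factor.  The kernel consists
   of the points x/2 and -x/2 for the samples x kept; it lies in K/2, hence its
   width never exceeds w. *)

Require Import Defs.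
From mathcomp Require Import all_boot all_order all_algebra.
From mathcomp Require Import all_reals exp.
From mathcomp Require Import boolp zify ring lra.

Set Implicit Arguments.
Unset Strict Implicit.
Unset Printing Implicit Defensive.

Import Order.TTheory GRing.Theory Num.Theory.
Local Open Scope ring_scope.

(** One sort yields a point of K because, for a fixed order of the points, the expected value of a
    functional at the last present point is linear in the functional: a single scan produces a
    vector whose product with any direction is at most the expected maximum, with equality in the
    sorted direction. An error O(eps) on the directions u_t is a relative one, since a dual body
    point has product 1 with every direction of the face, so that w is at least 1 there; this is
    what the cross-polytope provides. Bucketing the directions t alone, or the points x_t alone,
    with side sqrt eps would only bound the error by order sqrt eps, and bucketing both would square
    the number of cells. The sum of the two suffices because 4 s y is at most (s + y)^2, whatever
    the individual sizes of s and y. The powers of 2 come from the elimination, each step of which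
    at most doubles the widths of the functionals already normalised. Flat directions cannot be
    excluded, as K is flat whenever there are at most d points. *)

(** * Programs and their cost *)

(* Bounds the cost of a command only if the command is loop-free. *)
Fixpoint fcost (c : cmd) : nat :=
  match c with
  | Skip => 1
  | NStore a e => (ncost a + ncost e).+1
  | RStore a e => (ncost a + rcost e).+1
  | Write e => (rcost e).+1
  | Seq c1 c2 => fcost c1 + fcost c2
  | If b c1 c2 => tcost b + (fcost c1 + fcost c2)
  | While b c => 0
  end.

(** The language has no product of naturals; a multiple by a constant of the program is unrolled
    into additions. *)
Definition nmul (k : nat) (e : nexp) : nexp := iter k (NAdd e) (NNum 0).

(** Loops whose range depends only on the dimension are unrolled in the program text, so their index
    is a constant of the program and needs no memory. *)
Definition seqc (k : nat) (f : nat -> cmd) : cmd :=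
  foldr Seq Skip [seq f i | i <- iota 0 k].

Definition rsum (k : nat) (f : nat -> rexp) : rexp :=
  foldr RAdd (RNat (NNum 0)) [seq f i | i <- iota 0 k].

(* Both memories are viewed as 16 interleaved unbounded arrays: entry i of
   array r is cell 1 + r + 16 i of the natural-number memory, resp. cell
   1 + n (d + 1) + r + 16 i of the real memory, beyond the input. *)
Definition naddr (r : nat) (e : nexp) : nexp := NAdd (NNum r.+1) (nmul 16 e).
Definition nget (r : nat) (e : nexp) : nexp := NLoad (naddr r e).
Definition nset (r : nat) (e1 e2 : nexp) : cmd := NStore (naddr r e1) e2.

Section Addresses.
Variable d : nat.

Definition raddr (r : nat) (e : nexp) : nexp :=
  NAdd (NNum r.+1) (NAdd (nmul d.+1 (NLoad (NNum 0))) (nmul 16 e)).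
Definition rget (r : nat) (e : nexp) : rexp := RLoad (raddr r e).
Definition rset (r : nat) (e1 : nexp) (e2 : rexp) : cmd :=
  RStore (raddr r e1) e2.
(** Cell 0 of the input is [eps], whence the offset [k.+1]; [k = d] addresses the probability of the
    point. *)
Definition inget (e : nexp) (k : nat) : rexp :=
  RLoad (NAdd (NNum k.+1) (nmul d.+1 e)).
Definition vset (r : nat) (e : nexp) (f : nat -> rexp) : cmd :=
  seqc d (fun k => rset r (NAdd e (NNum k)) (f k)).

End Addresses.

Opaque nmul.

(** * Cost-bounded triples for the real RAM *)

Section Machine.
Variables (R : realType) (d n : nat) (inp : nat -> R).

Record astate : Type := AState {
  nm : nat -> nat -> nat;
  rm : nat -> nat -> R;
  tp : seq R }.

(** No abstract update can reach the cell of [n] or the input reals, so these are parameters of the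
    machine and not components of its state. *)
Definition conc (s : astate) : state R :=
  State (fun a => if a is b.+1 then nm s (b %% 16) (b %/ 16) else n)
        (fun a => if (a < (n * d.+1).+1)%N then inp a
                  else rm s ((a - (n * d.+1).+1) %% 16)
                            ((a - (n * d.+1).+1) %/ 16))
        (tp s).

Definition setN r i x (s : astate) : astate :=
  AState (fun r' i' => if (r' == r) && (i' == i) then x else nm s r' i')
         (rm s) (tp s).
Definition setR r i x (s : astate) : astate :=
  AState (nm s)
         (fun r' i' => if (r' == r) && (i' == i) then x else rm s r' i')
         (tp s).
Definition setV r i (g : nat -> R) (s : astate) : astate :=
  AState (nm s)
         (fun r' i' => if (r' == r) && (i <= i' < i + d)%N then g (i' - i)%N
                       else rm s r' i')
         (tp s).
Definition emit x (s : astate) : astate := AState (nm s) (rm s) (rcons (tp s) x).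

Implicit Types (s : astate) (P Q : astate -> Prop).

Lemma neval_nmul (st : state R) k e : neval st (nmul k e) = (k * neval st e)%N.
Proof.
Transparent nmul.
by elim: k => [|k IH] //=; rewrite mulSn -IH.
Opaque nmul.
Qed.

Lemma neval_nget s r e : (r < 16)%N ->
  neval (conc s) (nget r e) = nm s r (neval (conc s) e).
Proof.
move=> hr; rewrite /nget /naddr [LHS]/= neval_nmul.
by congr nm; lia.
Qed.

Lemma raddr_ge s r e :
  neval (conc s) (raddr d r e) =
    ((n * d.+1).+1 + (r + 16 * neval (conc s) e))%N.
Proof. by rewrite /raddr /= !neval_nmul /=; lia. Qed.

Lemma reval_rget s r e : (r < 16)%N ->
  reval (conc s) (rget d r e) = rm s r (neval (conc s) e).
Proof.
move=> hr; rewrite -[LHS]/(rmem (conc s) (neval (conc s) (raddr d r e))).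
rewrite raddr_ge /= ltnNge leq_addr /= addKn.
by congr rm; lia.
Qed.

Lemma reval_inget s e k : (neval (conc s) e < n)%N -> (k < d.+1)%N ->
  reval (conc s) (inget d e k) = inp (d.+1 * neval (conc s) e + k.+1)%N.
Proof.
move=> hi hk; rewrite /inget [LHS]/= neval_nmul /= ifT; last by nia.
by congr inp; lia.
Qed.

Lemma reval_rsum (st : state R) k f :
  reval st (rsum k f) = \sum_(i < k) reval st (f i).
Proof.
rewrite -(big_mkord xpredT (fun i => reval st (f i))) /index_iota subn0 /rsum.
by elim: (iota 0 k) => [|i l IH]; rewrite ?big_nil //= big_cons IH.
Qed.

(** A total-correctness triple with an upper bound on the running time; the exact time is hidden, so
    that bounds may be rounded up freely. *)
Definition tri (c : cmd) (T : nat) Q s : Prop :=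
  exists s' t, [/\ exec c (conc s) t (conc s'), (t <= T)%N & Q s'].

Lemma tri_weaken c T T' Q Q' s :
  tri c T Q s -> (T <= T')%N -> (forall s', Q s' -> Q' s') -> tri c T' Q' s.
Proof.
move=> [s' [t [h1 h2 h3]]] hT hQ; exists s', t.
by split; [|exact: leq_trans hT|exact: hQ].
Qed.

Lemma tri_skip T Q s : (1 <= T)%N -> Q s -> tri Skip T Q s.
Proof. by move=> hT h; exists s, 1%N; split=> //; apply: ExecSkip. Qed.

Lemma tri_seq c1 c2 T1 T2 Q s :
  tri c1 T1 (tri c2 T2 Q) s -> tri (Seq c1 c2) (T1 + T2) Q s.
Proof.
move=> [s1 [t1 [h1 l1 [s2 [t2 [h2 l2 h]]]]]].
by exists s2, (t1 + t2)%N; split=> //; [exact: ExecSeq h1 h2|exact: leq_add].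
Qed.

(** Charging both branches agrees with [fcost] and makes the bound independent of the outcome of the
    test. *)
Lemma tri_if b c1 c2 T1 T2 Q s :
  (teval (conc s) b -> tri c1 T1 Q s) ->
  (teval (conc s) b = false -> tri c2 T2 Q s) ->
  tri (If b c1 c2) (tcost b + (T1 + T2)) Q s.
Proof.
move=> h1 h2.
have [s' [t [ex lt q]]] :
    tri (if teval (conc s) b then c1 else c2) (T1 + T2) Q s.
  case E : (teval _ b).
  - by apply: tri_weaken (h1 E) _ _ => //; rewrite leq_addr.
  - by apply: tri_weaken (h2 E) _ _ => //; rewrite leq_addl.
exists s', (tcost b + t)%N; split=> //; last by rewrite leq_add2l.
exact: ExecIf.
Qed.

Lemma tri_nset r e1 e2 Q s : (r < 16)%N ->
  Q (setN r (neval (conc s) e1) (neval (conc s) e2) s) ->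
  tri (nset r e1 e2) (fcost (nset r e1 e2)) Q s.
Proof.
move=> hr h; exists (setN r (neval (conc s) e1) (neval (conc s) e2) s).
exists (fcost (nset r e1 e2)); split=> //.
have -> : conc (setN r (neval (conc s) e1) (neval (conc s) e2) s) =
  State (update (nmem (conc s)) (neval (conc s) (naddr r e1))
           (neval (conc s) e2)) (rmem (conc s)) (tape (conc s)).
  rewrite /conc /=; congr State; apply/funext => -[|a]; rewrite /update /=.
    by [].
  rewrite neval_nmul /=; set x := neval _ e1.
  by congr (if _ then _ else _); apply/andP/eqP => [[/eqP a1 /eqP a2]|]; lia.
exact: ExecNStore.
Qed.

Lemma tri_rset r e1 e2 Q s : (r < 16)%N ->
  Q (setR r (neval (conc s) e1) (reval (conc s) e2) s) ->
  tri (rset d r e1 e2) (fcost (rset d r e1 e2)) Q s.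
Proof.
move=> hr h; exists (setR r (neval (conc s) e1) (reval (conc s) e2) s).
exists (fcost (rset d r e1 e2)); split=> //.
have -> : conc (setR r (neval (conc s) e1) (reval (conc s) e2) s) =
  State (nmem (conc s)) (update (rmem (conc s)) (neval (conc s) (raddr d r e1))
           (reval (conc s) e2)) (tape (conc s)).
  rewrite {1}/conc; congr State; apply/funext => a; rewrite /update.
  rewrite raddr_ge /=; set x := neval _ e1; case: ltnP => ha.
    by rewrite ifF //; apply/eqP; lia.
  by congr (if _ then _ else _); apply/andP/eqP => [[/eqP a1 /eqP a2]|]; lia.
exact: ExecRStore.
Qed.

Lemma tri_write e Q s : Q (emit (reval (conc s) e) s) ->
  tri (Write e) (fcost (Write e)) Q s.
Proof.
move=> h; exists (emit (reval (conc s) e) s), (fcost (Write e)); split=> //.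
exact: ExecWrite.
Qed.

(** The invariant is indexed by the number of completed iterations, whose total is known beforehand,
    so termination is part of the rule. The isolated [tcost b] pays for the failing test. *)
Lemma tri_while b c N (P : nat -> astate -> Prop) (T : nat -> nat) s :
  P 0%N s ->
  (forall k s', (k < N)%N -> P k s' ->
     teval (conc s') b /\ tri c (T k) (P k.+1) s') ->
  (forall s', P N s' -> teval (conc s') b = false) ->
  tri (While b c) (\sum_(k < N) (tcost b + T k) + tcost b) (P N) s.
Proof.
elim: N P T s => [|N IH] P T s h0 hS hN.
  exists s, (tcost b); split=> //; last by rewrite leq_addl.
  by apply: ExecWhileDone; rewrite hN.
have [hb [s1 [t1 [e1 l1 p1]]]] := hS 0%N s isT h0.
have [s2 [t2 [e2 l2 p2]]] := IH (fun k => P k.+1) (fun k => T k.+1) s1 p1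
   (fun k s' hk hP => hS k.+1 s' hk hP) hN.
exists s2, (tcost b + t1 + t2)%N; split=> //; first exact: ExecWhileStep e1 e2.
rewrite big_ord_recl -!addnA leq_add2l leq_add //.
Qed.

Lemma tri_whileC b c N (P : nat -> astate -> Prop) T s :
  P 0%N s ->
  (forall k s', (k < N)%N -> P k s' ->
     teval (conc s') b /\ tri c T (P k.+1) s') ->
  (forall s', P N s' -> teval (conc s') b = false) ->
  tri (While b c) ((tcost b + T) * N.+1) (P N) s.
Proof.
move=> h0 h1 h2; apply: tri_weaken (tri_while (T := fun=> T) h0 h1 h2) _ _ => //.
by rewrite sum_nat_const card_ord; lia.
Qed.

Lemma tri_while_step b c T1 T2 Q s : teval (conc s) b ->
  tri c T1 (tri (While b c) T2 Q) s -> tri (While b c) (tcost b + T1 + T2) Q s.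
Proof.
move=> hb [s1 [t1 [e1 l1 [s2 [t2 [e2 l2 h]]]]]].
exists s2, (tcost b + t1 + t2)%N; split=> //; first exact: ExecWhileStep e1 e2.
by rewrite leq_add // leq_add2l.
Qed.

Lemma tri_while_done b c Q s : teval (conc s) b = false -> Q s ->
  tri (While b c) (tcost b) Q s.
Proof. by move=> hb h; exists s, (tcost b); split=> //; apply: ExecWhileDone; rewrite hb. Qed.

Lemma tri_seqc_from m k f (P : nat -> astate -> Prop) (T : nat -> nat) s :
  P m s ->
  (forall i s', (m <= i < m + k)%N -> P i s' -> tri (f i) (T i) (P i.+1) s') ->
  tri (foldr Seq Skip [seq f i | i <- iota m k])
      (\sum_(i <- iota m k) T i + 1) (P (m + k)%N) s.
Proof.
elim: k m s => [|k IH] m s h0 hS.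
  by rewrite big_nil addn0; apply: tri_skip.
rewrite /= big_cons -addnA; apply: tri_seq.
apply: tri_weaken (hS m s _ h0) _ _; [by lia|by []|] => s' h1.
rewrite -(addSnnS m k); apply: IH => // i s'' hi; apply: hS; lia.
Qed.

Lemma tri_seqc k f (P : nat -> astate -> Prop) (T : nat -> nat) s :
  P 0%N s ->
  (forall i s', (i < k)%N -> P i s' -> tri (f i) (T i) (P i.+1) s') ->
  tri (seqc k f) (\sum_(i <- iota 0 k) T i + 1) (P k) s.
Proof. by move=> h0 hS; apply: tri_seqc_from. Qed.

Lemma fcost_seqc k f :
  fcost (seqc k f) = (\sum_(i <- iota 0 k) fcost (f i) + 1)%N.
Proof.
rewrite /seqc; elim: (iota 0 k) => [|i l IH]; rewrite ?big_nil //=.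
by rewrite big_cons IH addnA.
Qed.

(** The expression for entry [k] is evaluated when entries below [k] have already been overwritten.
    The hypothesis therefore guarantees only the other arrays and the entries before the block or
    from [k] on, which still permits updates in place. *)
Lemma tri_vset r e f (g : nat -> R) Q s : (r < 16)%N ->
  (forall k s', (k < d)%N -> nm s' = nm s ->
     (forall r' i', (r' != r) || (i' < neval (conc s) e)%N
        || (neval (conc s) e + k <= i')%N -> rm s' r' i' = rm s r' i') ->
     reval (conc s') (f k) = g k) ->
  Q (setV r (neval (conc s) e) g s) ->
  tri (vset d r e f) (fcost (vset d r e f)) Q s.
Proof.
move=> hr hf hQ; rewrite fcost_seqc.
(* The base address is evaluated anew for each entry, but it reads naturals only and these writes
   are to reals. *)
have en s' : nm s' = nm s -> neval (conc s') e = neval (conc s) e.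
  move=> E; rewrite /conc E.
  by elim: (e) => //= [e1 -> //|e1 -> e2 ->|e1 -> e2 ->].
have [i0 Ei] : exists i0, neval (conc s) e = i0 by eexists.
rewrite {}Ei in hf hQ en *.
pose W k := AState (nm s)
  (fun r' i' => if (r' == r) && (i0 <= i' < i0 + k)%N then g (i' - i0)%N
                else rm s r' i') (tp s).
have step i s' : (i < d)%N -> s' = W i ->
  tri (rset d r (NAdd e (NNum i)) (f i))
     (fcost (rset d r (NAdd e (NNum i)) (f i))) (fun s'' => s'' = W i.+1) s'.
  move=> hi ->; apply: tri_rset => //.
  have -> : reval (conc (W i)) (f i) = g i.
    by apply: hf => // r' i' h /=; case: ifP => // ?; lia.
  rewrite /= en // /setR /W; congr AState.
  apply/funext => r'; apply/funext => i'; move: r' i' => r' i' /=.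
  move: (r' : nat) => {}r'.
  have [->|/negPf ne] := eqVneq r' r; last by [].
  have [->|/negPf ni] := eqVneq i' (i0 + i)%N; rewrite ?eqxx ?ni /=.
    by rewrite ifT ?addKn //; lia.
  by rewrite addnS ltnS (leq_eqVlt i') ni.
have h0 : s = W 0%N.
  by rewrite /W; case: (s) => a b c /=; congr AState; apply/funext => q; apply/funext => k;
    rewrite addn0; case: ifP => // /andP[_ /andP[]]; lia.

apply: tri_weaken (tri_seqc (P := fun k s' => s' = W k) h0 step) _ _ => // s' ->.
exact: hQ.
Qed.

End Machine.

Opaque naddr nget nset raddr rget rset inget vset seqc rsum.

Ltac ev := rewrite /=; do ? (rewrite !(neval_nget, reval_rget) //=).

(** * Sorting in O(n log n) *)

Local Notation tmp k := (nget 1 (NNum k)).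
Local Notation tmpset k e := (nset 1 (NNum k) e).

Section MergeSort.
Variables (R : realType) (d n : nat) (inp : nat -> R).
Local Notation tri := (tri d n inp).
Local Notation conc := (conc d n inp).
Implicit Types (s : astate R).

(* Array 3 of the real memory holds the keys.  Temporaries 0 .. 1 and 2 .. 3
   delimit the two runs to be merged, temporary 4 is the end of the output. *)
Definition take_run (k : nat) : cmd :=
  Seq (nset 4 (tmp 4) (nget 4 (tmp k)))
 (Seq (tmpset k (NAdd (tmp k) (NNum 1)))
      (tmpset 4 (NAdd (tmp 4) (NNum 1)))).

Definition merge_body : cmd :=
  If (NLt (tmp 0) (tmp 1))
    (If (NLt (tmp 2) (tmp 3))
      (If (RLt (rget d 3 (nget 4 (tmp 2))) (rget d 3 (nget 4 (tmp 0))))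
         (take_run 2) (take_run 0))
      (take_run 0))
    (take_run 2).

Definition merge_test : test :=
  NLt (NNum 0) (NAdd (NSub (tmp 1) (tmp 0)) (NSub (tmp 3) (tmp 2))).
Definition merge_loop : cmd := While merge_test merge_body.

Definition seg s (a k : nat) : seq nat := [seq nm s 4 i | i <- iota a k].

Lemma segS s a k : seg s a k.+1 = nm s 4 a :: seg s a.+1 k.
Proof. by []. Qed.

Lemma size_seg s a k : size (seg s a k) = k.
Proof. by rewrite size_map size_iota. Qed.

Lemma eq_seg s s' a k :
  (forall i, (a <= i < a + k)%N -> nm s' 4 i = nm s 4 i) ->
  seg s' a k = seg s a k.
Proof. by move=> h; apply/eq_in_map => i; rewrite mem_iota => /h. Qed.

Definition key_le (kf : nat -> R) : rel nat := fun x y => kf x <= kf y.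

Lemma take_runP k Q s :
  Q (setN 1 4 (nm s 1 4).+1 (setN 1 k (nm s 1 k).+1
      (setN 4 (nm s 1 4) (nm s 4 (nm s 1 k)) s))) -> (k < 4)%N ->
  tri (take_run k) (fcost (take_run k)) Q s.
Proof.
move=> h hk; apply: tri_seq; apply: tri_nset => //.
apply: tri_seq; apply: tri_nset => //; apply: tri_nset => //.
have e4 : (4 == k) = false by apply/eqP; lia.
by rewrite /= !neval_nget //= ?e4 !addn1.
Qed.

Record merge_post s (l : seq nat) s' : Prop := MergePost {
  merge_seg : seg s' (nm s 1 4) (size l) = l;
  merge_ptr : nm s' 1 4 = (nm s 1 4 + size l)%N;
  merge_below : forall i, (i < nm s 1 4)%N -> nm s' 4 i = nm s 4 i;
  merge_tmp : forall i, (4 < i)%N -> nm s' 1 i = nm s 1 i;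
  merge_nm : forall r i, r != 1%N -> r != 4%N -> nm s' r i = nm s r i;
  merge_rm : rm s' = rm s;
  merge_tp : tp s' = tp s }.

Lemma merge_post_cons k x l s s' : (k < 4)%N -> nm s 4 (nm s 1 k) = x ->
  merge_post (setN 1 4 (nm s 1 4).+1 (setN 1 k (nm s 1 k).+1
      (setN 4 (nm s 1 4) (nm s 4 (nm s 1 k)) s))) l s' ->
  merge_post s (x :: l) s'.
Proof.
move=> hk ex []; rewrite /= => e1 e2 e3 e4 e5 e6 e7; split=> //=.
- by rewrite segS e1 e3 // eqxx ex.
- by rewrite e2 addnS.
- by move=> i hi; rewrite e3 /= ?(ltn_eqF hi) // leqW.
- move=> i hi; rewrite e4 //= ifF; last by apply/eqP; lia.
  by rewrite ifF //; apply/eqP; lia.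
- by move=> r i /negPf h1 /negPf h4; rewrite e5 ?h1 ?h4 //= h1 h4.
Qed.

Definition merge_const := (tcost merge_test + fcost merge_body)%N.

(** The output pointer starts at or beyond the ends of both runs, so no unread entry is overwritten.
    Each iteration outputs one entry, which makes the cost linear in the total length. *)
Lemma merge_loopP kf l1 l2 s :
  rm s 3%N = kf ->
  seg s (nm s 1 0) (size l1) = l1 -> seg s (nm s 1 2) (size l2) = l2 ->
  nm s 1 1 = (nm s 1 0 + size l1)%N -> nm s 1 3 = (nm s 1 2 + size l2)%N ->
  (nm s 1 1 <= nm s 1 4)%N -> (nm s 1 3 <= nm s 1 4)%N ->
  tri merge_loop (merge_const * (size l1 + size l2).+1)
      (merge_post s (merge (key_le kf) l1 l2)) s.
Proof.
have [N] := ubnP (size l1 + size l2); elim: N l1 l2 s => // N IH l1 l2 s.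
rewrite ltnS => hN kE s1 s2 m1 m3 p1 p3.
have [hz|hpos] := posnP (size l1 + size l2).
  move/eqP: hz; rewrite addn_eq0 !size_eq0 => /andP[/eqP z1 /eqP z2]; subst.
  apply: (@tri_weaken _ _ _ _ _ (tcost merge_test) _ (merge_post s [::])).
  - apply: tri_while_done.
      by rewrite /merge_test /= !neval_nget //= m1 m3 !addn0 !subnn.
    by split=> //=; rewrite addn0.
  - by rewrite muln1 leq_addr.
  - by [].
have hc : (merge_const * (size l1 + size l2).+1 =
   tcost merge_test + fcost merge_body + merge_const * (size l1 + size l2))%N.
  by rewrite mulnS.
rewrite hc; apply: tri_while_step.
  by rewrite /merge_test /= !neval_nget //= m1 m3 !addKn.
pose A1 := setN 1 4 (nm s 1 4).+1 (setN 1 0 (nm s 1 0).+1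
      (setN 4 (nm s 1 4) (nm s 4 (nm s 1 0)) s)).
pose A2 := setN 1 4 (nm s 1 4).+1 (setN 1 2 (nm s 1 2).+1
      (setN 4 (nm s 1 4) (nm s 4 (nm s 1 2)) s)).
have step1 x l : l1 = x :: l ->
    merge (key_le kf) l1 l2 = x :: merge (key_le kf) l l2 ->
    tri (take_run 0) (fcost (take_run 0)) (tri merge_loop
      (merge_const * (size l1 + size l2)) (merge_post s (merge (key_le kf) l1 l2))) s.
  move=> E ->; subst; move: s1; rewrite /= segS => -[ex es].
  move: p1 m1 hN => /=; rewrite addnS => p1 m1 hN.
  apply: take_runP => //.
  apply: tri_weaken (IH l l2 A1 _ _ _ _ _ _ _ _) _ _ => //=; try lia.
  + by rewrite -[RHS]es; apply: eq_seg => i hi /=; rewrite ifF //; apply/eqP; lia.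
  + by rewrite -[RHS]s2; apply: eq_seg => i hi /=; rewrite ifF //; apply/eqP; lia.
  + by move=> s'; apply: merge_post_cons.
have step2 x l : l2 = x :: l ->
    merge (key_le kf) l1 l2 = x :: merge (key_le kf) l1 l ->
    tri (take_run 2) (fcost (take_run 2)) (tri merge_loop
      (merge_const * (size l1 + size l2)) (merge_post s (merge (key_le kf) l1 l2))) s.
  move=> E ->; subst; move: s2; rewrite /= segS => -[ex es].
  move: p3 m3 hN => /=; rewrite !addnS => p3 m3 hN.
  apply: take_runP => //.
  apply: tri_weaken (IH l1 l A2 _ _ _ _ _ _ _ _) _ _ => //=; try lia.
  + by rewrite -[RHS]s1; apply: eq_seg => i hi /=; rewrite ifF //; apply/eqP; lia.
  + by rewrite -[RHS]es; apply: eq_seg => i hi /=; rewrite ifF //; apply/eqP; lia.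
  + by move=> s'; apply: merge_post_cons.
apply: tri_if; rewrite /= !neval_nget //=.
- move=> h1; apply: tri_if; rewrite /= !neval_nget //=.
  + move=> h2; apply: tri_if; rewrite /= !reval_rget // !neval_nget //= kE.
    * case: l2 s2 m3 p3 h2 step2 {hN hpos hc step1} => [|y l2];
        first by rewrite /= addn0 => ? ->; rewrite ltnn.
      case: l1 s1 m1 p1 h1 => [|x l1];
        first by rewrite /= addn0 => ? ->; rewrite ltnn.
      rewrite /= !segS => -[-> _] m1 p1 h1 [-> _] m3 p3 h2 step2 lt.
      by apply: (step2 y l2) => //=; rewrite /key_le leNgt lt.
    * case: l1 s1 m1 p1 h1 step1 {hN hpos hc step2} => [|x l1];
        first by rewrite /= addn0 => ? ->; rewrite ltnn.
      case: l2 s2 m3 p3 h2 => [|y l2];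
        first by rewrite /= addn0 => ? ->; rewrite ltnn.
      rewrite /= !segS => -[-> _] m3 p3 h2 [-> _] m1 p1 h1 step1 lt.
      by apply: (step1 x l1) => //=; rewrite /key_le leNgt lt.
  + move=> h2.
    case: l1 s1 m1 p1 h1 step1 {hN hpos hc step2} => [|x l1];
      first by rewrite /= addn0 => ? ->; rewrite ltnn.
    case: l2 s2 m3 p3 h2 => [|y l2] s2 m3 p3 h2; last by move: h2; rewrite m3 /=; lia.
    by move=> _ _ _ _ step1; apply: (step1 x l1) => //=; case: (l1).
- move=> h1.
  case: l1 s1 m1 p1 h1 hpos hc step2 {hN step1} => [|x l1] s1 m1 p1 h1 hpos hc; last by move: h1; rewrite m1 /=; lia.
  case: l2 s2 m3 p3 hpos hc => [|y l2] // s2 m3 p3 hpos hc step2.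
  by apply: (step2 y l2).
Qed.

End MergeSort.

Section Sort.
Variables (R : realType) (d n : nat) (inp : nat -> R).
Local Notation tri := (tri d n inp).
Local Notation conc := (conc d n inp).
Implicit Types (s : astate R).

(* The runs form a binary tree whose nodes are numbered 1 .. 2n - 1: node
   n + i is the one-element run i, and node m < n merges 2m and 2m + 1.  Run m
   is stored in array 4 from entry (array 2)[m] on; (array 3)[m] is its length. *)
Definition leaf_body : cmd :=
  Seq (nset 4 (tmp 5) (tmp 5))
 (Seq (nset 2 (NAdd (NLoad (NNum 0)) (tmp 5)) (tmp 5))
 (Seq (nset 3 (NAdd (NLoad (NNum 0)) (tmp 5)) (NNum 1))
      (tmpset 5 (NAdd (tmp 5) (NNum 1))))).
Definition leaf_test : test := NLt (tmp 5) (NLoad (NNum 0)).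
Definition leaf_loop : cmd := While leaf_test leaf_body.

Definition lch : nexp := NAdd (tmp 5) (tmp 5).
Definition rch : nexp := NAdd lch (NNum 1).

Definition node_setup : cmd :=
  Seq (tmpset 5 (NSub (tmp 5) (NNum 1)))
 (Seq (tmpset 0 (nget 2 lch))
 (Seq (tmpset 1 (NAdd (nget 2 lch) (nget 3 lch)))
 (Seq (tmpset 2 (nget 2 rch))
 (Seq (tmpset 3 (NAdd (nget 2 rch) (nget 3 rch)))
 (Seq (nset 2 (tmp 5) (tmp 4))
      (nset 3 (tmp 5) (NAdd (nget 3 lch) (nget 3 rch)))))))).
Definition node_test : test := NLt (NNum 1) (tmp 5).
Definition node_loop : cmd := While node_test (Seq node_setup (merge_loop d)).

Definition sort_init : cmd :=
  Seq (tmpset 4 (NLoad (NNum 0))) (tmpset 5 (NLoad (NNum 0))).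

Definition sort_cmd : cmd :=
  Seq (tmpset 5 (NNum 0)) (Seq leaf_loop (Seq sort_init node_loop)).

Definition run_of s m := seg s (nm s 2 m) (nm s 3 m).

Definition sort_frame s0 s :=
  [/\ forall r i, r \notin [:: 1; 2; 3; 4]%N -> nm s r i = nm s0 r i,
      rm s = rm s0 & tp s = tp s0].

(** When the nodes from [k] on are built, the roots of the resulting forest are [k .. 2k - 1]; their
    runs together contain every point once. The bound on [m * nm s 3 m] is the depth information
    needed for the cost, and holds for every [n], power of two or not. *)
Record tree_inv s0 (k : nat) s : Prop := TreeInv {
  tree_node : nm s 1 5 = k;
  tree_run : forall m, (k <= m < n + n)%N ->
    [/\ sorted (key_le (rm s0 3)) (run_of s m),
        (nm s 2 m + nm s 3 m <= nm s 1 4)%N & (m * nm s 3 m <= n + n)%N];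
  tree_perm : perm_eq (flatten [seq run_of s m | m <- iota k k]) (iota 0 n);
  tree_frame : sort_frame s0 s }.

Lemma leaf_loopP s0 s : sort_frame s0 s -> nm s 1 5 = 0%N ->
  tri leaf_loop ((tcost leaf_test + fcost leaf_body) * n.+1)
    (fun s' => [/\ sort_frame s0 s',
       forall i, (i < n)%N -> nm s' 4 i = i &
       forall i, (i < n)%N -> nm s' 2 (n + i) = i /\ nm s' 3 (n + i) = 1%N]) s.
Proof.
move=> fr h5.
apply: tri_weaken (tri_whileC (N := n) (P := fun k s' =>
   [/\ nm s' 1 5 = k, sort_frame s0 s',
       forall i, (i < k)%N -> nm s' 4 i = i &
       forall i, (i < k)%N -> nm s' 2 (n + i) = i /\ nm s' 3 (n + i) = 1%N]) _ _ _) _ _.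
- by split.
- move=> k s' hk [e5 [f1 f2 f3] g1 g2]; split.
    by rewrite /= neval_nget //= e5.
  do 3! (apply: tri_seq; apply: tri_nset => //); apply: tri_nset => //.
  ev; rewrite !e5 !addn1; split=> /=; rewrite ?e5 //.
  + split=> //= r i; rewrite !inE !negb_or => /and4P[/negPf h1 /negPf h2 /negPf h3 /negPf h4].
    by rewrite h1 h2 h3 h4 /= f1 // !inE h1 h2 h3 h4.
  + by move=> i; rewrite ltnS leq_eqVlt => /orP[/eqP ->|hi]; rewrite ?eqxx // (ltn_eqF hi) g1.
  + move=> i; rewrite ltnS leq_eqVlt => /orP[/eqP ->|hi]; rewrite ?eqxx //.
    by rewrite eqn_add2l (ltn_eqF hi); apply: g2.
- by move=> s' [e5 _ _ _]; rewrite /= neval_nget //= e5 ltnn.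
- by [].
- by move=> s' [].
Qed.

Lemma flatten_seq1 (T : Type) (l : seq T) : flatten [seq [:: x] | x <- l] = l.
Proof. by elim: l => //= x l ->. Qed.

Lemma tree_init s0 s : (0 < n)%N ->
   sort_frame s0 s -> (forall i, (i < n)%N -> nm s 4 i = i) ->
   (forall i, (i < n)%N -> nm s 2 (n + i) = i /\ nm s 3 (n + i) = 1%N) ->
   tri sort_init (fcost sort_init) (tree_inv s0 n) s.
Proof.
move=> n0 fr h4 h23; apply: tri_seq; apply: tri_nset => //; apply: tri_nset => //.
set s1 := setN _ _ _ _.
have runE m : (n <= m < n + n)%N -> run_of s1 m = [:: (m - n)%N].
  move=> hm; have [a b] : nm s1 2 m = (m - n)%N /\ nm s1 3 m = 1%N.
    by have /= := h23 (m - n)%N; rewrite subnKC; [apply; lia|lia].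
  by rewrite /run_of a b /seg /= h4 //; lia.
split=> //.
- move=> m hm; rewrite runE //; have [a b] := h23 (m - n)%N ltac:(lia).
  by rewrite subnKC in a b; [rewrite /= a b; split=> //; lia|lia].
- rewrite (_ : [seq run_of s1 m | m <- iota n n] = [seq [:: x] | x <- iota 0 n]).
    by rewrite flatten_seq1.
  rewrite -[in LHS](addn0 n) iotaDl -map_comp addn0; apply/eq_in_map => i.
  by rewrite mem_iota /= => hi; rewrite runE ?addKn //; lia.
- case: fr => f1 f2 f3; split=> //= r i hr; rewrite f1 //.
  by case: (eqVneq r 1%N) hr => // ->.
Qed.

Definition node_const := (tcost node_test + fcost node_setup + merge_const d)%N.

(** Merging [2k] and [2k + 1] into [k] turns the roots [k + 1 .. 2k + 1] into [k .. 2k - 1]. *)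
Lemma tree_step s0 k s : (0 < k < n)%N -> tree_inv s0 k.+1 s ->
  tri (Seq node_setup (merge_loop d))
    (fcost node_setup + merge_const d * ((n + n) %/ k).+1) (tree_inv s0 k) s.
Proof.
move=> /andP[k0 kn] [e5 er ep [f1 f2 f3]].
apply: tri_seq; do 7! (try apply: tri_seq; apply: tri_nset => //).
ev; rewrite !e5 subn1 /= !addn1.
set s1 := setN 1 5 _ _; set s2 := setN 3 _ _ _.
have hl : (k.+1 <= k + k < n + n)%N by lia.
have hr : (k.+1 <= (k + k).+1 < n + n)%N by lia.
have [l1 l2 l3] := er _ hl; have [r1 r2 r3] := er _ hr.
have ek : ((k + k) == k) = false by apply/eqP; lia.
have ek1 : ((k + k).+1 == k) = false by apply/eqP; lia.
have e20 : nm s2 1 0 = nm s 2 (k + k) by [].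
have e21 : nm s2 1 1 = (nm s 2 (k + k) + nm s 3 (k + k))%N by [].
have e22 : nm s2 1 2 = nm s 2 (k + k).+1 by [].
have e23 : nm s2 1 3 = (nm s 2 (k + k).+1 + nm s 3 (k + k).+1)%N by [].
have e24 : nm s2 1 4 = nm s 1 4 by [].
have h := @merge_loopP R d n inp (rm s0 3%N) (run_of s (k + k)) (run_of s (k + k).+1) s2.
rewrite !size_seg in h.
(* With [l] and [l'] the two lengths, [2 k l <= 2 n] and [(2 k + 1) l' <= 2 n] add up to
   [k (l + l') <= 2 n]. *)
have hc : (nm s 3 (k + k) + nm s 3 (k + k).+1 <= (n + n) %/ k)%N.
  by rewrite leq_divRL //; nia.
apply: tri_weaken (h _ _ _ _ _ _ _) _ _ => //; rewrite ?f2 ?e20 ?e21 ?e22 ?e23 ?e24 //.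
  by rewrite leq_mul2l ltnS hc orbT.
move=> s' [m1 m2 m3 m4 m5 m6 m7].
rewrite e24 size_merge size_cat !size_seg in m1 m2.
rewrite e24 in m3.
have runk : run_of s' k = merge (key_le (rm s0 3)) (run_of s (k + k)) (run_of s (k + k).+1).
  by rewrite /run_of !m5 //= eqxx.
have [k2 k3] : nm s' 2 k = nm s 1 4 /\ nm s' 3 k = (nm s 3 (k + k) + nm s 3 (k + k).+1)%N.
  by rewrite !m5 /s2 //= eqxx.
have other m : (k < m)%N -> nm s' 2 m = nm s 2 m /\ nm s' 3 m = nm s 3 m.
  by move=> hm; rewrite !m5 //= gtn_eqF.
have runm m : (k < m < n + n)%N -> run_of s' m = run_of s m.
  move=> hm; have [o1 o2] := other m ltac:(lia); rewrite /run_of o1 o2.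
  by apply: eq_seg => i hi; rewrite m3 //; have [] := er _ hm; lia.
split.
- by rewrite m4.
- move=> m /andP[km mn]; move: km; rewrite leq_eqVlt => /orP[/eqP <-|km].
    rewrite runk k2 k3 m2; split=> //; last by nia.
    by apply: merge_sorted => // x y; apply: le_total.
  have [o1 o2] := other m km; rewrite runm ?km // o1 o2 m2.
  by have [] := er m ltac:(lia) => ? ? ?; split=> //; lia.
- apply: perm_trans ep.
  have -> : iota k k = k :: iota k.+1 k.-1 by case: (k) k0.
  have -> : iota k.+1 k.+1 = iota k.+1 k.-1 ++ [:: k + k; (k + k).+1]%N.
    rewrite [X in iota _ X = _](_ : _ = k.-1 + 2)%N; last by lia.
    by rewrite iotaD /=; congr (_ ++ [:: _; _]); lia.
  rewrite [X in perm_eq X]/= runk.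
  have -> : [seq run_of s' m | m <- iota k.+1 k.-1] = [seq run_of s m | m <- iota k.+1 k.-1].
    by apply/eq_in_map => m; rewrite mem_iota => hm; apply: runm; lia.
  rewrite map_cat flatten_cat /= cats0 perm_catC perm_cat2l.
  by rewrite perm_merge.
- split; [|by rewrite m6|by rewrite m7] => r i hr'.
  move: (hr'); rewrite !inE !negb_or => /and4P[q1 q2 q3 q4].
  by rewrite m5 //= (negPf q1) (negPf q2) (negPf q3) /= f1.
Qed.

Definition sort_const := (fcost (tmpset 5 (NNum 0)) + (tcost leaf_test + fcost leaf_body)
  + fcost sort_init + node_const)%N.

(** The merge at node [k] handles at most [2 n / k] entries, so the logarithm comes from a harmonic
    sum and not from the depth of the tree. *)
Definition sort_cost := (n + \sum_(1 <= k < n) ((n + n) %/ k))%N.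

Lemma sort_cmdP s : (0 < n)%N ->
  tri sort_cmd (sort_const * (2 * sort_cost).+2) (fun s' =>
    [/\ sorted (key_le (rm s 3)) (seg s' (nm s' 2 1) n),
        perm_eq (seg s' (nm s' 2 1) n) (iota 0 n) & sort_frame s s']) s.
Proof.
move=> n0.
pose T0 := ((tcost leaf_test + fcost leaf_body) * n.+1)%N.
pose T1 := (\sum_(k < n.-1) (tcost node_test + (fcost node_setup + merge_const d *
   ((n + n) %/ (n - k.+1)).+1)) + tcost node_test)%N.
apply: (@tri_weaken _ _ _ _ _ (fcost (tmpset 5 (NNum 0)) + (T0 + (fcost sort_init + T1))) _
   (tree_inv s 1)).
- apply: tri_seq; apply: tri_nset => //; apply: tri_seq.
  apply: (@tri_weaken _ _ _ _ _ T0); first apply: (leaf_loopP (s0 := s)) => //.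
    by split=> // r i; rewrite !inE !negb_or => /and4P[/negPf /= -> _ _ _].
    by [].
  move=> s1 [fr g1 g2]; apply: tri_seq.
  apply: tri_weaken (tree_init n0 fr g1 g2) _ _ => // s2 tr.
  (* After [k] iterations the invariant stands at node [n - k]; the root is reached after [n - 1] of
     them. *)
  have {1}<- : (n - n.-1 = 1)%N by lia.
  apply: (@tri_while _ _ _ _ _ _ n.-1 (fun k => tree_inv s (n - k)) (fun k => fcost node_setup + merge_const d *
   ((n + n) %/ (n - k.+1)).+1)%N).
  + by rewrite subn0.
  + move=> k s' hk; have -> : (n - k = (n - k.+1).+1)%N by lia.
    move=> h; split; last by apply: tree_step => //; lia.
    by rewrite /= neval_nget //= (tree_node h); lia.
  + move=> s' h; rewrite /= neval_nget //= (tree_node h); lia.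
- have : (T1 <= node_const * (n + \sum_(1 <= k < n) ((n + n) %/ k)))%N.
    rewrite /T1 /node_const.
    move: (tcost node_test) (fcost node_setup) (merge_const d) => a b c.
    have -> : (\sum_(1 <= k < n) ((n + n) %/ k) = \sum_(k < n.-1) ((n + n) %/ (n - k.+1)))%N.
      rewrite big_nat_rev /= big_add1 -(big_mkord xpredT (fun k => (n + n) %/ (n - k.+1)))%N.
      by apply: eq_big_nat => k hk; congr (_ %/ _)%N; lia.
    rewrite big_split /= big_split /= !sum_nat_const card_ord.
    under eq_bigr do rewrite mulnS.
    rewrite big_split /= -big_distrr /= sum_nat_const card_ord.
    move: (\sum_(_ < _) _)%N => X.
    have : (n = n.-1.+1)%N by lia.
    move: n.-1 => p ->; nia.
  rewrite -/sort_cost /T0 /sort_const.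
  have : (n <= sort_cost)%N by rewrite leq_addr.
  by nia.
- move=> s' [_ tr tp fr]; rewrite /= cats0 in tp.
  have l1 : nm s' 3 1 = n by have := perm_size tp; rewrite size_seg size_iota.
  have [t1 _ _] := tr 1%N ltac:(lia).
  by rewrite /run_of l1 in tp t1.
Qed.

End Sort.

(** * Extreme points of the expected difference body *)

(* If L lists the points by increasing f, then lastval f p L is the expected
   maximum of f over the points present: acc is the expectation for the points
   read so far, and the next point, when present, is the new maximum. *)
Definition lastval (R : realType) (I : Type) (f p : I -> R) (L : seq I) : R :=
  foldl (fun acc i => p i * f i + (1 - p i) * acc) 0 L.

Section Oracle.
Variables (R : realType) (d n : nat) (inp : nat -> R).
Local Notation tri := (tri d n inp).
Local Notation conc := (conc d n inp).
Implicit Types (s : astate R).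

Definition coordin (i k : nat) : R := inp (d.+1 * i + k.+1)%N.
Definition probin (i : nat) : R := inp (d.+1 * i + d.+1)%N.
Definition keyin s (i : nat) : R := \sum_(k < d) rm s 1 k * coordin i k.

(* The direction is read from array 1 of the real memory. *)
Definition key_body : cmd :=
  Seq (rset d 3 (tmp 5)
        (rsum d (fun k => RMul (rget d 1 (NNum k)) (inget d (tmp 5) k))))
      (tmpset 5 (NAdd (tmp 5) (NNum 1))).
Definition count_test : test := NLt (tmp 5) (NLoad (NNum 0)).
Definition key_loop : cmd := While count_test key_body.

Definition run_update (t b : nat) : cmd :=
  vset d 5 (NNum b) (fun k =>
    RAdd (RMul (inget d (tmp t) d) (inget d (tmp t) k))
         (RMul (RSub (RNat (NNum 1)) (inget d (tmp t) d))
               (rget d 5 (NNum (b + k))))).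

(** Two scans advance together: block [0] of array 5 follows the sorted order, for the maximum, and
    block [d] follows the reverse order, for the minimum. *)
Definition run_body : cmd :=
  Seq (tmpset 6 (nget 4 (NAdd (nget 2 (NNum 1)) (tmp 5))))
 (Seq (tmpset 7 (nget 4 (NAdd (nget 2 (NNum 1))
         (NSub (NLoad (NNum 0)) (NAdd (tmp 5) (NNum 1))))))
 (Seq (run_update 6 0)
 (Seq (run_update 7 d)
      (tmpset 5 (NAdd (tmp 5) (NNum 1)))))).
Definition run_loop : cmd := While count_test run_body.

Definition run_init : cmd :=
  Seq (vset d 5 (NNum 0) (fun=> RNat (NNum 0)))
 (Seq (vset d 5 (NNum d) (fun=> RNat (NNum 0))) (tmpset 5 (NNum 0))).
Definition run_exit : cmd :=
  vset d 2 (NNum 0) (fun k => RSub (rget d 5 (NNum k)) (rget d 5 (NNum (d + k)))).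

(* Writes to array 2 of the real memory a point of the difference body that is
   extreme in the direction in array 1. *)
Definition oracle : cmd :=
  Seq (tmpset 5 (NNum 0))
 (Seq key_loop
 (Seq (sort_cmd d)
 (Seq run_init
 (Seq run_loop run_exit)))).

Definition oracle_frame s s' :=
  [/\ forall r i, r \notin [:: 1; 2; 3; 4]%N -> nm s' r i = nm s r i,
      forall r i, r \notin [:: 2; 3; 5]%N -> rm s' r i = rm s r i & tp s' = tp s].

Lemma oracle_frame_trans s1 s2 s3 :
  oracle_frame s1 s2 -> oracle_frame s2 s3 -> oracle_frame s1 s3.
Proof.
move=> [a1 a2 a3] [b1 b2 b3]; split; last by rewrite b3.
- by move=> r i h; rewrite b1 ?a1.
- by move=> r i h; rewrite b2 ?a2.
Qed.

Lemma sort_frame_oracle s s' : sort_frame s s' -> oracle_frame s s'.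
Proof. by move=> [a1 a2 a3]; split=> // r i _; rewrite a2. Qed.

Lemma setN_frame i x s : oracle_frame s (setN 1 i x s).
Proof. by split=> // r j /=; rewrite inE negb_or => /andP[/negPf ->]. Qed.

Lemma setR_frame r i x s : r \in [:: 2; 3; 5]%N -> oracle_frame s (setR r i x s).
Proof. by move=> hr; split=> // r' j h /=; case: (eqVneq r' r) h => // ->; rewrite hr. Qed.

Lemma setV_frame r i g s : r \in [:: 2; 3; 5]%N -> oracle_frame s (setV d r i g s).
Proof. by move=> hr; split=> // r' j h /=; case: (eqVneq r' r) h => // ->; rewrite hr. Qed.

Lemma key_loopP s : nm s 1 5 = 0%N ->
  tri key_loop ((tcost count_test + fcost key_body) * n.+1)
    (fun s' => oracle_frame s s' /\
        forall i, (i < n)%N -> rm s' 3 i = keyin s i) s.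
Proof.
move=> h5.
apply: tri_weaken (tri_whileC (N := n) (P := fun k s' =>
   [/\ nm s' 1 5 = k, oracle_frame s s' &
       forall i, (i < k)%N -> rm s' 3 i = keyin s i]) _ _ _) _ _ => //.
- move=> k s' hk [e5 fr hk']; split; first by ev; rewrite e5.
  apply: tri_seq; apply: tri_rset => //; apply: tri_nset => //.
  ev; rewrite e5 addn1; split=> //.
  + apply: oracle_frame_trans fr _; apply: oracle_frame_trans (setN_frame _ _ _).
    exact: setR_frame.
  + move=> i /=; rewrite ltnS leq_eqVlt => /orP[/eqP ->|hi]; last first.
      by rewrite (ltn_eqF hi); apply: hk'.
    rewrite eqxx reval_rsum; apply: eq_bigr => j _.
    rewrite /= reval_rget // reval_inget /=; [|by ev; rewrite e5|by rewrite ltnS ltnW].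
    by ev; rewrite e5; case: fr => _ -> .
- by move=> s' [e5 _ _]; ev; rewrite e5 ltnn.
- by move=> s' [].
Qed.

Lemma run_updateP t b i Q s : (i < n)%N -> nm s 1 t = i ->
  Q (setV d 5 b (fun k => probin i * coordin i k + (1 - probin i) * rm s 5 (b + k)) s) ->
  tri (run_update t b) (fcost (run_update t b)) Q s.
Proof.
move=> hi ht hQ; apply: tri_vset => //; last exact: hQ.
move=> k s' hk en er; rewrite /= reval_rget //= er; last by rewrite /= leqnn orbT.
have e : neval (conc s') (tmp t) = i by ev; rewrite en ht.
by rewrite !reval_inget ?e // ltnS ltnW.
Qed.

Lemma lastval_rcons (I : Type) (f p : I -> R) L i :
  lastval f p (rcons L i) = p i * f i + (1 - p i) * lastval f p L.
Proof. by rewrite /lastval foldl_rcons. Qed.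

Lemma run_loopP s L : nm s 1 5 = 0%N -> L = seg s (nm s 2 1) n ->
  (forall i, i \in L -> (i < n)%N) ->
  (forall k, (k < d)%N -> rm s 5 k = 0 /\ rm s 5 (d + k) = 0) ->
  tri run_loop ((tcost count_test + fcost run_body) * n.+1)
    (fun s' => oracle_frame s s' /\
        forall k, (k < d)%N ->
          rm s' 5 k = lastval (coordin^~ k) probin L /\
          rm s' 5 (d + k) = lastval (coordin^~ k) probin (rev L)) s.
Proof.
move=> h5 LE Ln h0; have szL : size L = n by rewrite LE size_seg.
apply: tri_weaken (tri_whileC (N := n) (P := fun m s' =>
   [/\ nm s' 1 5 = m, oracle_frame s s', nm s' 2 = nm s 2, nm s' 4 = nm s 4 &
       forall k, (k < d)%N ->
          rm s' 5 k = lastval (coordin^~ k) probin (take m L) /\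
          rm s' 5 (d + k) = lastval (coordin^~ k) probin (take m (rev L))]) _ _ _) _ _ => //.
- by split=> // k /h0; rewrite !take0.
- move=> m s' hm [e5 fr e2 e4 hk']; split; first by ev; rewrite e5.
  have Lnth j : (j < n)%N -> nm s' 4 (nm s' 2 1 + j) = nth 0%N L j.
    by move=> hj; rewrite LE (nth_map 0%N) ?size_iota // nth_iota // e4 e2.
  have L1 : (nth 0%N L m < n)%N by apply: Ln; rewrite mem_nth ?szL.
  have L2 : (nth 0%N (rev L) m < n)%N.
    by apply: Ln; rewrite -mem_rev mem_nth // size_rev szL.
  apply: tri_seq; apply: tri_nset => //; apply: tri_seq; apply: tri_nset => //.
  ev; rewrite e5 addn1 (Lnth m hm) (Lnth (n - m.+1)%N); last by lia.
  rewrite (_ : nth 0%N L (n - m.+1) = nth 0%N (rev L) m); last first.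
    by rewrite nth_rev szL.
  apply: tri_seq; apply: (run_updateP (i := nth 0%N L m)) => //.
  apply: tri_seq; apply: (run_updateP (i := nth 0%N (rev L) m)) => //.
  apply: tri_nset => //; ev; rewrite e5 addn1; split=> //.
  + apply: oracle_frame_trans fr _; apply: oracle_frame_trans (setN_frame _ _ _).
    apply: oracle_frame_trans (setV_frame _ _ _ _) => //.
    apply: oracle_frame_trans (setV_frame _ _ _ _) => //.
    by apply: oracle_frame_trans (setN_frame _ _ _); apply: setN_frame.
  + move=> k hk /=; rewrite addKn !add0n !subn0 (leqNgt d k) hk leq_addr ltn_add2l hk /=.
    rewrite (ltnNge (d + k)) leq_addr /=.
    have [-> ->] := hk' k hk.
    rewrite (take_nth 0%N) ?szL // (take_nth 0%N) ?size_rev ?szL //.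
    by rewrite !lastval_rcons.
- by move=> s' [e5 _ _ _ _]; ev; rewrite e5 ltnn.
- by move=> s' [_ fr _ _ h]; split=> // k /h; rewrite !take_oversize ?size_rev ?szL.
Qed.

Definition oracle_const :=
  (fcost (tmpset 5 (NNum 0)) + (tcost count_test + fcost key_body) + sort_const d
   + fcost run_init + (tcost count_test + fcost run_body) + fcost run_exit)%N.
Definition oracle_cost := (oracle_const * (2 * sort_cost n).+2)%N.

Lemma oracleP s : (0 < n)%N ->
  tri oracle oracle_cost (fun s' =>
    oracle_frame s s' /\ exists L,
    [/\ perm_eq L (iota 0 n), sorted (fun i j => keyin s i <= keyin s j) L &
        forall k, (k < d)%N -> rm s' 2 k =
          lastval (coordin^~ k) probin L - lastval (coordin^~ k) probin (rev L)]) s.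
Proof.
move=> n0; pose T1 := ((tcost count_test + fcost key_body) * n.+1)%N.
pose T2 := (sort_const d * (2 * sort_cost n).+2)%N.
pose T3 := ((tcost count_test + fcost run_body) * n.+1)%N.
apply: (@tri_weaken _ _ _ _ _ (fcost (tmpset 5 (NNum 0)) +
   (T1 + (T2 + (fcost run_init + (T3 + fcost run_exit))))) _ _ _ _ _ _ (fun _ h => h)); last first.
  have hn : (n <= sort_cost n)%N by rewrite leq_addr.
  rewrite /oracle_cost /oracle_const /T1 /T2 /T3.
  move: (fcost _) (_ + fcost key_body)%N (sort_const d) (fcost run_init)
   (_ + fcost run_body)%N (fcost run_exit) (sort_cost n) hn => a b c e f g h; nia.
apply: tri_seq; apply: tri_nset => //; apply: tri_seq.
apply: tri_weaken (key_loopP _) (leqnn _) _; first by ev.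
move=> s1 [fr1 k1]; apply: tri_seq.
apply: tri_weaken (sort_cmdP _ _ _ n0) (leqnn _) _ => s2 [so pe fr2].
have {}fr2 := sort_frame_oracle fr2.
set L := seg s2 _ _ in so pe.
have Ln i : i \in L -> (i < n)%N by rewrite (perm_mem pe) mem_iota.
have {}k1 i : (i < n)%N -> rm s1 3 i = keyin s i by move=> hi; rewrite k1.
have {}fr : oracle_frame s s2.
  apply: oracle_frame_trans fr2; apply: oracle_frame_trans fr1; exact: setN_frame.
apply: tri_seq; apply: tri_seq.
apply: (@tri_vset _ _ _ _ _ _ _ (fun=> 0)) => //.
apply: tri_seq; apply: (@tri_vset _ _ _ _ _ _ _ (fun=> 0)) => //.
apply: tri_nset => //; ev; set s3 := setN _ _ _ _; apply: tri_seq.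
have fr3 : oracle_frame s s3.
  apply: oracle_frame_trans fr _; apply: oracle_frame_trans (setN_frame _ _ _).
  by apply: oracle_frame_trans (setV_frame _ _ _ _) => //; apply: setV_frame.
apply: tri_weaken (@run_loopP s3 L _ _ _ _) (leqnn _) _ => //.
  by move=> k hk; rewrite /= !add0n hk leq_addr ltn_add2l hk /= if_same.
move=> s4 [fr4 r4]; apply: (@tri_vset _ _ _ _ _ _ _ (fun k => rm s4 5 k - rm s4 5 (d + k))) => //.
  by move=> k s' hk en er; rewrite /= !reval_rget // !er.
split.
  apply: oracle_frame_trans fr3 _; apply: oracle_frame_trans fr4 _; exact: setV_frame.
exists L; split=> //.
- apply: (@sub_in_sorted _ (mem L) (key_le (rm s1 3)) _ _ L _ so).
    by move=> i j iL jL; rewrite /key_le !k1 ?Ln.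
  by apply/allP.
- by move=> k hk; ev; rewrite hk subn0; have [-> ->] := r4 k hk.
Qed.

End Oracle.

(** * Inner products, extents and support functions *)

Section Extent.
Variables (R : realType) (d : nat).
Implicit Types (u q x : 'rV[R]_d) (S : seq 'rV[R]_d) (w : 'rV[R]_d -> R).

Lemma dotpDl u u' q : dotp (u + u') q = dotp u q + dotp u' q.
Proof. by rewrite -big_split; apply: eq_bigr => j _; rewrite mxE mulrDl. Qed.

Lemma dotpZl a u q : dotp (a *: u) q = a * dotp u q.
Proof. by rewrite /dotp mulr_sumr; apply: eq_bigr => j _; rewrite mxE mulrA. Qed.

Lemma dotpNl u q : dotp (- u) q = - dotp u q.
Proof. by rewrite -scaleN1r dotpZl mulN1r. Qed.

Lemma dotpBl u u' q : dotp (u - u') q = dotp u q - dotp u' q.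
Proof. by rewrite dotpDl dotpNl. Qed.

Lemma dotp0l q : dotp 0 q = 0.
Proof. by rewrite -(scale0r 0) dotpZl mul0r. Qed.

Lemma dotpC u q : dotp u q = dotp q u.
Proof. by apply: eq_bigr => j _; rewrite mulrC. Qed.

Lemma dotpDr u q q' : dotp u (q + q') = dotp u q + dotp u q'.
Proof. by rewrite dotpC dotpDl !(dotpC u). Qed.

Lemma dotpZr a u q : dotp u (a *: q) = a * dotp u q.
Proof. by rewrite dotpC dotpZl (dotpC u). Qed.

Lemma dotpNr u q : dotp u (- q) = - dotp u q.
Proof. by rewrite dotpC dotpNl (dotpC u). Qed.

Lemma dotpBr u q q' : dotp u (q - q') = dotp u q - dotp u q'.
Proof. by rewrite dotpDr dotpNr. Qed.

Lemma dotp_suml (I : Type) (r : seq I) (P : pred I) (F : I -> 'rV[R]_d) q :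
  dotp (\sum_(i <- r | P i) F i) q = \sum_(i <- r | P i) dotp (F i) q.
Proof.
elim/big_rec2: _ => [|i x y _ <-]; first exact: dotp0l.
by rewrite dotpDl.
Qed.

Lemma extent_ge S u q : q \in S -> dotp u q <= extent S u.
Proof.
case: S => // q0 S; rewrite inE => /predU1P[->|hq] /=.
  exact: bigmax_ge_id.
exact: le_bigmax_seq.
Qed.

Lemma extent_le S u c : S != [::] ->
  (forall q, q \in S -> dotp u q <= c) -> extent S u <= c.
Proof.
case: S => // q0 S _ h /=; rewrite big_seq; apply: bigmax_le => [|q hq].
  by rewrite h // mem_head.
by rewrite h // inE hq orbT.
Qed.

Lemma widthN S u : width S (- u) = width S u.
Proof. by rewrite /width opprK addrC. Qed.

(* With w the support function of a symmetric convex body K, [in_body w] is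
   membership in K, and [extreme w u x] says that x maximises <u, .> on K. *)
Definition in_body w x := forall u, dotp u x <= w u.
Definition extreme w u x := in_body w x /\ dotp u x = w u.

End Extent.

(** * Expected extents as scans of a sorted list *)

Section ExpectedWidth.
Variables (R : realType) (d n : nat) (v : 'I_n -> 'rV[R]_d) (p : 'I_n -> R).
Hypothesis p01 : forall i, 0 < p i < 1.
Implicit Types (A : {set 'I_n}) (L : seq 'I_n) (u : 'rV[R]_d) (f : 'I_n -> R).

Lemma realization_probE A :
  realization_prob p A = \prod_i (if i \in A then p i else 1 - p i).
Proof.
rewrite (bigID (mem A)) /=; congr (_ * _).
  by apply: eq_bigr => i ->.
rewrite (eq_bigl (fun i => i \notin A)); last by move=> i; rewrite inE.
by apply: eq_bigr => i /negPf ->.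
Qed.

Lemma realization_probD1 i A :
  realization_prob p A = (if i \in A then p i else 1 - p i) *
    \prod_(j | j != i) (if j \in A then p j else 1 - p j).
Proof. by rewrite realization_probE (bigD1 i). Qed.

Lemma realization_prob_ge0 A : 0 <= realization_prob p A.
Proof.
rewrite realization_probE; apply: prodr_ge0 => i _.
by have := p01 i; case: ifP => _; lra.
Qed.

Lemma sum_realization_prob : \sum_(A : {set 'I_n}) realization_prob p A = 1.
Proof.
under eq_bigr do rewrite realization_probE.
rewrite -(bigA_distr 1 _ p (fun i => 1 - p i)) big1 // => i _.
by rewrite /= addrC subrK.
Qed.

(** The realizations [A] and [i |: A] share all factors except the one of [i], so they are summed in
    pairs. *)
Lemma sum_prob_pairing i (G : {set 'I_n} -> R) :
  \sum_A realization_prob p A * G A =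
  \sum_(A : {set 'I_n} | i \notin A)
     (\prod_(j | j != i) (if j \in A then p j else 1 - p j)) *
     (p i * G (i |: A) + (1 - p i) * G A).
Proof.
rewrite (bigID (fun A : {set 'I_n} => i \in A)) /=.
rewrite (reindex_onto (fun A => i |: A) (fun A => A :\ i)) /=; last first.
  by move=> A iA; rewrite setD1K.
rewrite (eq_bigl (fun A : {set 'I_n} => i \notin A)); last first.
  move=> A; rewrite setU11; apply/eqP/idP => [<-|]; last exact: setU1K.
  by rewrite !inE eqxx.
rewrite -big_split /=; apply: eq_bigr => A iA.
rewrite !(realization_probD1 i) setU11 (negPf iA).
rewrite (eq_bigr (fun j => if j \in A then p j else 1 - p j)); last first.
  by move=> j ji; rewrite inE in_set1 (negPf ji).
ring.
Qed.

(** Independence of the presence of [i] from a quantity that ignores [i]; this is the recursion step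
    of [lastval]. *)
Lemma sum_prob_indep i x (h : {set 'I_n} -> R) :
  (forall A, h (i |: A) = h A) ->
  \sum_A realization_prob p A * (if i \in A then x else h A) =
  p i * x + (1 - p i) * \sum_A realization_prob p A * h A.
Proof.
(* The constant [x] is written as an expectation, so that both sides become sums over the same
   pairs. *)
move=> hi; rewrite -[p i * x]mulr1 -[X in _ * X]sum_realization_prob.
under [X in _ * X + _]eq_bigr do rewrite -[realization_prob _ _]mulr1.
rewrite !(sum_prob_pairing i) !mulr_sumr -big_split /=; apply: eq_bigr => A iA.
rewrite setU11 (negPf iA) hi; ring.
Qed.

Definition last_present f L A : R :=
  foldl (fun acc i => if i \in A then f i else acc) 0 L.

Lemma last_present_rcons f L i A : last_present f (rcons L i) A =
  if i \in A then f i else last_present f L A.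
Proof. by rewrite /last_present foldl_rcons. Qed.

Lemma last_present_setU f L i A : i \notin L ->
  last_present f L (i |: A) = last_present f L A.
Proof.
elim/last_ind: L => // L j IH; rewrite mem_rcons inE negb_or => /andP[ij iL].
by rewrite !last_present_rcons IH // !inE eq_sym (negPf ij).
Qed.

Lemma expected_last_present f L : uniq L ->
  \sum_A realization_prob p A * last_present f L A = lastval f p L.
Proof.
elim/last_ind: L => [|L i IH] uL.
  by rewrite big1 // => A _; rewrite mulr0.
move: uL; rewrite rcons_uniq => /andP[iL uL].
under eq_bigr do rewrite last_present_rcons.
rewrite sum_prob_indep ?IH ?lastval_rcons // => A.
exact: last_present_setU.
Qed.

Lemma last_presentP f L A :
  (exists2 j, j \in A & last_present f L A = f j) \/
  (forall j, j \in L -> j \notin A) /\ last_present f L A = 0.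
Proof.
elim/last_ind: L => [|L i IH]; first by right.
rewrite last_present_rcons; case: ifPn => iA; first by left; exists i.
case: IH => [|[h ->]]; first by left.
by right; split=> // j; rewrite mem_rcons inE => /predU1P[->|/h].
Qed.

Lemma last_present_max f L A j :
  sorted (fun i i' => f i <= f i') L -> j \in L -> j \in A ->
  f j <= last_present f L A.
Proof.
elim/last_ind: L => // L i IH so jL jA; rewrite last_present_rcons.
have tr : transitive (fun i i' => f i <= f i') by move=> ? ? ?; apply: le_trans.
have soL : sorted (fun i i' => f i <= f i') L.
  by apply: (subseq_sorted tr _ so); apply: subseq_rcons.
have ji : f j <= f i.
  have := so; rewrite -[sorted _ _]/(sorted _ (rcons L i)) -cats1.
  move: jL; rewrite mem_rcons inE => /predU1P[->|jL] //.
  rewrite sorted_pairwise // pairwise_cat => /and3P[/allrelP h _ _].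
  by apply: h => //; rewrite mem_seq1.
case: ifPn => // iA; apply: IH => //; move: jL; rewrite mem_rcons inE.
by case/predU1P => // E; rewrite -E jA in iA.
Qed.

(** In any order, the last present point is one of the present points; in the empty realization both
    sides take the default value 0. *)
Lemma last_present_extent u L A : L =i 'I_n ->
  last_present (fun i => dotp u (v i)) L A <= extent (realization_points v A) u.
Proof.
move=> hL; case: (last_presentP (fun i => dotp u (v i)) L A) => [[j jA ->]|[h ->]].
  by apply: extent_ge; apply: map_f; rewrite mem_enum.
suff -> : A = set0 by rewrite /realization_points enum_set0.
by apply/setP => i; rewrite inE; apply/negbTE/h; rewrite hL.
Qed.

Lemma last_present_extent_eq u L A : L =i 'I_n ->
  sorted (fun i j => dotp u (v i) <= dotp u (v j)) L ->
  last_present (fun i => dotp u (v i)) L A = extent (realization_points v A) u.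
Proof.
move=> hL so; apply/le_anti/andP; split; first exact: last_present_extent.
have [->|[i iA]] := set_0Vmem A.
  case: (last_presentP (fun i => dotp u (v i)) L set0) => [[j]|[_ ->]].
    by rewrite inE.
  by rewrite /realization_points enum_set0.
apply: extent_le.
  by apply/eqP => E; have := map_f v (s := enum A) (x := i); rewrite mem_enum iA -/(realization_points v A) E => /(_ isT).
move=> q /mapP[j]; rewrite mem_enum => jA ->.
by apply: (last_present_max (f := fun i => dotp u (v i))) => //; rewrite hL.
Qed.

Definition expected_extent u : R :=
  \sum_A realization_prob p A * extent (realization_points v A) u.

Lemma expected_widthE u :
  expected_width v p u = expected_extent u + expected_extent (- u).
Proof.
by rewrite -big_split /=; apply: eq_bigr => A _; rewrite -mulrDr.
Qed.

(** No sortedness is assumed: this is why an order found for one direction gives a point that stays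
    in the body for all the others. *)
Lemma lastval_le u L : uniq L -> L =i 'I_n ->
  lastval (fun i => dotp u (v i)) p L <= expected_extent u.
Proof.
move=> uL hL; rewrite -expected_last_present //; apply: ler_sum => A _.
by rewrite ler_wpM2l ?realization_prob_ge0 // last_present_extent.
Qed.

Lemma lastval_eq u L : uniq L -> L =i 'I_n ->
  sorted (fun i j => dotp u (v i) <= dotp u (v j)) L ->
  lastval (fun i => dotp u (v i)) p L = expected_extent u.
Proof.
move=> uL hL so; rewrite -expected_last_present //; apply: eq_bigr => A _.
by rewrite last_present_extent_eq.
Qed.

(** For a fixed order the scan is linear in the values scanned, so scanning coordinates computes a
    vector independent of [u]. *)
Lemma lastval_dotp u L :
  lastval (fun i => dotp u (v i)) p L =
  dotp u (\row_k lastval (fun i => v i 0 k) p L).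
Proof.
elim/last_ind: L => [|L i IH].
  by rewrite /lastval /= /dotp big1 // => k _; rewrite mxE mulr0.
have -> : \row_k lastval (fun i => v i 0 k) p (rcons L i) =
    p i *: v i + (1 - p i) *: \row_k lastval (fun i => v i 0 k) p L.
  by apply/rowP => k; rewrite !mxE lastval_rcons.
by rewrite dotpDr !dotpZr lastval_rcons IH.
Qed.

(** The point is the difference of a forward and a backward scan. Both scans bound the extents in
    every direction from below, and both are exact at [u], because reversing [L] sorts it for
    [- u]. *)
Lemma expected_width_extreme u L : perm_eq L (enum 'I_n) ->
  sorted (fun i j => dotp u (v i) <= dotp u (v j)) L ->
  extreme (expected_width v p) u
    (\row_k (lastval (fun i => v i 0 k) p L - lastval (fun i => v i 0 k) p (rev L))).
Proof.
move=> pL so.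
have hL : L =i 'I_n by move=> i; rewrite (perm_mem pL) mem_enum.
have uL : uniq L by rewrite (perm_uniq pL) enum_uniq.
have hrL : rev L =i 'I_n by move=> i; rewrite mem_rev.
have urL : uniq (rev L) by rewrite rev_uniq.
have dotE u' : dotp u' (\row_k (lastval (fun i => v i 0 k) p L -
      lastval (fun i => v i 0 k) p (rev L))) =
    lastval (fun i => dotp u' (v i)) p L +
    lastval (fun i => dotp (- u') (v i)) p (rev L).
  rewrite !lastval_dotp dotpNl -dotpBr; congr dotp.
  by apply/rowP => k; rewrite !mxE.
split=> [u'|]; rewrite dotE expected_widthE.
  by rewrite lerD // lastval_le.
rewrite !lastval_eq // rev_sorted.
by apply: sub_sorted so => i j; rewrite !dotpNl lerN2.
Qed.

End ExpectedWidth.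

(** * Normalising the body *)

Section SymmetricBody.
Variables (R : realType) (D : nat).
Local Notation d := D.+1.
Variable w : 'rV[R]_d -> R.
Hypothesis w_extreme : forall u, exists x, extreme w u x.
Hypothesis wN : forall u, w (- u) = w u.
Implicit Types (u x z : 'rV[R]_d) (a b : nat -> 'rV[R]_d).

(** This and the following facts on [w] use only that extreme points exist in every direction and
    that [w] is even. *)
Lemma wD u u' : w (u + u') <= w u + w u'.
Proof. by have [x [h <-]] := w_extreme (u + u'); rewrite dotpDl lerD. Qed.

Lemma w0 : w 0 = 0.
Proof. by have [x [_ <-]] := w_extreme 0; rewrite dotp0l. Qed.

Lemma w_ge0 u : 0 <= w u.
Proof. by have := wD u (- u); rewrite subrr w0 wN; lra. Qed.

Lemma body_norm x u : in_body w x -> `|dotp u x| <= w u.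
Proof. by move=> h; rewrite ler_norml h andbT; have := h (- u); rewrite dotpNl wN; lra. Qed.

Lemma wZ c u : w (c *: u) = `|c| * w u.
Proof.
have le c' u' : w (c' *: u') <= `|c'| * w u'.
  have [x [h <-]] := w_extreme (c' *: u'); rewrite dotpZl.
  by rewrite (le_trans (ler_norm _)) // normrM ler_wpM2l // body_norm.
apply/le_anti; rewrite le /=; have [->|c0] := eqVneq c 0.
  by rewrite normr0 mul0r w_ge0.
have := le c^-1 (c *: u); rewrite scalerA mulVf // scale1r normfV.
by rewrite ler_pdivlMl ?normr_gt0.
Qed.

Lemma wB u u' : w (u - u') <= w u + w u'.
Proof. by rewrite -(wN u') wD. Qed.

(** Directions of zero width form the space along which the body is flat, so [w] is defined modulo
    them. *)
Lemma w_null z u : w z = 0 -> w (u + z) = w u.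
Proof.
move=> hz; apply/le_anti/andP; split.
  by have := wD u z; rewrite hz addr0.
by have := wB (u + z) z; rewrite addrK hz addr0.
Qed.

Lemma body_null z x : w z = 0 -> in_body w x -> dotp z x = 0.
Proof.
by move=> hz /(body_norm z); rewrite hz normr_le0 => /eqP.
Qed.

(* The a_i become a dual basis of body points b_l, except that the coordinates
   flagged by nul, on which the body is flat, are dropped by setting a_i := 0. *)
Definition basis_inv (j : nat) a : Prop := exists (nul : nat -> bool) b,
  [/\ forall l, (l < j)%N -> ~~ nul l -> in_body w (b l) /\
        forall i, (i < d)%N -> dotp (a i) (b l) = (i == l)%:R,
      forall i, (i < j)%N -> nul i -> a i = 0,
      forall i, (i < j)%N -> w (a i) <= 2 ^+ j &
      forall u, exists2 y : nat -> R,
        w (u - \sum_(i < d) y i *: a i) = 0 &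
        forall i, (i < j)%N -> nul i -> y i = 0].

(** When [x] is extreme for [a j] the pivot [c] is [w (a j)]: it vanishes exactly when the body is
    flat along [a j], and after division the new [a j] has width 1. *)
Definition dual_step j x a : nat -> 'rV[R]_d :=
  let c := dotp (a j) x in
  if 0 < c then
    fun i => if i == j then c^-1 *: a j
             else a i - dotp (a i) x *: (c^-1 *: a j)
  else fun i => if i == j then 0 else a i.

Lemma basis_inv0 a : (forall i k, (i < d)%N -> a i 0 k = (k == i :> nat)%:R) ->
  basis_inv 0 a.
Proof.
move=> ha; exists (fun=> false), (fun=> 0); split=> // u.
exists (fun i => u 0 (inord i)) => //.
suff -> : \sum_(i < d) u 0 (inord i) *: a i = u by rewrite subrr w0.
apply/rowP => k; rewrite summxE (bigD1 k) //= mxE ha // eqxx mulr1 inord_val.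
rewrite big1 ?addr0 // => i ik; rewrite mxE ha //.
by have /negPf -> : (k != i :> nat) by [rewrite eq_sym]; rewrite mulr0.

Qed.

(** The new row [a i] subtracts [dotp (a i) x] times a functional of width 1, and this factor is at
    most [w (a i)]: widths of finished rows at most double, while row [j] enters with width 1.
    Earlier dual points [b l] annihilate [a j], so they remain dual. *)
Lemma dual_stepP j x a : (j < d)%N -> basis_inv j a -> extreme w (a j) x ->
  basis_inv j.+1 (dual_step j x a).
Proof.
move=> jd [nul [b [hb hn hw hy]]] [xK cE].
rewrite /dual_step cE; have := w_ge0 (a j); rewrite le_eqVlt => /predU1P[E|c0].
  (* Flat case: dropping the term [y j *: a j] changes the residue by a direction of zero width. *)
  rewrite -E ltxx; exists (fun i => (i == j) || nul i), b; split.
  - move=> l; rewrite ltnS leq_eqVlt => /predU1P[->|lj]; first by rewrite eqxx.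
    rewrite (ltn_eqF lj) /= => nl; have [h1 h2] := hb l lj nl; split=> // i hi.
    case: eqVneq => [->|_]; last exact: h2.
    by rewrite dotp0l (gtn_eqF lj).
  - move=> i; rewrite ltnS leq_eqVlt => /predU1P[->|ij]; first by rewrite eqxx.
    by rewrite (ltn_eqF ij) /= => /hn; apply.
  - move=> i; rewrite ltnS leq_eqVlt => /predU1P[->|ij].
      by rewrite eqxx w0 exprn_ge0.
    by rewrite (ltn_eqF ij) (le_trans (hw _ ij)) // ler_eXn2l // ltr1n.
  - move=> u; have [y y1 y2] := hy u.
    exists (fun i => if i == j then 0 else y i); last first.
      move=> i; rewrite ltnS leq_eqVlt => /predU1P[->|ij]; first by rewrite eqxx.
      by rewrite (ltn_eqF ij) /=; apply: y2.
    have -> : \sum_(i < d) (if i == j :> nat then 0 else y i) *: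
        (if i == j :> nat then 0 else a i) = \sum_(i < d) y i *: a i - y j *: a j.
      rewrite [in RHS](bigD1 (Ordinal jd)) //= addrAC subrr add0r.
      rewrite (bigD1 (Ordinal jd)) //= eqxx scale0r add0r.
      by apply: eq_bigr => i /negPf; rewrite -val_eqE /= => ->.
    by rewrite opprB addrA addrAC w_null ?wZ -?E ?mulr0.
rewrite c0; set c := w (a j) in c0 cE *; set aj := c^-1 *: a j.
have dj : dotp aj x = 1 by rewrite dotpZl cE mulVf // gt_eqF.
have waj : w aj = 1 by rewrite wZ gtr0_norm ?invr_gt0 // mulVf // gt_eqF.
exists (fun i => (i != j) && nul i), (fun l => if l == j then x else b l); split.
- move=> l; rewrite ltnS leq_eqVlt => /predU1P[->|lj].
    rewrite eqxx => _; split=> // i hi; case: eqVneq => [//|_].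
    by rewrite dotpBl dotpZl dj mulr1 subrr.
  rewrite (ltn_eqF lj) /= => nl; have [h1 h2] := hb l lj nl; split=> // i hi.
  have dl : dotp aj (b l) = 0 by rewrite dotpZl h2 // (gtn_eqF lj) mulr0.
  case: eqVneq => [->|_]; first by rewrite dl (gtn_eqF lj).
  by rewrite dotpBl dotpZl dl mulr0 subr0 h2.
- move=> i; rewrite ltnS leq_eqVlt => /predU1P[->|ij]; first by rewrite eqxx.
  rewrite (ltn_eqF ij) /= => /(hn _ ij) ->.
  by rewrite dotp0l scale0r subrr.
- move=> i; rewrite ltnS leq_eqVlt => /predU1P[->|ij].
    by rewrite eqxx waj exprn_ege1 // ler1n.
  rewrite (ltn_eqF ij) (le_trans (wB _ _)) // wZ waj mulr1 exprS.
  by have := body_norm (a i) xK; have := hw i ij; lra.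
- move=> u; have [y y1 y2] := hy u.
  (* The normalised [a j] must give back all multiples of it subtracted from the other rows, besides
     [y j * c] for itself; together this is the product of the whole combination with [x]. *)
  exists (fun i => if i == j then \sum_(l < d) y l * dotp (a l) x else y i); last first.
    move=> i; rewrite ltnS leq_eqVlt => /predU1P[->|ij]; first by rewrite eqxx.
    by rewrite (ltn_eqF ij) /=; apply: y2.
  rewrite -[RHS]y1; congr (w (u - _)); rewrite [in RHS](bigD1 (Ordinal jd)) //=.
  rewrite (bigD1 (Ordinal jd)) //= eqxx [X in X *: _](bigD1 (Ordinal jd)) //=.
  rewrite (eq_bigr (fun i : 'I_d => y i *: a i - (y i * dotp (a i) x) *: aj)); last first.
    by move=> i /negPf; rewrite -val_eqE /= => ->; rewrite scalerBr scalerA.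
  rewrite sumrB -scaler_suml scalerDl cE.
  have -> : (y j * c) *: aj = y j *: a j.
    by rewrite scalerA mulrK ?unitfE ?gt_eqF.
  by rewrite addrA addrAC addrK addrC.
Qed.

(** * Covering all directions by grids on the faces *)

Section Faces.
Variable a : nat -> 'rV[R]_d.
Hypothesis aP : basis_inv d a.

(** A direction scaled so that its coefficient on [a i] is 1; [bump i] enumerates the indices other
    than [i]. *)
Definition face_dir (i : nat) (t : nat -> R) : 'rV[R]_d :=
  a i + \sum_(l < D) t l *: a (bump i l).

Lemma face_dirB i t t' : face_dir i t - face_dir i t' =
  \sum_(l < D) (t l - t' l) *: a (bump i l).
Proof.
rewrite opprD addrACA subrr add0r -sumrB.
by apply: eq_bigr => l _; rewrite scalerBl.
Qed.

Lemma bump_lt i l : (l < D)%N -> (bump i l < d)%N.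
Proof. by move=> h; rewrite /bump; case: (i <= l)%N; rewrite ?add1n ?add0n ltnS // ltnW. Qed.

Lemma basis_bound i : (i < d)%N -> w (a i) <= 2 ^+ d.
Proof. by case: aP => nul [b [_ _ h _]]; apply: h. Qed.

(** Adding the two optimality inequalities gives [<u' - u, x' - x> >= 0]. When [t] and [t'] differ
    on one axis, a single summand remains. *)
Lemma face_dir_monotone i t t' x x' :
  extreme w (face_dir i t) x -> extreme w (face_dir i t') x' ->
  0 <= \sum_(l < D) (t' l - t l) *
         (dotp (a (bump i l)) x' - dotp (a (bump i l)) x).
Proof.
move=> [h1 h2] [h1' h2'].
have -> : \sum_(l < D) (t' l - t l) *
         (dotp (a (bump i l)) x' - dotp (a (bump i l)) x) =
    dotp (face_dir i t' - face_dir i t) (x' - x).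
  by rewrite face_dirB dotp_suml; apply: eq_bigr => l _; rewrite dotpZl dotpBr.
rewrite dotpBl !dotpBr h2 h2'; have := h1 (face_dir i t').
have := h1' (face_dir i t); lra.
Qed.

(** Since [x'] is extreme for the second direction, only the difference of the two directions
    contributes to the error, and it splits along the axes. *)
Lemma same_cell_error i (m : R) t t' x x' : 0 < m ->
  extreme w (face_dir i t) x -> extreme w (face_dir i t') x' ->
  (forall l, (l < D)%N ->
    `|m * (t l + dotp (a (bump i l)) x) - m * (t' l + dotp (a (bump i l)) x')| <= 1) ->
  dotp (face_dir i t) (x - x') <= D%:R / (4 * m ^+ 2).
Proof.
move=> m0 [h1 h2] [h1' h2'] hc.
have -> : face_dir i t = (face_dir i t - face_dir i t') + face_dir i t' by rewrite subrK.
rewrite dotpDl [X in _ + X]dotpBr h2'.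
have := h1 (face_dir i t'); rewrite -subr_le0 => hle.
apply: (@le_trans _ _ (dotp (face_dir i t - face_dir i t') (x - x'))); first by lra.
rewrite face_dirB dotp_suml.
apply: (@le_trans _ _ (\sum_(l < D) (4 * m ^+ 2)^-1)); last first.
  by rewrite sumr_const card_ord -[leLHS]mulr_natl.
apply: ler_sum => l _; rewrite dotpZl dotpBr.
have m4 : 0 < 4 * m ^+ 2 by rewrite mulr_gt0 // exprn_gt0.
rewrite -[_^-1]mul1r ler_pdivlMr //.
have := hc l (ltn_ord l); set y := dotp _ x; set y' := dotp _ x'.
set s := t l; set s' := t' l.
rewrite -mulrBr => hs; have : (m * (s + y - (s' + y'))) ^+ 2 <= 1.
  by rewrite -real_normK ?num_real // expr_le1.
(* A product is a quarter of the square of the sum minus a quarter of the square of the difference;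
   the latter is discarded. *)
have : 0 <= (m * (s - s' - (y - y'))) ^+ 2 by exact: sqr_ge0.
rewrite !exprMn; nra.
Qed.

(** The indices [1 .. G] give values in [(-1, 1]] with step [2 / G]; index 0 is reserved for an axis
    whose loop is not running. *)
Definition grid_val (G k : nat) : R := 2 * k%:R / G%:R - 1.

Lemma nat_approx (G : nat) (s : R) : (0 < G)%N -> 0 <= s <= G%:R ->
  exists2 k, (0 < k <= G)%N & k%:R - 1 <= s <= k%:R.
Proof.
elim: G => // G IH _ /andP[s0 s1].
have [sG|sG] := leP s G%:R.
  case: G IH sG {s1} => [|G] IH sG.
    by exists 1%N => //; move: sG; lra.
  have [|k k1 k2] := IH isT; first by rewrite s0 sG.
  by exists k => //; lia.
exists G.+1; first by rewrite leqnn.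
by rewrite s1 andbT -natr1; lra.
Qed.

Lemma grid_approx (G : nat) (t : R) : (0 < G)%N -> `|t| <= 1 ->
  exists2 k, (0 < k <= G)%N & `|t - grid_val G k| <= 2 / G%:R.
Proof.
move=> G0; rewrite ler_norml => /andP[t1 t2].
have g0 : 0 < G%:R :> R by rewrite ltr0n.
have [|k k1 /andP[k2 k3]] := @nat_approx G ((t + 1) / 2 * G%:R) G0.
  by apply/andP; split; nra.
exists k => //; rewrite /grid_val ler_norml.
have e : 2 * k%:R / G%:R = 2 / G%:R * k%:R :> R by ring.
have i0 : 0 < 2 / G%:R :> R by rewrite divr_gt0.
have ie : 2 / G%:R * ((t + 1) / 2 * G%:R) = t + 1 by field; rewrite gt_eqF.
rewrite e; apply/andP; split; nra.
Qed.

(** Modulo zero width, dividing [u] by its coefficient of largest modulus moves it to a face with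
    all parameters in [-1, 1], where a grid direction is close. The hypothesis on [eps] adds the
    cost of replacing the direction, namely [D] axes with step [2 / G] and range [2 * 2 ^ d], to the
    cost [eta] of replacing the sample. *)
Theorem kernel_covers (G : nat) (eps eta : R) (X : seq 'rV[R]_d) :
  (0 < G)%N ->
  (forall x, x \in X -> in_body w x) ->
  (forall i g, (i < d)%N -> (forall l, (l < D)%N -> (0 < g l <= G)%N) ->
     exists2 x', x' \in X &
     exists2 x, extreme w (face_dir i (fun l => grid_val G (g l))) x &
       dotp (face_dir i (fun l => grid_val G (g l))) (x - x') <= eta) ->
  D%:R * (2 / G%:R * (2 * 2 ^+ d)) + eta <= eps ->
  forall u, exists2 x, x \in X & (1 - eps) * w u <= `|dotp u x|.
Proof.
move=> G0 hX hcov heps u.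
case: (aP) => nul [b [hb _ _ /(_ u)[y y1 y2]]].
have [i _ imax] := @Order.TotalTheory.arg_maxP _ _ _ (ord0 : 'I_d) xpredT (fun i => `|y i|) isT.
have {}imax (k : 'I_d) : `|y k| <= `|y i| := imax k isT.
have [yi0|yi0] := eqVneq (y i) 0.
  have wu : w u = 0.
    rewrite -y1 big1 ?subr0 // => k _; have := imax k.
    by rewrite yi0 normr0 normr_le0 => /eqP ->; rewrite scale0r.
  (* Here [w u = 0], so any member of [X] serves; the grid point with all indices 1 provides one. *)
  have [||x xX _] := hcov 0%N (fun=> 1%N) => //.
  by exists x => //; rewrite wu mulr0.
have ni : ~~ nul i by apply/negP => /(y2 i (ltn_ord i)); apply/eqP.
set u1 := (y i)^-1 *: u; pose t l := y (bump i l) / y i.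
have t1 l : (l < D)%N -> `|t l| <= 1.
  move=> hl; rewrite normrM normfV ler_pdivrMr ?normr_gt0 // mul1r.
  exact: (imax (Ordinal (bump_lt i hl))).
have sumE : (y i)^-1 *: (\sum_(k < d) y k *: a k) = face_dir i t.
  rewrite (bigD1_ord i) //= scalerDr scalerA mulVf // scale1r scaler_sumr.
  by congr (_ + _); apply: eq_bigr => l _; rewrite scalerA mulrC.
have wz : w (u1 - face_dir i t) = 0.
  by rewrite -sumE -scalerBr wZ y1 mulr0.
have [biK bi] := hb i (ltn_ord i) ni.
(* The dual point [b i] has product 1 with [u1]; this lower bound turns the absolute error below
   into a relative one. *)
have w1 : 1 <= w u1.
  suff <- : dotp u1 (b i) = 1 by exact: biK.
  have := body_null wz biK; rewrite dotpBl => /eqP; rewrite subr_eq0 => /eqP ->.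
  rewrite dotpDl bi // eqxx dotp_suml big1 ?addr0 // => l _.
  by rewrite dotpZl bi ?bump_lt // ?(negPf (neq_bump _ _)) ?mulr0 // eq_sym (negPf (neq_bump _ _)) mulr0.
have [g gP] : exists g : nat -> nat, forall l, (l < D)%N ->
    (0 < g l <= G)%N /\ `|t l - grid_val G (g l)| <= 2 / G%:R.
  have /choice[g hg] : forall l, exists k, (l < D)%N ->
      (0 < k <= G)%N /\ `|t l - grid_val G k| <= 2 / G%:R.
    move=> l; case: (ltnP l D) => [hl|_]; last by exists 0%N.
    by have [k k1 k2] := grid_approx G0 (t1 l hl); exists k.
  by exists g.
have [|x' x'X [xt [xtK xtE] err]] := hcov i g (ltn_ord i); first by move=> l /gP[].
exists x' => //.
have x'K := hX x' x'X.
have [xx [xxK xxE]] := w_extreme u1.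
set ut := face_dir i (fun l => grid_val G (g l)) in xtE err.
have e1 : dotp (u1 - ut) (xx - x') <= D%:R * (2 / G%:R * (2 * 2 ^+ d)).
  have -> : u1 - ut = (u1 - face_dir i t) + (face_dir i t - ut) by rewrite addrA subrK.
  rewrite dotpDl dotpBr !(body_null wz) // subrr add0r face_dirB dotp_suml.
  rewrite mulr_natl -[X in _ *+ X]card_ord -sumr_const; apply: ler_sum => l _.
  rewrite dotpZl (le_trans (ler_norm _)) // normrM.
  have [_ h] := gP l (ltn_ord l); apply: ler_pM => //.
  rewrite dotpBr (le_trans (ler_normB _ _)) //.
  have al := basis_bound (bump_lt i (ltn_ord l)).
  by have := body_norm (a (bump i l)) xxK; have := body_norm (a (bump i l)) x'K; lra.
have e2 : dotp ut (xx - xt) <= 0 by rewrite dotpBr xtE subr_le0 xxK.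
have e3 : w u1 - dotp u1 x' <= eps.
  have -> : w u1 - dotp u1 x' =
      dotp (u1 - ut) (xx - x') + dotp ut (xx - xt) + dotp ut (xt - x').
    by rewrite dotpBl !dotpBr xxE; lra.
  lra.
have eps0 : 0 <= eps by have := x'K u1; lra.
have uE : u = y i *: u1 by rewrite scalerA mulfV // scale1r.
rewrite uE wZ dotpZl normrM mulrCA ler_wpM2l //.
by rewrite (le_trans _ (ler_norm _)) //; nra.
Qed.

End Faces.

End SymmetricBody.

(** * Layout of the input *)

Section Input.
Variables (R : realType) (d n : nat) (eps : R).
Variables (v : 'I_n -> 'rV[R]_d) (p : 'I_n -> R).

Definition input : nat -> R := nth 0 (input_reals eps v p).

Lemma nth_flatten_const (T : Type) (x0 : T) (m : nat) (ss : seq (seq T)) i k :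
  (forall j, (j < size ss)%N -> size (nth [::] ss j) = m) ->
  (i < size ss)%N -> (k < m)%N ->
  nth x0 (flatten ss) (m * i + k) = nth x0 (nth [::] ss i) k.
Proof.
elim: ss i => // s ss IH [|i] hs hi hk /=.
  by rewrite muln0 add0n nth_cat (hs 0%N isT) hk.
rewrite nth_cat (hs 0%N isT) ifF; last by apply/negbTE; rewrite -leqNgt; nia.
rewrite (_ : m * i.+1 + k - m = m * i + k)%N; last by nia.
by apply: IH => // j hj; apply: (hs j.+1).
Qed.

Lemma input_block (i : 'I_n) k : (k <= d)%N ->
  input (d.+1 * i + k.+1)%N = nth 0 (rcons [seq v i 0 j | j <- enum 'I_d] (p i)) k.
Proof.
move=> hk; rewrite /input /input_reals addnS.
set F := [seq rcons [seq v i 0 j | j <- enum 'I_d] (p i) | i <- enum 'I_n].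
have szF : size F = n by rewrite size_map size_enum_ord.
change (nth 0 (flatten F) (d.+1 * i + k) =
  nth 0 (rcons [seq v i 0 j | j <- enum 'I_d] (p i)) k).
rewrite (@nth_flatten_const _ _ d.+1) ?szF //.
  by rewrite (nth_map i) ?size_enum_ord // nth_ord_enum.
move=> j hj; rewrite (nth_map i) ?size_enum_ord //.
by rewrite size_rcons size_map size_enum_ord.
Qed.

Lemma coordin_input (i : 'I_n) (k : 'I_d) : coordin d input i k = v i 0 k.
Proof.
rewrite /coordin input_block ?[(k <= d)%N]ltnW // nth_rcons size_map size_enum_ord ltn_ord.
by rewrite (nth_map k) ?size_enum_ord // nth_ord_enum.
Qed.

Lemma probin_input (i : 'I_n) : probin d input i = p i.
Proof.
by rewrite /probin input_block // nth_rcons size_map size_enum_ord ltnn eqxx.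
Qed.

Lemma size_input : size (input_reals eps v p) = (n * d.+1).+1.
Proof.
rewrite -[LHS]/(size (flatten _)).+1 size_flatten /shape -map_comp; congr _.+1.
rewrite (eq_map (g := fun=> d.+1)); last first.
  by move=> i /=; rewrite size_rcons size_map size_enum_ord.
by rewrite sumnE big_map big_enum /= sum_nat_const card_ord.
Qed.

End Input.

Section ExtremeOracle.
Variables (R : realType) (d n : nat) (eps : R).
Variables (v : 'I_n -> 'rV[R]_d) (p : 'I_n -> R).
Hypothesis p01 : forall i, 0 < p i < 1.
Hypothesis n0 : (0 < n)%N.
Implicit Types (s : astate R).

Definition row_of s r (i : nat) : 'rV[R]_d := \row_k rm s r (i + k)%N.

Lemma eq_lastval (I : Type) (f f' q q' : I -> R) L :
  f =1 f' -> q =1 q' -> lastval f q L = lastval f' q' L.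
Proof.
move=> ef eq; elim/last_ind: L => // L i IH.
by rewrite !lastval_rcons ef eq IH.
Qed.

Lemma lastval_map (I J : Type) (g : J -> I) (f q : I -> R) L :
  lastval f q (map g L) = lastval (f \o g) (q \o g) L.
Proof. by rewrite /lastval; elim: L 0 => /= [//|j L IH] z; rewrite IH. Qed.

Lemma oracle_extremeP s :
  tri d n (input eps v p) (oracle d) (oracle_cost d n) (fun s' =>
    oracle_frame s s' /\
    extreme (expected_width v p) (row_of s 1 0) (row_of s' 2 0)) s.
Proof.
apply: tri_weaken (oracleP d _ s n0) (leqnn _) _ => s' [fr [L [pL so hx]]].
split=> //.
have [L' LE] : exists L' : seq 'I_n, L = map val L'.
  exists [seq insubd (Ordinal n0) i | i <- L].
  rewrite -map_comp -[LHS]map_id; apply/eq_in_map => i.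
  by rewrite (perm_mem pL) mem_iota => /andP[_ hi]; rewrite /= insubdK.
have pL' : perm_eq L' (enum 'I_n).
  by apply: (perm_map_inj val_inj); rewrite val_enum_ord -LE.
have keyE (i : 'I_n) : keyin d (input eps v p) s i = dotp (row_of s 1 0) (v i).
  by apply: eq_bigr => k _; rewrite mxE coordin_input.
have so' : sorted (fun i j => dotp (row_of s 1 0) (v i) <= dotp (row_of s 1 0) (v j)) L'.
  move: so; rewrite LE sorted_map; apply: sub_sorted => i j /=.
  by rewrite !keyE.
have := expected_width_extreme p01 pL' so'; congr extreme.
apply/rowP => k; rewrite !mxE add0n hx ?ltn_ord // LE -map_rev !lastval_map.
congr (_ - _); apply: eq_lastval => i /=; by rewrite ?coordin_input ?probin_input.
Qed.

End ExtremeOracle.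

(** * The elimination as a program *)

Section DualBasis.
Variable d : nat.

Definition basis_init : cmd :=
  seqc d (fun i => vset d 4 (NNum (i * d)) (fun k => RNat (NNum (k == i)))).

Definition basis_dot (i : nat) : rexp :=
  rsum d (fun k => RMul (rget d 4 (NNum (i * d + k))) (rget d 2 (NNum k))).

(** The factor is saved in a scalar because the row it is computed from is then overwritten entry by
    entry; [basis_pivot] saves the pivot for the same reason. *)
Definition basis_elim (j i : nat) : cmd :=
  if i == j then Skip else
  Seq (rset d 0 (NNum 1) (basis_dot i))
      (vset d 4 (NNum (i * d)) (fun k =>
         RSub (rget d 4 (NNum (i * d + k)))
              (RMul (rget d 0 (NNum 1)) (rget d 4 (NNum (j * d + k)))))).

Definition basis_pivot (j : nat) : cmd :=
  Seq (rset d 0 (NNum 0) (basis_dot j))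
  (If (RLt (RNat (NNum 0)) (rget d 0 (NNum 0)))
     (Seq (vset d 4 (NNum (j * d)) (fun k =>
             RDiv (rget d 4 (NNum (j * d + k))) (rget d 0 (NNum 0))))
          (seqc d (basis_elim j)))
     (vset d 4 (NNum (j * d)) (fun=> RNat (NNum 0)))).

Definition basis_load (j : nat) : cmd :=
  vset d 1 (NNum 0) (fun k => rget d 4 (NNum (j * d + k))).

Definition basis_stage (j : nat) : cmd :=
  Seq (basis_load j) (Seq (oracle d) (basis_pivot j)).

Definition basis_cmd : cmd := Seq basis_init (seqc d basis_stage).

End DualBasis.

Lemma in_blockE (e i j k : nat) : (k < e)%N ->
  (j * e <= i * e + k < j * e + e)%N = (i == j).
Proof.
move=> hk; case: (ltngtP i j) => [h|h|->].
- by apply/negbTE; nia.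
- by apply/negbTE; nia.
- by rewrite leq_addr ltn_add2l hk.
Qed.

Section DualBasisCorrect.
Variables (R : realType) (D n : nat) (eps : R).
Local Notation d := D.+1.
Variables (v : 'I_n -> 'rV[R]_d) (p : 'I_n -> R).
Hypothesis p01 : forall i, 0 < p i < 1.
Hypothesis n0 : (0 < n)%N.
Implicit Types (s : astate R) (a : nat -> 'rV[R]_d).
Local Notation w := (expected_width v p).
Local Notation tri := (tri d n (input eps v p)).
Local Notation conc := (conc d n (input eps v p)).

(** Existence is read off from a run of the oracle on a state that stores [u] as the direction. *)
Lemma expected_width_ex u : exists x, extreme w u x.
Proof.
pose s : astate R := AState (fun _ _ => 0%N) (fun r k => u 0 (inord k)) [::].
have [s' [t [_ _ [_ h]]]] := oracle_extremeP eps v p01 n0 s.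
exists (row_of d s' 2 0); suff {1}-> : u = row_of d s 1 0 by [].
by apply/rowP => k; rewrite mxE /= add0n inord_val.
Qed.

Lemma expected_widthN u : w (- u) = w u.
Proof. by apply: eq_bigr => A _; rewrite widthN. Qed.

Definition dual_row s (i : nat) : 'rV[R]_d := row_of d s 4 (i * d).

Definition basis_frame s s' :=
  [/\ forall r i, r \notin [:: 1; 2; 3; 4]%N -> nm s' r i = nm s r i,
      forall r i, (5 < r)%N -> rm s' r i = rm s r i & tp s' = tp s].

Lemma eq_basis_inv j a a' : (j <= d)%N ->
  (forall i, (i < d)%N -> a i = a' i) -> basis_inv w j a -> basis_inv w j a'.
Proof.
move=> jd E [nul [b [h1 h2 h3 h4]]]; exists nul, b; split.
- by move=> l lj nl; have [? h] := h1 l lj nl; split=> // i hi; rewrite -E // h.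
- by move=> i ij ni; rewrite -E ?h2 // (leq_trans ij).
- by move=> i ij; rewrite -E ?h3 // (leq_trans ij).
- move=> u; have [y y1 y2] := h4 u; exists y => //.
  by rewrite -y1; congr (w (u - _)); apply: eq_bigr => i _; rewrite E.
Qed.

Lemma dual_row_setV i j g s : dual_row (setV d 4 (j * d) g s) i =
  if i == j then \row_k g k else dual_row s i.
Proof.
apply/rowP => k; rewrite !mxE /= in_blockE //.
by case: eqVneq => [->|_]; rewrite !mxE // addKn.
Qed.

Lemma basis_initP s :
  tri (basis_init d) (fcost (basis_init d))
    (fun s' => basis_frame s s' /\ basis_inv w 0 (dual_row s')) s.
Proof.
rewrite fcost_seqc.
apply: (tri_weaken (Q := fun s' => basis_frame s s' /\
   forall i, (i < d)%N -> dual_row s' i = \row_k (k == i :> nat)%:R)).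
- apply: (@tri_seqc _ _ _ _ _ _ (fun m s' => basis_frame s s' /\
     forall i, (i < m)%N -> dual_row s' i = \row_k (k == i :> nat)%:R)) => //.
  move=> i s' hi [fr hs]; apply: (@tri_vset _ _ _ _ _ _ _ (fun k => (k == i)%:R)) => //.
  split.
    case: fr => f1 f2 f3; split=> // r l hr; rewrite /= -f2 //.
    by rewrite gtn_eqF // (ltn_trans _ hr).
  move=> l; rewrite ltnS leq_eqVlt dual_row_setV => /predU1P[->|hl]; rewrite ?eqxx //.
  by rewrite (ltn_eqF hl) hs.
- by [].
- move=> s' [fr h]; split=> //; apply: basis_inv0.
  + exact: expected_width_ex.
  + by move=> i k hi; rewrite h // mxE.
Qed.

Lemma reval_basis_dot s i :
  reval (conc s) (basis_dot d i) = dotp (dual_row s i) (row_of d s 2 0).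
Proof.
rewrite reval_rsum; apply: eq_bigr => k _; rewrite !mxE.
by ev.
Qed.

Lemma basis_pivotP j s s0 : (j < d)%N -> basis_frame s0 s ->
  tri (basis_pivot d j) (fcost (basis_pivot d j))
    (fun s' => basis_frame s0 s' /\ forall i, (i < d)%N ->
       dual_row s' i = dual_step j (row_of d s 2 0) (dual_row s) i) s.
Proof.
move=> hj [f1 f2 f3]; apply: tri_seq; apply: tri_rset => //.
rewrite reval_basis_dot; set x := row_of d s 2 0; rewrite /dual_step.
set c := dotp _ x; rewrite [neval _ _]/=.
set s1 := setR 0 0 c s.
apply: tri_if; rewrite /= reval_rget // => hc; rewrite hc; last first.
  apply: (@tri_vset _ _ _ _ _ _ _ (fun=> 0)) => //; split.
    split=> //= r i hr; rewrite (gtn_eqF (ltn_trans _ hr)) //=.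
    by rewrite (gtn_eqF (ltn_trans _ hr)) //= f2.
  move=> i hi; rewrite [neval _ _]/= dual_row_setV; case: eqVneq => // _.
  by apply/rowP => k; rewrite !mxE.
apply: tri_seq.
apply: (@tri_vset _ _ _ _ _ _ _ (fun k => rm s 4 (j * d + k)%N / c)) => //.
  by move=> k s' hk en er; ev; rewrite !er //= leqnn !orbT.
rewrite [neval _ _]/=; set s2 := setV _ _ _ _ _.
have aj2 : dual_row s2 j = c^-1 *: dual_row s j.
  by rewrite dual_row_setV eqxx; apply/rowP => k; rewrite !mxE mulrC.
have ai2 i : i != j -> dual_row s2 i = dual_row s i.
  by move=> /negPf ij; rewrite dual_row_setV ij; apply/rowP => k; rewrite !mxE.
have costE : fcost (seqc d (basis_elim d j)) =
    (\sum_(i <- iota 0 d) fcost (basis_elim d j i) + 1)%N by rewrite fcost_seqc.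
rewrite -[X in tri _ X]/(fcost (seqc d (basis_elim d j))) costE.
apply: tri_weaken (tri_seqc (P := fun m s' => [/\ basis_frame s0 s',
   row_of d s' 2 0 = x, dual_row s' j = c^-1 *: dual_row s j,
   forall i, i != j -> (m <= i < d)%N -> dual_row s' i = dual_row s i &
   forall i, i != j -> (i < m)%N -> dual_row s' i =
     dual_row s i - dotp (dual_row s i) x *: (c^-1 *: dual_row s j)]) _ _) (leqnn _) _.
- split=> //.
  + split=> //= r i hr; rewrite (gtn_eqF (ltn_trans _ hr)) //=.
    by rewrite (gtn_eqF (ltn_trans _ hr)) //= f2.
  + by move=> i /ai2.
- move=> i s' hi [[g1 g2 g3] hx hjj hge hlt]; rewrite /basis_elim; case: eqVneq => [ij|ij].
    apply: tri_skip => //; split=> //.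
      by move=> l lj hl; apply: hge => //; lia.
    move=> l lj; rewrite ltnS leq_eqVlt => /predU1P[E|]; last exact: hlt.
    by rewrite E ij eqxx in lj.
  apply: tri_seq; apply: tri_rset => //; rewrite reval_basis_dot hx hge ?leqnn //.
  rewrite [neval _ _]/=; set e := dotp _ x.
  apply: (@tri_vset _ _ _ _ _ _ _ (fun k => rm s' 4 (i * d + k)%N - e * rm s' 4 (j * d + k)%N)) => //.
    move=> k s'' hk en er; ev; rewrite !er //= ?leqnn ?orbT //.
    have := in_blockE j i hk; rewrite eq_sym (negPf ij).
    case: (ltnP (j * d + k) (i * d)) => //= _ /negbT; rewrite -leqNgt; lia.
  rewrite [neval _ _]/=; set s3 := setV _ _ _ _ _.
  have bE l : dual_row s3 l = if l == i then dual_row s' i - e *: dual_row s' j else dual_row s' l.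
    by rewrite dual_row_setV; case: eqVneq => _; apply/rowP => k; rewrite !mxE.
  split.
  + split=> //= r l hr; rewrite (gtn_eqF (ltn_trans _ hr)) //=.
    by rewrite (gtn_eqF (ltn_trans _ hr)) //= g2.
  + by rewrite -hx; apply/rowP => k; rewrite !mxE.
  + by rewrite bE eq_sym (negPf ij).
  + by move=> l lj /andP[h1 h2]; rewrite bE (gtn_eqF h1) hge // h2 ltnW.
  + move=> l lj; rewrite ltnS leq_eqVlt bE => /predU1P[->|hl].
      by rewrite eqxx hjj hge // leqnn hi.
    by rewrite (ltn_eqF hl) hlt.
- move=> s' [fr _ h1 _ h2]; split=> // i hi; case: eqVneq => [->|ij] //.
  exact: h2.
Qed.

Definition basis_cost := (fcost (basis_init d) +
  (\sum_(j <- iota 0 d) (fcost (basis_load d j) + (oracle_cost d n + fcost (basis_pivot d j))) + 1))%N.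

Lemma basis_cmdP s : tri (basis_cmd d) basis_cost
  (fun s' => basis_frame s s' /\ basis_inv w d (dual_row s')) s.
Proof.
apply: tri_seq; apply: tri_weaken (basis_initP s) (leqnn _) _ => s1 h1.
apply: (@tri_seqc _ _ _ _ _ _ (fun m s' => basis_frame s s' /\ basis_inv w m (dual_row s')) _ _ h1).
move=> j s' hj [[f1 f2 f3] inv]; apply: tri_seq.
apply: (@tri_vset _ _ _ _ _ _ _ (fun k => rm s' 4 (j * d + k)%N)) => //.
  by move=> k s'' hk en er; ev; rewrite !er.
apply: tri_seq; rewrite [neval _ _]/=; set s2 := setV _ _ _ _ _.
apply: tri_weaken (oracle_extremeP eps v p01 n0 s2) (leqnn _) _.
move=> s3 [[g1 g2 g3] ex]; apply: tri_weaken (@basis_pivotP j s3 s hj _) (leqnn _) _.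
  split=> [r i hr|r i hr|]; last by rewrite g3.
    by rewrite g1 // -f1.
  rewrite g2; last by rewrite !inE; lia.
  by rewrite /= (gtn_eqF (ltn_trans _ hr)) //= f2.
have uE : row_of d s2 1 0 = dual_row s' j.
  by apply/rowP => k; rewrite !mxE /= !add0n ltn_ord subn0.
have bE i : dual_row s3 i = dual_row s' i.
  by apply/rowP => k; rewrite !mxE g2.
move=> s4 [fr h]; split=> //; apply: (@eq_basis_inv _ (dual_step j (row_of d s3 2 0) (dual_row s'))) => //.
  by move=> i hi; rewrite h // /dual_step !bE; case: ifP => _; rewrite ?bE.
apply: dual_stepP => //.
- exact: expected_width_ex.
- exact: expected_widthN.
- by rewrite -uE.
Qed.

End DualBasisCorrect.

(** * Sampling the faces *)

Local Notation var k := (nget 0 (NNum k)).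
Local Notation varset k e := (nset 0 (NNum k) e).

(* Scalars, in array 0: 1 is the index of the current grid point, 2 the number
   G of grid values per axis, 3 the number m of cells per unit, 4 the number of
   cells per axis. *)
Section Setup.
Variable D : nat.
Local Notation d := D.+1.

(** Without a floor function, [G] and [m] are found by counting up; the time is linear in the
    result, which the final bound absorbs. *)
Definition search_body (k : nat) : cmd := varset k (NAdd (var k) (NNum 1)).
Definition search_test (e : rexp) (c : nat) : test := RLt e (RNat (NNum c)).
Definition search (k : nat) (e : rexp) (c : nat) : cmd :=
  Seq (varset k (NNum 1)) (While (search_test e c) (search_body k)).

Definition grid_test : rexp := RMul (RNat (var 2)) (RLoad (NNum 0)).
(** Comparing [m ^ 2 * eps] with [D] avoids a square root. *)
Definition cell_test : rexp :=
  RMul (RMul (RNat (var 3)) (RNat (var 3))) (RLoad (NNum 0)).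
(** With [G * eps] at least this number, the grid error [4 * D * 2 ^ d / G] is at most [eps / 2]. *)
Definition grid_bound : nat := 8 * D * 2 ^ d.

(** On a face, a parameter ranges over a length 2 and a functional over a length [2 * 2 ^ d], with
    [m] cells per unit; the successor counts the cell numbered 0. *)
Definition cells (m : nat) : nat := ((2 + 2 * 2 ^ d) * m).+1.

Definition power_body (r l : nat) : cmd :=
  Seq (nset r (NNum l.+1) (NAdd (nget r (NNum l.+1)) (nget r (NNum l))))
      (tmpset 0 (NAdd (tmp 0) (NNum 1))).
Definition power_test (e : nexp) : test := NLt (tmp 0) e.
Definition power_step (r : nat) (e : nexp) (l : nat) : cmd :=
  Seq (nset r (NNum l.+1) (NNum 0))
  (Seq (tmpset 0 (NNum 0)) (While (power_test e) (power_body r l))).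
(** Each power is the previous one added up [e] times, for want of a product of naturals. *)
Definition powers (r : nat) (e : nexp) : cmd :=
  Seq (nset r (NNum 0) (NNum 1)) (seqc D (power_step r e)).

Definition cells_set : cmd :=
  varset 4 (NAdd (nmul (2 + 2 * 2 ^ d) (var 3)) (NNum 1)).
Definition grid_base : nexp := NAdd (var 2) (NNum 1).

Definition setup : cmd :=
  Seq (search 2 grid_test grid_bound)
 (Seq (search 3 cell_test D)
 (Seq cells_set
 (Seq (powers 8 grid_base) (powers 9 (var 4))))).

Variables (R : realType) (n : nat) (inp : nat -> R).
Local Notation tri := (tri d n inp).
Local Notation conc := (conc d n inp).
Implicit Types (s : astate R).

Definition setup_frame s s' :=
  [/\ forall r i, r \notin [:: 0; 1; 8; 9]%N -> nm s' r i = nm s r i,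
      rm s' = rm s, tp s' = tp s & nm s' 0 1 = nm s 0 1].

Lemma setup_frame_trans s1 s2 s3 :
  setup_frame s1 s2 -> setup_frame s2 s3 -> setup_frame s1 s3.
Proof.
move=> [a1 a2 a3 a4] [b1 b2 b3 b4]; split; rewrite ?b2 ?b3 ?b4 //.
by move=> r i h; rewrite b1 ?a1.
Qed.

Lemma setup_frame_setN r i x s : r \in [:: 0; 1; 8; 9]%N -> (r != 0%N) || (i != 1%N) ->
  setup_frame s (setN r i x s).
Proof.
move=> hr hi; split=> //=; last first.
  by rewrite eq_sym (eq_sym 1%N); case: (r == _) (i == _) hi => -[].
by move=> r' j h; case: (eqVneq r' r) h => // ->; rewrite hr.
Qed.

Definition search_cost (k : nat) e c m :=
  (fcost (varset k (NNum 1)) + (tcost (search_test e c) + fcost (search_body k)) * m.+1)%N.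

Lemma searchP (k : nat) e c (f : nat -> R) : (1 < k)%N ->
  (forall s', reval (conc s') e = f (nm s' 0 k)) ->
  (exists N, c%:R <= f N.+1) ->
  exists m, [/\ (0 < m)%N, c%:R <= f m, (1 < m)%N -> f m.-1 < c%:R &
    forall s, tri (search k e c) (search_cost k e c m)
      (fun s' => [/\ setup_frame s s', nm s' 0 k = m &
         forall i, i != k -> nm s' 0 i = nm s 0 i]) s].
Proof.
move=> hk he hN; case: (ex_minnP hN) => N cN minN; exists N.+1; split=> //.
  move=> N0; rewrite ltNge; apply/negP => h.
  have := minN N.-1; rewrite prednK //; move/(_ h); lia.
move=> s; apply: tri_seq; apply: tri_nset => //; rewrite ![neval _ _]/=.
have frk x s' : setup_frame s s' -> setup_frame s (setN 0 k x s').
  move=> h; apply: setup_frame_trans h _; apply: setup_frame_setN => //.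
  by rewrite (gtn_eqF hk) orbT.
apply: tri_weaken (tri_whileC (N := N) (P := fun j s' =>
  [/\ setup_frame s s', nm s' 0 k = j.+1 & forall i, i != k -> nm s' 0 i = nm s 0 i])
  (T := fcost (search_body k)) _ _ _) _ _.
- split=> //=; first exact: frk.
  + by rewrite eqxx.
  + by move=> i /negPf ->.
- move=> j s' hj [fr ej ei]; split.
    rewrite /= he ej ltNge; apply/negP => h; have := minN _ h; lia.
  apply: tri_nset => //; ev; rewrite ej addn1; split=> /=; rewrite ?eqxx //.
    exact: frk.
  by move=> i ik; rewrite (negPf ik) ei.
- by move=> s' [_ ej _]; rewrite /= he ej; apply/negbTE; rewrite -leNgt.
- by rewrite leq_mul2l leqnSn orbT.
- by [].
Qed.

Definition power_const (r : nat) e := (fcost (nset r (NNum 1) (NNum 0)) +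
  fcost (tmpset 0 (NNum 0)) + (tcost (power_test e) + fcost (power_body r 0)))%N.

Definition powers_cost (r : nat) e b := (fcost (nset r (NNum 0) (NNum 1)) +
  (D * (power_const r e * b.+1) + 1))%N.

Lemma powersP r e b s : r \in [:: 8; 9]%N ->
  (forall s', (forall i, nm s' 0 i = nm s 0 i) -> neval (conc s') e = b) ->
  tri (powers r e) (powers_cost r e b)
    (fun s' => [/\ setup_frame s s', forall i, nm s' 0 i = nm s 0 i,
       forall r' i, r' != r -> r' != 1%N -> nm s' r' i = nm s r' i &
       forall l, (l <= D)%N -> nm s' r l = (b ^ l)%N]) s.
Proof.
move=> hr he.
have r16 : (r < 16)%N by move: hr; rewrite !inE => /orP[] /eqP ->.
have r0 : (0 == r)%N = false by move: hr; rewrite !inE => /orP[] /eqP ->.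
have r1 : (1 == r)%N = false by move: hr; rewrite !inE => /orP[] /eqP ->.
have frr i x s' : setup_frame s s' -> setup_frame s (setN r i x s').
  move=> h; apply: setup_frame_trans h _; apply: setup_frame_setN.
    by move: hr; rewrite !inE => /orP[] /eqP ->.
  by rewrite eq_sym r0.
have fr1 i x s' : setup_frame s s' -> setup_frame s (setN 1 i x s').
  by move=> h; apply: setup_frame_trans h _; apply: setup_frame_setN.
apply: tri_seq; apply: tri_nset => //; rewrite ![neval _ _]/=.
apply: tri_weaken (tri_seqc (k := D) (T := fun=> (power_const r e * b.+1)%N) (P := fun m s' =>
  [/\ setup_frame s s', forall i, nm s' 0 i = nm s 0 i,
      forall r' i, r' != r -> r' != 1%N -> nm s' r' i = nm s r' i &
      forall l, (l <= m)%N -> nm s' r l = (b ^ l)%N]) _ _) _ _.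
- split=> //=; first exact: frr.
  + by move=> i; rewrite r0.
  + by move=> r' i /negPf ->.
  + by move=> l; rewrite leqn0 => /eqP ->; rewrite !eqxx.
- move=> l s' hl [fr e0 eo ep].
  apply: (@tri_weaken _ _ _ _ _ (fcost (nset r (NNum l.+1) (NNum 0)) + (fcost (tmpset 0 (NNum 0)) +
    (tcost (power_test e) + fcost (power_body r l)) * b.+1)) _ _ _ _ _ _ (fun _ h => h)); last first.
    rewrite (_ : fcost (power_body r l) = fcost (power_body r 0)) //.
    rewrite (_ : fcost (nset r (NNum l.+1) _) = fcost (nset r (NNum 1) (NNum 0))) //.
    rewrite /power_const; move: (fcost _) (fcost (tmpset _ _)) (tcost _ + _)%N => x y z; nia.
  apply: tri_seq; apply: tri_nset => //; apply: tri_seq; apply: tri_nset => //.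
  apply: tri_weaken (tri_whileC (N := b) (T := fcost (power_body r l)) (P := fun j s'' =>
    [/\ setup_frame s s'', forall i, nm s'' 0 i = nm s 0 i,
      forall r' i, r' != r -> r' != 1%N -> nm s'' r' i = nm s r' i &
      [/\ nm s'' 1 0 = j, forall l', (l' <= l)%N -> nm s'' r l' = (b ^ l')%N &
      nm s'' r l.+1 = (j * b ^ l)%N]]) _ _ _) (leqnn _) _.
  + rewrite ![neval _ _]/=; split=> /=.
    * by apply: fr1; apply: frr.
    * by move=> i; rewrite r0 e0.
    * by move=> r' i /negPf hr' /negPf h1; rewrite hr' h1 /= eo ?hr' ?h1.
    * rewrite (eq_sym r) r1 /= !eqxx; split=> // l' hl'.
      by rewrite ltn_eqF // ep.
  + move=> j s'' hj [fr' e0' eo' [ej el es]]; split.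
      by ev; rewrite ej he // => i; rewrite e0'.
    apply: tri_seq; apply: tri_nset => //; apply: tri_nset => //.
    ev; rewrite r1 /= ej es el // addn1; split=> /=.
    * by apply: fr1; apply: frr.
    * by move=> i; rewrite r0 e0'.
    * by move=> r' i /negPf hr' /negPf h1; rewrite hr' h1 /= eo' ?hr' ?h1.
    * rewrite (eq_sym r) r1 /= !eqxx mulSnr; split=> // l' hl'.
      by rewrite ltn_eqF // el.
  + by move=> s'' [_ e0' _ [ej _ _]]; ev; rewrite ej he ?ltnn // => i; rewrite e0'.
  + move=> s'' [fr' e0' eo' [_ el es]]; split=> // l'; rewrite leq_eqVlt => /predU1P[->|].
      by rewrite es expnS.
    by rewrite ltnS => /el.
- by rewrite big_const_seq count_predT size_iota iter_addn_0 mulnC.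
- by [].
Qed.

Record env (G m : nat) s : Prop := Env {
  env_G : nm s 0 2 = G;
  env_m : nm s 0 3 = m;
  env_grid : forall l, (l <= D)%N -> nm s 8 l = (G.+1 ^ l)%N;
  env_cells : forall l, (l <= D)%N -> nm s 9 l = (cells m ^ l)%N }.

Definition setup_cost G m := (search_cost 2 grid_test grid_bound G +
  (search_cost 3 cell_test D m + (fcost cells_set +
  (powers_cost 8 grid_base G.+1 + powers_cost 9 (var 4) (cells m)))))%N.

Lemma setupP : 0 < inp 0%N -> exists G m,
  [/\ (0 < G)%N, grid_bound%:R <= G%:R * inp 0%N,
     (1 < G)%N -> G.-1%:R * inp 0%N < grid_bound%:R &
  [/\ (0 < m)%N, D%:R <= m%:R ^+ 2 * inp 0%N,
     (1 < m)%N -> m.-1%:R ^+ 2 * inp 0%N < D%:R &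
     forall s, tri setup (setup_cost G m) (fun s' => setup_frame s s' /\ env G m s') s]].
Proof.
move=> e0.
have arch (c : nat) : exists N, c%:R <= N.+1%:R * inp 0%N.
  have [N hN] : exists N : nat, c%:R / inp 0%N <= N%:R.
    by exists (Num.truncn (c%:R / inp 0%N)).+1; apply/ltW/truncnS_gt.
  by exists N; rewrite -ler_pdivrMr // (le_trans hN) // ler_nat.
have [||G [G0 G1 G2 trG]] := @searchP 2 grid_test grid_bound (fun N => N%:R * inp 0%N) isT.
  by move=> s'; ev.
  by apply: arch.
have [||m [m0 m1 m2 trm]] := @searchP 3 cell_test D (fun N => N%:R ^+ 2 * inp 0%N) isT.
- by move=> s'; ev; rewrite expr2.
- have [N hN] := arch D; exists N; rewrite (le_trans hN) // ler_pM2r //.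
  by rewrite expr2 ler_peMl // ler1n.
exists G, m; split=> //; split=> // s.
apply: tri_seq; apply: tri_weaken (trG s) (leqnn _) _ => s1 [fr1 eG oth1].
apply: tri_seq; apply: tri_weaken (trm s1) (leqnn _) _ => s2 [fr2 em oth2].
apply: tri_seq; apply: tri_nset => //.
ev; rewrite neval_nmul; ev; rewrite em addn1 -/(cells m); set s3 := setN _ _ _ _.
apply: tri_seq; apply: tri_weaken (@powersP 8 grid_base G.+1 s3 _ _) (leqnn _) _ => //.
  by move=> s' h; ev; rewrite h /= oth2 // eG addn1.
move=> s4 [fr4 oth4 oth4' pw4].
apply: tri_weaken (@powersP 9 (var 4) (cells m) s4 _ _) (leqnn _) _ => //.
  by move=> s' h; ev; rewrite h oth4.
move=> s5 [fr5 oth5 oth5' pw5]; split.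
  apply: setup_frame_trans fr5; apply: setup_frame_trans fr4.
  apply: setup_frame_trans (setup_frame_setN _ _ _ _) => //.
  exact: setup_frame_trans fr2.
split=> //.
- by rewrite oth5 oth4 /= oth2.
- by rewrite oth5 oth4.
- by move=> l hl; rewrite oth5' ?pw4.
Qed.

End Setup.

(** * Grid indices and nested loops *)

Definition radix (D b : nat) (f : nat -> nat) : nat :=
  (\sum_(l < D) f l * b ^ l)%N.

Lemma radix_lt D b f : (forall l, (l < D)%N -> (f l < b)%N) -> (radix D b f < b ^ D)%N.
Proof.
elim: D => [|D IH] h; first by rewrite /radix big_ord0.
rewrite /radix big_ord_recr /= -/(radix D b f) expnS.
have h1 : (radix D b f < b ^ D)%N by apply: IH => l hl; apply: h; rewrite ltnW.
have := h D (ltnSn D); nia.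
Qed.

Lemma radix_inj D b f f' : (forall l, (l < D)%N -> (f l < b)%N) ->
  (forall l, (l < D)%N -> (f' l < b)%N) -> radix D b f = radix D b f' ->
  forall l, (l < D)%N -> f l = f' l.
Proof.
elim: D => // D IH h h'; rewrite /radix !big_ord_recr /= -!/(radix D b _) => E.
have r1 : (radix D b f < b ^ D)%N by apply: radix_lt => l hl; apply: h; rewrite ltnW.
have r2 : (radix D b f' < b ^ D)%N by apply: radix_lt => l hl; apply: h'; rewrite ltnW.
have e : f D = f' D by nia.
move=> l; rewrite ltnS leq_eqVlt => /predU1P[->//|hl].
apply: IH hl.
- by move=> k hk; apply: h; rewrite ltnW.
- by move=> k hk; apply: h'; rewrite ltnW.
- by move: E; rewrite e => /addIn.
Qed.

(* Grid points are the digit sequences in {1 .. G}^D.  During the loops digit l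
   is in entry l of array 7 and the index of the grid point, in base G + 1, is
   scalar 1. *)
Definition incr_digit (l : nat) : cmd :=
  Seq (nset 7 (NNum l) (NAdd (nget 7 (NNum l)) (NNum 1)))
      (varset 1 (NAdd (var 1) (nget 8 (NNum l)))).
Definition decr_digit (l : nat) : cmd :=
  Seq (nset 7 (NNum l) (NSub (nget 7 (NNum l)) (NNum 1)))
      (varset 1 (NSub (var 1) (nget 8 (NNum l)))).
Definition incr_test (l : nat) : test := NLt (nget 7 (NNum l)) (var 2).
Definition decr_test (l : nat) : test := NLt (NNum 0) (nget 7 (NNum l)).

(** The digit is counted back to 0, not reset, because the index of the grid point has to be
    restored along with it. *)
Definition for_cmd (l : nat) (body : cmd) : cmd :=
  Seq (While (incr_test l) (Seq (incr_digit l) body))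
      (While (decr_test l) (decr_digit l)).

Definition nest (js : seq nat) (body : cmd) : cmd := foldr for_cmd body js.

(** The points in the order in which [nest js] visits them, so that an invariant can refer to those
    already visited. *)
Fixpoint gridseq (G : nat) (js : seq nat) (t : seq nat) : seq (seq nat) :=
  if js is j :: js' then
    flatten [seq gridseq G js' (set_nth 0%N t j k) | k <- iota 1 G]
  else [:: t].

Lemma size_set_digit t D j k : size t = D -> (j < D)%N ->
  size (set_nth 0%N t j k) = D.
Proof. by move=> <- hj; rewrite size_set_nth; apply/maxn_idPr. Qed.

Lemma mem_gridseq G D js t t' : uniq js -> all (fun j => j < D)%N js ->
  size t = D -> t' \in gridseq G js t ->
  [/\ size t' = D, forall l, l \notin js -> nth 0%N t' l = nth 0%N t l &
      forall l, l \in js -> (0 < nth 0%N t' l <= G)%N].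
Proof.
elim: js t => [|j js IH] t /=.
  by move=> _ _ st; rewrite inE => /eqP ->.
move=> /andP[jjs ujs] /andP[jD aD] st /flattenP[x /mapP[k]].
rewrite mem_iota add1n ltnS => hk -> tx.
have [s1 s2 s3] := IH _ ujs aD (size_set_digit k st jD) tx; split=> //.
- by move=> l; rewrite inE negb_or => /andP[/negPf lj ljs]; rewrite s2 // nth_set_nth /= lj.
- by move=> l; rewrite inE => /predU1P[->|]; [rewrite s2 // nth_set_nth /= eqxx|apply: s3].
Qed.

Lemma gridseq_mem G D js t t' : all (fun j => j < D)%N js ->
  size t = D -> size t' = D ->
  (forall l, l \notin js -> nth 0%N t' l = nth 0%N t l) ->
  (forall l, l \in js -> (0 < nth 0%N t' l <= G)%N) -> t' \in gridseq G js t.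
Proof.
elim: js t => [|j js IH] t /=.
  move=> _ st st' h _; rewrite inE; apply/eqP; apply: (@eq_from_nth _ 0%N).
    by rewrite st st'.
  by move=> i _; apply: h.
move=> /andP[jD aD] st st' h1 h2; apply/flattenP.
exists (gridseq G js (set_nth 0%N t j (nth 0%N t' j))).
  apply: map_f; rewrite mem_iota add1n ltnS; apply: h2; exact: mem_head.
apply: IH => //; first exact: size_set_digit.
- move=> l ljs; rewrite nth_set_nth /=; case: eqVneq => [->//|lj].
  by apply: h1; rewrite inE negb_or lj.
- by move=> l ljs; apply: h2; rewrite inE ljs orbT.
Qed.

Section Loops.
Variables (R : realType) (D n : nat) (inp : nat -> R) (G m : nat).
Local Notation d := D.+1.
Local Notation tri := (tri d n inp).
Local Notation conc := (conc d n inp).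
Implicit Types (s : astate R) (t : seq nat).

Definition flat t : nat := radix D G.+1 (nth 0%N t).
Definition digits t s :=
  (forall l, (l < D)%N -> nm s 7 l = nth 0%N t l) /\ nm s 0 1 = flat t.

(** Stated with sums on both sides because subtraction of naturals truncates. *)
Lemma flat_set t l k : (l < D)%N ->
  (flat (set_nth 0 t l k) + nth 0 t l * G.+1 ^ l = flat t + k * G.+1 ^ l)%N.
Proof.
move=> hl; rewrite /flat /radix (bigD1 (Ordinal hl)) //= [in RHS](bigD1 (Ordinal hl)) //=.
rewrite nth_set_nth /= eqxx.
rewrite (eq_bigr (fun i : 'I_D => nth 0 t i * G.+1 ^ i)%N); last first.
  by move=> i; rewrite -val_eqE nth_set_nth /= => /negPf ->.
by rewrite addnAC [RHS]addnAC [X in (X + _)%N = _]addnC.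
Qed.

Lemma eq_digits t t' s : (forall l, nth 0%N t l = nth 0%N t' l) ->
  digits t s -> digits t' s.
Proof.
move=> h [h1 h2]; split; first by move=> l hl; rewrite h1 ?h.
by rewrite h2; apply: eq_bigr => i _; rewrite h.
Qed.

Lemma digits_set t l k s : (l < D)%N -> nm s 0 1 = flat (set_nth 0%N t l k) ->
  nm s 7 l = k -> (forall l', (l' < D)%N -> l' != l -> nm s 7 l' = nth 0%N t l') ->
  digits (set_nth 0%N t l k) s.
Proof.
move=> hl h1 h2 h3; split=> // l' hl'; rewrite nth_set_nth /=.
by case: eqVneq => [->//|ne]; apply: h3.
Qed.

Definition for_const := (tcost (incr_test 0) + fcost (incr_digit 0) +
  (tcost (decr_test 0) + fcost (decr_digit 0)))%N.

(** Digits and grid index change outside the loop body, so invariants must be insensitive to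
    them. *)
Definition digit_stable (P : astate R -> Prop) :=
  forall s l x, P s -> P (setN 7 l x s) /\ P (setN 0 1 x s).

Lemma forP l body (P : nat -> astate R -> Prop) (T : nat -> nat) t s :
  (l < D)%N -> nth 0%N t l = 0%N -> digits t s -> P 0%N s ->
  (forall k s', P k s' -> env D G m s') -> (forall k, digit_stable (P k)) ->
  (forall k s', (k < G)%N -> P k s' -> digits (set_nth 0%N t l k.+1) s' ->
     tri body (T k) (fun s'' => P k.+1 s'' /\ digits (set_nth 0%N t l k.+1) s'') s') ->
  tri (for_cmd l body) (\sum_(k < G) (for_const + T k) + for_const * G.+1)
    (fun s' => P G s' /\ digits t s') s.
Proof.
move=> hl tl dg p0 pE pS hb.
have flE k : flat (set_nth 0%N t l k) = (flat t + k * G.+1 ^ l)%N.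
  by have := flat_set t k hl; rewrite tl mul0n addn0.
have pS2 k s' x y : P k s' -> P k (setN 0 1 y (setN 7 l x s')).
  by move=> /(pS k _ l x)[h _]; have [_] := pS k _ 0%N y h.
pose T1 := (\sum_(k < G) (tcost (incr_test l) + (fcost (incr_digit l) + T k)) +
  tcost (incr_test l))%N.
pose T2 := ((tcost (decr_test l) + fcost (decr_digit l)) * G.+1)%N.
apply: (@tri_weaken _ _ _ _ _ (T1 + T2)%N _ _ _ _ _ _ (fun _ h => h)); last first.
  rewrite /T1 /T2 /for_const.
  rewrite (_ : tcost (incr_test l) = tcost (incr_test 0)) //.
  rewrite (_ : fcost (incr_digit l) = fcost (incr_digit 0)) //.
  rewrite (_ : tcost (decr_test l) = tcost (decr_test 0)) //.
  rewrite (_ : fcost (decr_digit l) = fcost (decr_digit 0)) //.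
  move: (tcost (incr_test 0)) (tcost (decr_test 0)) => a b.
  move: (fcost (incr_digit 0)) (fcost (decr_digit 0)) => c e.
  rewrite !big_split /= !sum_nat_const card_ord.
  move: (\sum_(_ < _) _)%N => f; nia.
apply: tri_seq.
apply: (@tri_weaken _ _ _ _ _ T1 _ (fun s' => P G s' /\ digits (set_nth 0%N t l G) s')) => //.
- apply: (@tri_while _ _ _ _ _ _ G (fun k s' => P k s' /\ digits (set_nth 0%N t l k) s')
    (fun k => fcost (incr_digit l) + T k)%N).
  + split=> //; apply: eq_digits dg => l'; rewrite nth_set_nth /=.
    by case: eqVneq => // ->.
  + move=> k s' hk [pk [dk fk]]; have [eG _ eg _] := pE _ _ pk.
    have e7 : nm s' 7 l = k by rewrite dk // nth_set_nth /= eqxx.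
    split; first by ev; rewrite e7 eG.
    apply: tri_seq; apply: tri_seq; apply: tri_nset => //; apply: tri_nset => //.
    ev; rewrite e7 addn1 fk eg 1?ltnW //.
    apply: hb => //; first exact: pS2.
    apply: digits_set => //=; rewrite ?eqxx //.
      by rewrite !flE mulSnr addnA.
    by move=> l' hl' /negPf ne; rewrite ne dk // nth_set_nth /= ne.
  + move=> s' [pk [dk fk]]; have [eG _ _ _] := pE _ _ pk.
    by ev; rewrite eG dk // nth_set_nth /= eqxx ltnn.
- move=> s1 [pG dG].
  apply: tri_weaken (tri_whileC (N := G) (P := fun k s' => P G s' /\
    digits (set_nth 0%N t l (G - k)%N) s') (T := fcost (decr_digit l)) _ _ _) _ _.
  + by rewrite subn0.
  + move=> k s' hk [pk [dk fk]]; have [eG _ eg _] := pE _ _ pk.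
    have e7 : nm s' 7 l = (G - k)%N by rewrite dk // nth_set_nth /= eqxx.
    split; first by ev; rewrite e7 subn_gt0.
    apply: tri_seq; apply: tri_nset => //; apply: tri_nset => //.
    ev; rewrite e7 fk eg 1?ltnW //; split; first exact: pS2.
    apply: digits_set => //=.
    * rewrite !flE; have -> : (G - k = (G - k.+1).+1)%N by lia.
      by rewrite mulSnr addnA addnK.
    * by rewrite eqxx; lia.
    * by move=> l' hl' /negPf ne; rewrite ne dk // nth_set_nth /= ne.
  + by move=> s' [pk [dk _]]; ev; rewrite dk // nth_set_nth /= eqxx subnn.
  + by [].
  + move=> s' [pk dk]; split=> //; apply: eq_digits dk => l'.
    by rewrite nth_set_nth /= subnn; case: eqVneq => // ->.
Qed.

Fixpoint nest_cost (T q : nat) : nat :=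
  if q is q'.+1 then (G * (for_const + nest_cost T q') + for_const * G.+1)%N
  else T.

Lemma nest_cost_le T q : (0 < G)%N ->
  (nest_cost T q <= (T + 3 * for_const) * G.+1 ^ q)%N.
Proof.
(* The extra [3 * for_const] on the left pays for the loop overhead of the next level and makes the
   induction close. *)
move=> G0; suff : (nest_cost T q + 3 * for_const <= (T + 3 * for_const) * G.+1 ^ q)%N.
  by apply: leq_trans; rewrite leq_addr.
elim: q => [|q IH] /=; first by rewrite muln1.
rewrite expnS mulnCA; apply: leq_trans (leq_mul (leqnn G.+1) IH).
move: (nest_cost _ _) for_const => x y; nia.
Qed.

Lemma nestP js body T (P : seq (seq nat) -> astate R -> Prop) done t s :
  uniq js -> all (fun j => j < D)%N js -> size t = D ->
  (forall l, l \in js -> nth 0%N t l = 0%N) -> digits t s -> P done s ->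
  (forall l s', P l s' -> env D G m s') -> (forall l, digit_stable (P l)) ->
  (forall l t' s', t' \in gridseq G js t -> P l s' -> digits t' s' ->
     tri body T (fun s'' => P (rcons l t') s'' /\ digits t' s'') s') ->
  tri (nest js body) (nest_cost T (size js))
    (fun s' => P (done ++ gridseq G js t) s' /\ digits t s') s.
Proof.
move=> + + + + + + pE pS; elim: js done t s => [|j js IH] done t s.
  move=> _ _ st _ dg pd hb; apply: tri_weaken (hb done t s _ pd dg) _ _ => //.
    by rewrite mem_head.
  by move=> s'; rewrite -cats1.
move=> /= /andP[jjs ujs] /andP[jD aD] st t0 dg pd hb.
pose Pk k s' := P (done ++ flatten [seq gridseq G js (set_nth 0%N t j k) | k <- iota 1 k]) s'.
apply: tri_weaken (@forP j (nest js body) Pk (fun=> nest_cost T (size js)) t s jD _ dg _ _ _ _) _ _ => //.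
- by apply: t0; rewrite mem_head.
- by rewrite /Pk /= cats0.
- by move=> k s' /pE.
- by move=> k; apply: pS.
- move=> k s' hk pk dk.
  have : Pk k.+1 = P ((done ++ flatten [seq gridseq G js (set_nth 0%N t j k') | k' <- iota 1 k])
       ++ gridseq G js (set_nth 0%N t j k.+1)).
    rewrite /Pk (_ : iota 1 k.+1 = rcons (iota 1 k) k.+1).
      by rewrite map_rcons flatten_rcons catA.
    by rewrite -cats1 -[in LHS](addn1 k) iotaD add1n.
  move=> ->; apply: IH => //; first exact: size_set_digit.
    move=> l ljs; rewrite nth_set_nth /=; case: eqVneq => [E|_].
      by rewrite -E ljs in jjs.
    by apply: t0; rewrite inE ljs orbT.
  move=> l t' s'' ht'; apply: hb; apply/flattenP.
  exists (gridseq G js (set_nth 0%N t j k.+1)) => //.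
  by apply: map_f; rewrite mem_iota add1n ltnS.
- by rewrite sum_nat_const card_ord.
Qed.

End Loops.

Section Ceiling.
Variable R : realType.
Implicit Types y : R.

Lemma ceiln_ex y : exists N : nat, y <= N%:R.
Proof. by exists (Num.truncn y).+1; apply/ltW/truncnS_gt. Qed.

(** The value at which a count from 0 stops, hence 0 for a negative argument. *)
Definition ceiln y : nat := ex_minn (ceiln_ex y).

Lemma ltn_ceiln k y : (k < ceiln y)%N = (k%:R < y).
Proof.
rewrite /ceiln; case: ex_minnP => N yN minN; rewrite ltNge.
apply/idP/negP => [kN|h].
  by move=> /minN; rewrite leqNgt kN.
rewrite ltnNge; apply/negP => Nk; apply: h.
by rewrite (le_trans yN) // ler_nat.
Qed.

Lemma ceiln_le y N : y <= N%:R -> (ceiln y <= N)%N.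
Proof. by rewrite leqNgt ltn_ceiln -leNgt. Qed.

Lemma le_ceiln y y' : y <= y' -> (ceiln y <= ceiln y')%N.
Proof.
move=> h; apply: ceiln_le; apply: le_trans h _.
by rewrite leNgt -ltn_ceiln ltnn.
Qed.

(** A common positive ceiling confines both numbers to an interval of length 1; for the ceiling 0
    the two sign hypotheses do so. *)
Lemma ceiln_close y y' : 0 <= y -> 0 <= y' -> ceiln y = ceiln y' ->
  `|y - y'| <= 1.
Proof.
move=> y0 y0' E.
have u : y <= (ceiln y)%:R by rewrite leNgt -ltn_ceiln ltnn.
have u' : y' <= (ceiln y)%:R by rewrite E leNgt -ltn_ceiln ltnn.
case C : (ceiln y) E u u' => [|c] E u u'; first by rewrite ler_norml; lra.
have l : c%:R < y by rewrite -ltn_ceiln C.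
have l' : c%:R < y' by rewrite -ltn_ceiln -E.
by move: u u'; rewrite -natr1 ler_norml => u u'; lra.
Qed.

End Ceiling.

(** * The programs for one face *)

Section FaceCommands.
Variables (D : nat).
Local Notation d := D.+1.

Definition grid_expr (l : nat) : rexp :=
  RSub (RDiv (RMul (RNat (NNum 2)) (RNat (nget 7 (NNum l)))) (RNat (var 2)))
       (RNat (NNum 1)).
Definition dir_expr (i k : nat) : rexp :=
  RAdd (rget d 4 (NNum (i * d + k)))
       (rsum D (fun l => RMul (grid_expr l) (rget d 4 (NNum (bump i l * d + k))))).
Definition load_dir (i : nat) : cmd := vset d 1 (NNum 0) (dir_expr i).

(* The sample at the grid point of index f is row f of array 6 of the real
   memory; its scaled cell number along axis j is entry (f, j) of array 5 of
   the natural-number memory. *)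
Definition point_base : nexp := nmul d (var 1).
Definition store_point : cmd := vset d 6 point_base (fun k => rget d 2 (NNum k)).
Definition sample_body (i : nat) : cmd :=
  Seq (load_dir i) (Seq (oracle d) store_point).
Definition sample_cmd (i : nat) : cmd := nest (iota 0 D) (sample_body i).

Definition cell_idx (j : nat) : nexp := NAdd (nmul D (var 1)) (NNum j).
Definition walk : nexp := nget 10 (NNum 0).
(** The summand [1 + 2 ^ d] makes the height nonnegative. It is multiplied by the power of the
    number of cells that belongs to axis [j], and the walk moves in steps of that power, so that the
    key of a cell is a plain sum of stored numbers. *)
Definition height_expr (i j : nat) : rexp :=
  RMul (RNat (nget 9 (NNum j)))
  (RMul (RNat (var 3))
    (RAdd (RAdd (grid_expr j)
      (rsum d (fun k => RMul (rget d 4 (NNum (bump i j * d + k)))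
                             (rget d 6 (NAdd point_base (NNum k))))))
      (RNat (NNum (1 + 2 ^ d))))).
Definition walk_test (i j : nat) : test := RLt (RNat walk) (height_expr i j).
Definition walk_body (j : nat) : cmd :=
  nset 10 (NNum 0) (NAdd walk (nget 9 (NNum j))).
Definition line_body (i j : nat) : cmd :=
  Seq (While (walk_test i j) (walk_body j)) (nset 5 (cell_idx j) walk).
(** The pointer is reset once per grid line and only moves up inside it. *)
Definition line_cmd (i j : nat) : cmd :=
  Seq (nset 10 (NNum 0) (NNum 0)) (for_cmd j (line_body i j)).
(** Axis [j] is made the innermost loop, so that consecutive grid points differ on it alone. *)
Definition bucket_cmd (i j : nat) : cmd :=
  nest (rem j (iota 0 D)) (line_cmd i j).

Definition nsum (k : nat) (f : nat -> nexp) : nexp :=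
  foldr NAdd (NNum 0) [seq f l | l <- iota 0 k].
(* Entry k of array 6 is i + 1 when cell k already has a sample on face i, so no
   marks have to be cleared between faces. *)
Definition key_expr : nexp := nsum D (fun l => nget 5 (cell_idx l)).
Definition emit_point : cmd :=
  Seq (seqc d (fun k => Write (RDiv (rget d 6 (NAdd point_base (NNum k))) (RNat (NNum 2)))))
      (seqc d (fun k => Write (RDiv (RSub (RNat (NNum 0)) (rget d 6 (NAdd point_base (NNum k))))
                                    (RNat (NNum 2))))).
Definition select_body (i : nat) : cmd :=
  If (NLt (nget 6 key_expr) (NNum i.+1))
     (Seq (nset 6 key_expr (NNum i.+1)) emit_point) Skip.
Definition select_cmd (i : nat) : cmd := nest (iota 0 D) (select_body i).

Definition face_cmd (i : nat) : cmd :=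
  Seq (sample_cmd i) (Seq (seqc D (bucket_cmd i)) (select_cmd i)).

End FaceCommands.

Lemma neval_nsum (R : realType) (st : state R) k f :
  neval st (nsum k f) = (\sum_(l < k) neval st (f l))%N.
Proof.
rewrite -(big_mkord xpredT (fun l => neval st (f l))) /index_iota subn0 /nsum.
by elim: (iota 0 k) => [|l r IH]; rewrite ?big_nil //= big_cons IH.
Qed.

Lemma tri_writes (R : realType) (d n : nat) (inp : nat -> R) k f (g : nat -> R) Q s :
  (forall l s', (l < k)%N -> nm s' = nm s -> rm s' = rm s ->
     reval (conc d n inp s') (f l) = g l) ->
  Q (AState (nm s) (rm s) (tp s ++ mkseq g k)) ->
  tri d n inp (seqc k (fun l => Write (f l))) (fcost (seqc k (fun l => Write (f l)))) Q s.
Proof.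
move=> hf hQ; rewrite fcost_seqc.
apply: tri_weaken (tri_seqc (P := fun l s' =>
  s' = AState (nm s) (rm s) (tp s ++ mkseq g l)) _ _) (leqnn _) _.
- by rewrite cats0; case: (s).
- move=> l s' hl ->; apply: tri_write; rewrite /emit /= hf // rcons_cat.
  by rewrite /mkseq -[in RHS]addn1 iotaD map_cat cats1.
- by move=> s' ->.
Qed.

Lemma mkseq_row (R : realType) (D : nat) (q : 'rV[R]_D.+1) :
  mkseq (fun k => q 0 (inord k)) D.+1 = [seq q 0 j | j <- enum 'I_D.+1].
Proof.
rewrite /mkseq -val_enum_ord -map_comp; apply/eq_map => k /=.
by rewrite inord_val.
Qed.

Definition antipodal (R : realType) (D : nat) (X : seq 'rV[R]_D) : seq 'rV[R]_D :=
  flatten [seq [:: 2^-1 *: q; - (2^-1 *: q)] | q <- X].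

Lemma coordinates_cat (R : realType) (D : nat) (X Y : seq 'rV[R]_D) :
  coordinates (X ++ Y) = coordinates X ++ coordinates Y.
Proof. by rewrite /coordinates map_cat flatten_cat. Qed.

Lemma antipodal_cat (R : realType) (D : nat) (X Y : seq 'rV[R]_D) :
  antipodal (X ++ Y) = antipodal X ++ antipodal Y.
Proof. by rewrite /antipodal map_cat flatten_cat. Qed.

Lemma size_antipodal (R : realType) (D : nat) (X : seq 'rV[R]_D) :
  size (antipodal X) = (2 * size X)%N.
Proof. by elim: X => //= q X IH; rewrite -/(antipodal X) IH mulnS. Qed.

(** * Correctness and cost on one face *)

Section FaceCorrect.
Variables (R : realType) (D n : nat) (eps : R).
Local Notation d := D.+1.
Variables (v : 'I_n -> 'rV[R]_d) (p : 'I_n -> R).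
Hypothesis p01 : forall i, 0 < p i < 1.
Hypothesis n0 : (0 < n)%N.
Implicit Types (s : astate R) (t : seq nat).
Local Notation w := (expected_width v p).
Local Notation inp := (input eps v p).
Local Notation tri := (tri d n inp).
Local Notation conc := (conc d n inp).
Variables (G m : nat) (a : nat -> 'rV[R]_d) (i : nat).
Hypotheses (G0 : (0 < G)%N) (m0 : (0 < m)%N) (aP : basis_inv w d a) (hi : (i < d)%N).
Local Notation flat := (flat D G).
Local Notation digits := (digits D G).
Local Notation bump_lt := (bump_lt (D := D)).
Local Notation dual_row := (@dual_row R D).

Definition grid : seq (seq nat) := gridseq G (iota 0 D) (nseq D 0%N).

Lemma iotaD_lt : all (fun j => j < D)%N (iota 0 D).
Proof. by apply/allP => j; rewrite mem_iota. Qed.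

Lemma gridP t : reflect (size t = D /\ forall l, (l < D)%N -> (0 < nth 0%N t l <= G)%N)
  (t \in grid).
Proof.
apply: (iffP idP) => [h|[st h]].
  have [st _ h2] := mem_gridseq (iota_uniq 0 D) iotaD_lt (size_nseq D 0%N) h.
  by split=> // l hl; apply: h2; rewrite mem_iota.
apply: (@gridseq_mem G D) => //; first exact: iotaD_lt.
  by rewrite size_nseq.
- move=> l; rewrite mem_iota add0n -leqNgt => hl.
  by rewrite !nth_default ?size_nseq ?st.
- by move=> l; rewrite mem_iota => /h.
Qed.

Lemma flat_inj t t' : t \in grid -> t' \in grid -> flat t = flat t' -> t = t'.
Proof.
move=> /gridP[st h] /gridP[st' h'] E; apply: (@eq_from_nth _ 0%N); first by rewrite st.
move=> l; rewrite st => hl; apply: (radix_inj _ _ E) => // k hk.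
  by have /andP[] := h k hk.
by have /andP[] := h' k hk.
Qed.

Definition grid_dir t : 'rV[R]_d :=
  face_dir a i (fun l => grid_val R G (nth 0%N t l)).
Definition point s t : 'rV[R]_d := row_of d s 6 (d * flat t).

Record face_env s0 s : Prop := FaceEnv {
  fe_env : env D G m s;
  fe_basis : forall k, (k < d)%N -> dual_row s k = a k;
  fe_tp : tp s = tp s0;
  fe_mark : nm s 6 = nm s0 6 }.

Lemma face_env_stable s0 : digit_stable (face_env s0).
Proof.
move=> s l x [[e1 e2 e3 e4] h2 h3 h4]; split; split=> //=.
Qed.

Lemma reval_grid_expr s t l : digits t s -> nm s 0 2 = G -> (l < D)%N ->
  reval (conc s) (grid_expr l) = grid_val R G (nth 0%N t l).
Proof. by move=> [h _] h2 hl; ev; rewrite h // h2. Qed.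
Opaque grid_expr.

Lemma neval_point_base s t : digits t s -> neval (conc s) (point_base D) = (d * flat t)%N.
Proof. by move=> [_ h]; rewrite neval_nmul; ev; rewrite h. Qed.
Opaque point_base.

Lemma reval_dir_expr s t k : nm s 0 2 = G ->
  (forall l, (l < d)%N -> dual_row s l = a l) -> digits t s -> (k < d)%N ->
  reval (conc s) (dir_expr D i k) = grid_dir t 0 (inord k).
Proof.
move=> eG fe dg hk; rewrite mxE summxE /dir_expr [LHS]/= reval_rget // reval_rsum.
rewrite [neval _ _]/= -(fe _ hi) mxE inordK //; congr (_ + _).
apply: eq_bigr => l _; rewrite [LHS]/= (reval_grid_expr dg) //.
by rewrite mxE -(fe _ (bump_lt _ (ltn_ord l))) mxE inordK // reval_rget.
Qed.

Definition sample_cost := (fcost (load_dir D i) + (oracle_cost d n + fcost (store_point D)))%N.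

Lemma row_setV s t t' g : t \in grid -> t' \in grid ->
  point (setV d 6 (d * flat t') g s) t = if t == t' then \row_k g k else point s t.
Proof.
move=> tg tg'; apply/rowP => k; rewrite !mxE /= (mulnC d (flat t')) (mulnC d (flat t)) in_blockE //.
have -> : (flat t == flat t') = (t == t').
  by apply/eqP/eqP => [|-> //]; apply: flat_inj.
by case: eqVneq => [->|_]; rewrite !mxE ?addKn // mulnC.
Qed.

Lemma digits_frame t s s' : (forall l, nm s' 7 l = nm s 7 l) ->
  nm s' 0 1 = nm s 0 1 -> digits t s -> digits t s'.
Proof. by move=> h1 h2 [h3 h4]; split; rewrite ?h2 // => l hl; rewrite h1 h3. Qed.

Lemma face_env_frame s0 s s' : face_env s0 s ->
  (forall r k, r \in [:: 0; 6; 8; 9]%N -> nm s' r k = nm s r k) ->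
  (forall k, rm s' 4 k = rm s 4 k) -> tp s' = tp s -> face_env s0 s'.
Proof.
move=> [[e1 e2 e3 e4] h2 h3 h4] f1 f2 f3; split.
- by split; rewrite ?f1 // => l hl; rewrite f1 // ?e3 ?e4.
- by move=> k hk; rewrite -h2 //; apply/rowP => l; rewrite !mxE f2.
- by rewrite f3.
- by rewrite -h4; apply/funext => k; rewrite f1.
Qed.

Lemma sample_bodyP s0 s t : face_env s0 s -> digits t s -> t \in grid ->
  tri (sample_body D i) sample_cost (fun s' => [/\ face_env s0 s', digits t s',
     extreme w (grid_dir t) (point s' t) &
     forall t', t' \in grid -> t' != t -> point s' t' = point s t']) s.
Proof.
move=> fe dg tg; apply: tri_seq.
apply: (@tri_vset _ _ _ _ _ _ _ (fun k => grid_dir t 0 (inord k))) => //.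
  move=> k s' hk en er; apply: reval_dir_expr => //.
  - by rewrite en (env_G (fe_env fe)).
  - move=> l hl; rewrite -(fe_basis fe hl); apply/rowP => k'.
    by rewrite !mxE er.
  - by apply: digits_frame dg; rewrite en.
rewrite [neval _ _]/=; set s1 := setV _ _ _ _ _; apply: tri_seq.
apply: tri_weaken (oracle_extremeP eps v p01 n0 s1) (leqnn _) _ => s2 [[g1 g2 g3] ex].
have dg2 : digits t s2 by apply: digits_frame dg; rewrite ?g1 // => l; rewrite g1.
apply: (@tri_vset _ _ _ _ _ _ _ (fun k => rm s2 2 k)) => //.
  by move=> k s' hk en er; ev; rewrite er.
rewrite (neval_point_base dg2); split.
- apply: face_env_frame fe _ _ _ => //= [r k|k].
    by rewrite !inE => /or4P[] /eqP ->; rewrite g1.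
  by rewrite g2.
- by apply: digits_frame dg2.
- rewrite row_setV // eqxx.
  have <- : row_of d s1 1 0 = grid_dir t.
    by apply/rowP => k; rewrite mxE /= add0n ltn_ord subn0 inord_val.
  by congr extreme: ex; apply/rowP => k; rewrite !mxE.
- move=> t' tg' /negPf ne; rewrite row_setV // ne.
  by apply/rowP => k; rewrite !mxE g2.
Qed.

Definition origin : seq nat := nseq D 0%N.

Lemma sample_cmdP s0 s : face_env s0 s -> digits origin s ->
  tri (sample_cmd D i) (nest_cost G sample_cost D) (fun s' =>
    [/\ face_env s0 s', digits origin s' &
        forall t, t \in grid -> extreme w (grid_dir t) (point s' t)]) s.
Proof.
move=> fe dg; pose P (done : seq (seq nat)) s' := face_env s0 s' /\
  forall t, t \in grid -> t \in done -> extreme w (grid_dir t) (point s' t).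
have := @nestP R D n inp G m (iota 0 D) (sample_body D i) sample_cost P [::] origin s.
rewrite size_iota => H; apply: tri_weaken (H _ _ _ _ _ _ _ _ _) (leqnn _) _ => {H} //.
- exact: iota_uniq.
- exact: iotaD_lt.
- by rewrite size_nseq.
- by move=> l _; rewrite nth_nseq if_same.
- by move=> l s' [/fe_env].
- by move=> l s' k x [/(face_env_stable k x)[f1 f2] h]; split; split.
- move=> l t s' tg [fe' h] dg'; apply: tri_weaken (sample_bodyP fe' dg' tg) (leqnn _) _.
  move=> s'' [fe'' dg'' ex oth]; split=> //; split=> // t' tg'.
  rewrite mem_rcons inE; have [->|ne] := eqVneq t' t => //= t'l.
  by rewrite oth //; apply: h.
- by move=> s' [[fe' h] dg']; split=> // t tg; apply: h.
Qed.

(** * Cells of the samples, and one sample per cell *)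

Section Buckets.
Variable x : seq nat -> 'rV[R]_d.
Hypothesis xP : forall t, t \in grid -> extreme w (grid_dir t) (x t).

Local Notation K := (cells D m).

Definition height (l : nat) t : R := m%:R *
  (grid_val R G (nth 0%N t l) + dotp (a (bump i l)) (x t) + (1 + 2 ^ d)%N%:R).
Definition cell (l : nat) t : nat := ceiln (height l t).

Lemma height_bounds l t : t \in grid -> (l < D)%N ->
  0 <= height l t <= ((2 + 2 * 2 ^ d) * m)%N%:R.
Proof.
move=> tg hl; have [_ /(_ l hl)/andP[g1 g2]] := gridP _ tg.
have G0' : 0 < G%:R :> R by rewrite ltr0n.
have v1 : -1 <= grid_val R G (nth 0%N t l) <= 1.
  have q0 : 0 <= (nth 0%N t l)%:R / G%:R :> R by rewrite divr_ge0.
  have q1 : (nth 0%N t l)%:R / G%:R <= 1 :> R by rewrite ler_pdivrMr // mul1r ler_nat.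
  by rewrite /grid_val -mulrA; lra.
have v2 : `|dotp (a (bump i l)) (x t)| <= 2 ^+ d.
  apply: le_trans (basis_bound aP (bump_lt i hl)).
  apply: body_norm; first exact: expected_widthN.
  by have [] := xP tg.
move: v1 v2; rewrite ler_norml => /andP[a1 a2] /andP[b1 b2].
have e1 : ((2 + 2 * 2 ^ d) * m)%N%:R = m%:R * (2 + 2 * 2 ^+ d) :> R.
  by rewrite mulnC natrM natrD natrM natrX.
have e2 : (1 + 2 ^ d)%N%:R = 1 + 2 ^+ d :> R by rewrite natrD natrX.
rewrite /height e1 e2.
have m0' : 0 <= m%:R :> R by [].
by apply/andP; split; [apply: mulr_ge0 => //; lra|rewrite ler_wpM2l //; lra].
Qed.

Lemma cell_lt l t : t \in grid -> (l < D)%N -> (cell l t < K)%N.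
Proof. by move=> tg hl; have /andP[_ h] := height_bounds tg hl; rewrite ltnS; apply: ceiln_le. Qed.

Definition cell_ok s l t : Prop := nm s 5 (D * flat t + l)%N = (cell l t * K ^ l)%N.

Record bucket_env s0 j s : Prop := BucketEnv {
  be_face : face_env s0 s;
  be_point : forall t, t \in grid -> point s t = x t;
  be_cell : forall l t, (l < j)%N -> t \in grid -> cell_ok s l t }.

Lemma bucket_env_stable s0 j : digit_stable (bucket_env s0 j).
Proof.
by move=> s l y [/(face_env_stable l y)[f1 f2] h1 h2]; split; split.
Qed.

Lemma reval_height s0 s j l t : bucket_env s0 j s -> digits t s -> t \in grid ->
  (l < D)%N ->
  reval (conc s) (height_expr D i l) = (K ^ l)%N%:R * height l t.
Proof.
move=> [[[eG em _ ec] fb _ _] hp _] dg tg hl.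
rewrite /height_expr [LHS]/= reval_rsum (reval_grid_expr dg) // !neval_nget //.
rewrite [neval _ (NNum l)]/= [neval _ (NNum 3)]/= em ec 1?ltnW //.
congr (_ * (_ * (_ + _ + _))); apply: eq_bigr => k _.
rewrite [LHS]/= !reval_rget // [neval _ (NAdd _ _)]/= (neval_point_base dg).
by rewrite [neval _ _]/= -hp // -(fb _ (bump_lt _ hl)) !mxE.
Qed.

Lemma cell_ok_setN s l t l' t' : (l < D)%N -> (l' < D)%N -> t \in grid -> t' \in grid ->
  cell_ok s l t \/ (l = l' /\ t = t') ->
  cell_ok (setN 5 (D * flat t' + l') (cell l' t' * K ^ l') s) l t.
Proof.
move=> hl hl' tg tg' h; rewrite /cell_ok /=; case: eqP => [E|ne].
  have Et : flat t = flat t'.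
    apply/eqP; rewrite -(in_blockE (flat t) (flat t') hl) !(mulnC _ D) E.
    by rewrite leq_addr ltn_add2l.
  have El : l = l' by move: E; rewrite Et => /addnI.
  by rewrite El (flat_inj tg tg' Et).
by case: h => // -[E1 E2]; case: ne; rewrite E1 E2.
Qed.

Definition walk_const j := (tcost (walk_test D i j) + fcost (walk_body j))%N.

(** The cost counts only the cells climbed since the previous grid point, in the form needed for
    telescoping along the line. *)
Lemma walkP s0 s j t c : bucket_env s0 j s -> digits t s -> t \in grid -> (j < D)%N ->
  nm s 10 0 = (c * K ^ j)%N -> (c <= cell j t)%N ->
  tri (While (walk_test D i j) (walk_body j)) (walk_const j * (cell j t - c).+1)
    (fun s' => [/\ nm s' 10 0 = (cell j t * K ^ j)%N,
       forall r, r != 10 -> nm s' r = nm s r, rm s' = rm s & tp s' = tp s]) s.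
Proof.
move=> be dg tg hj hc cc.
have K0 : 0 < (K ^ j)%N%:R :> R by rewrite ltr0n expn_gt0.
have test s' k : nm s' 10 0 = ((c + k) * K ^ j)%N ->
    (forall r, r != 10 -> nm s' r = nm s r) -> rm s' = rm s -> tp s' = tp s ->
    teval (conc s') (walk_test D i j) = (c + k < cell j t)%N.
  move=> e1 e2 e3 e4.
  rewrite -[LHS]/((neval (conc s') walk)%:R < reval (conc s') (height_expr D i j)).
  rewrite neval_nget // [neval _ _]/= e1.
  have fr : bucket_env s0 j s'.
    case: be => fe hp ho; split.
    - apply: face_env_frame fe _ _ _ => // [r k'|k']; last by rewrite e3.
      by rewrite !inE => /or4P[] /eqP ->; rewrite e2.
    - by move=> t' tg'; rewrite -hp // /point /row_of e3.
    - by move=> l t' hl tg'; rewrite /cell_ok e2 //; apply: ho.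
  have dg' : digits t s' by apply: digits_frame dg => [l|]; rewrite e2.
  by rewrite (reval_height fr dg' tg hj) natrM mulrC ltr_pM2l // ltn_ceiln.
apply: tri_weaken (tri_whileC (N := (cell j t - c)%N) (T := fcost (walk_body j))
  (P := fun k s' => [/\ nm s' 10 0 = ((c + k) * K ^ j)%N,
       forall r, r != 10 -> nm s' r = nm s r, rm s' = rm s & tp s' = tp s]) _ _ _) _ _ => //.
- by rewrite addn0.
- move=> k s' hk [e1 e2 e3 e4]; split; first by rewrite (test _ _ e1 e2 e3 e4); lia.
  apply: tri_nset => //; rewrite [neval _ (NNum 0)]/=.
  have /env_cells ec := fe_env (be_face be).
  have e9 : nm s' 9 j = (K ^ j)%N by rewrite e2 // ec // ltnW.
  rewrite [neval _ _]/= !neval_nget // ![neval _ (NNum _)]/= e1 e9; split=> //=.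
    by rewrite addnS mulSnr.
  move=> r hr; rewrite -e2 //; apply/funext => l.
  by rewrite /= (negPf hr).
- by move=> s' [e1 e2 e3 e4]; rewrite (test _ _ e1 e2 e3 e4) subnKC ?ltnn.
- by move=> s' [e1 e2 e3 e4]; split=> //; rewrite e1 subnKC.
Qed.

Definition axis_point t j k : seq nat := set_nth 0%N t j k.
(** One representative for each grid line parallel to axis [j], with digit [j] still 0. *)
Definition axis_base j : seq (seq nat) := gridseq G (rem j (iota 0 D)) origin.

Lemma mem_rem_iota j l : (l \in rem j (iota 0 D)) = (l != j) && (l < D)%N.
Proof. by rewrite mem_rem_uniq ?iota_uniq // inE mem_iota. Qed.

Lemma axis_baseP j t : (j < D)%N -> t \in axis_base j ->
  [/\ size t = D, nth 0%N t j = 0%N &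
      forall k, (0 < k <= G)%N -> axis_point t j k \in grid].
Proof.
move=> hj tb.
have ar : all (fun l => l < D)%N (rem j (iota 0 D)).
  by apply/allP => l; rewrite mem_rem_iota => /andP[].
have [st h1 h2] := mem_gridseq (rem_uniq j (iota_uniq 0 D)) ar (size_nseq D 0%N) tb.
split=> //; first by rewrite h1 ?nth_nseq ?if_same // mem_rem_iota eqxx.
move=> k hk; apply/gridP; split; first exact: size_set_digit.
move=> l hl; rewrite nth_set_nth /=; case: eqVneq => // lj.
by apply: h2; rewrite mem_rem_iota lj.
Qed.

Lemma grid_axis j t : (j < D)%N -> t \in grid ->
  axis_point t j 0 \in axis_base j /\
  t = axis_point (axis_point t j 0) j (nth 0%N t j).
Proof.
move=> hj /gridP[st ht]; split.
  apply: (@gridseq_mem G D); rewrite ?size_nseq //.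
  - by apply/allP => l; rewrite mem_rem_iota => /andP[].
  - exact: size_set_digit.
  - move=> l; rewrite mem_rem_iota negb_and negbK -leqNgt nth_set_nth nth_nseq if_same /=.
    by case: eqVneq => //= _ Dl; rewrite nth_default ?st.
  - by move=> l; rewrite mem_rem_iota nth_set_nth /= => /andP[/negPf -> /ht].
apply: (@eq_from_nth _ 0%N); first by rewrite st !(@size_set_digit _ D) // size_set_digit.
by move=> l _; rewrite !nth_set_nth /= nth_set_nth /=; case: eqVneq => [->|].
Qed.

(** Along the line only the parameter of axis [j] changes, so [face_dir_monotone] reduces to one
    product whose first factor is positive; parameter and functional then increase together. *)
Lemma cell_monotone j t k k' : (j < D)%N -> t \in axis_base j ->
  (0 < k <= k')%N -> (k' <= G)%N ->
  (cell j (axis_point t j k) <= cell j (axis_point t j k'))%N.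
Proof.
move=> hj tb /andP[k0 kk'] k'G; have [st tj tg] := axis_baseP hj tb.
have g1 : axis_point t j k \in grid by apply: tg; rewrite k0 (leq_trans kk').
have g2 : axis_point t j k' \in grid by apply: tg; rewrite (leq_trans k0).
apply: le_ceiln; rewrite /height ler_wpM2l // lerD2r !nth_set_nth /= eqxx.
have := face_dir_monotone (xP g1) (xP g2).
rewrite (bigD1 (Ordinal hj)) //= big1 ?addr0; last first.
  move=> l; rewrite -val_eqE /= => /negPf lj.
  by rewrite !nth_set_nth /= lj subrr mul0r.
rewrite !nth_set_nth /= eqxx; move: kk'; rewrite leq_eqVlt => /predU1P[->//|kk'].
have gv : grid_val R G k < grid_val R G k'.
  rewrite /grid_val ltrD2r -!mulrA ltr_pM2l // ltr_pM2r ?invr_gt0 ?ltr0n //.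
  by rewrite ltr_nat.
rewrite pmulr_rge0 ?subr_gt0 // subr_ge0 => h.
by rewrite lerD // ltW.
Qed.

Lemma telescope_le (f : nat -> nat) N :
  (forall k, (k < N)%N -> (f k <= f k.+1)%N) ->
  (\sum_(k < N) (f k.+1 - f k) + f 0 = f N)%N.
Proof.
elim: N => [|N IH] h; first by rewrite big_ord0.
rewrite big_ord_recr /= addnAC IH; last by move=> k hk; apply: h; apply: leq_trans hk _.
by rewrite addnC subnK // h.
Qed.

Lemma bucket_env_frame s0 j s s' : bucket_env s0 j s ->
  (forall r, r \in [:: 0; 5; 6; 8; 9]%N -> nm s' r = nm s r) ->
  rm s' = rm s -> tp s' = tp s -> bucket_env s0 j s'.
Proof.
move=> [fe hp ho] h1 h2 h3; split.
- apply: face_env_frame fe _ _ _ => // [r k|k]; last by rewrite h2.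
  by rewrite !inE => /or4P[] /eqP ->; rewrite h1.
- by move=> t tg; rewrite -hp // /point /row_of h2.
- by move=> l t hl tg; rewrite /cell_ok h1 //; apply: ho.
Qed.

Definition line_const j := (fcost (nset 10 (NNum 0) (NNum 0)) + for_const +
  walk_const j + fcost (nset 5 (cell_idx D j) walk))%N.
Definition line_cost j := (line_const j * (3 * G.+1 + K))%N.

Definition line_inv s0 j (done : seq (seq nat)) s : Prop :=
  bucket_env s0 j s /\
  forall t, t \in grid -> axis_point t j 0 \in done -> cell_ok s j t.

Lemma line_inv_setN s0 j done s r k y : (9 < r)%N ->
  line_inv s0 j done s -> line_inv s0 j done (setN r k y s).
Proof.
move=> hr [be h]; split; last first.
  by move=> t tg tD; rewrite /cell_ok /= ltn_eqF ?(leq_trans _ hr) //=; apply: h.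
apply: bucket_env_frame be _ _ _ => // r' hr'; apply/funext => k' /=.
rewrite ltn_eqF //; apply: leq_ltn_trans hr; move: hr'.
by rewrite !inE => /or4P[| | |/orP[]] /eqP ->.
Qed.

Lemma line_inv_cell s0 j done s t : (j < D)%N -> t \in grid -> line_inv s0 j done s ->
  line_inv s0 j done (setN 5 (D * flat t + j) (cell j t * K ^ j) s).
Proof.
move=> hj tg [[fe hp ho] h]; split.
  split; first by apply: face_env_frame fe _ _ _ => // r k; rewrite !inE => /or4P[] /eqP ->.
    by move=> t' /hp.
  move=> l t' hl tg'; apply: cell_ok_setN => //; first exact: ltn_trans hj.
  by left; apply: ho.
by move=> t' tg' tD; apply: cell_ok_setN => //; left; apply: h.
Qed.

(** The moves along the line telescope to the last cell number, which is below the number of cells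
    per axis; the other work is constant per grid point. *)
Lemma line_cmdP s0 j done t s : (j < D)%N -> t \in axis_base j ->
  line_inv s0 j done s -> digits t s ->
  tri (line_cmd D i j) (line_cost j)
    (fun s' => line_inv s0 j (rcons done t) s' /\ digits t s') s.
Proof.
move=> hj tb li dg; have [st tj tg] := axis_baseP hj tb.
(* The value 0 at [k = 0] is the position of the freshly reset pointer, not the cell of a grid
   point. *)
pose cc k := if k is 0 then 0%N else cell j (axis_point t j k).
pose P k s' := [/\ line_inv s0 j done s',
   forall k', (0 < k' <= k)%N -> cell_ok s' j (axis_point t j k') &
   nm s' 10 0 = (cc (minn k G) * K ^ j)%N].
pose T k := (walk_const j * (cc k.+1 - cc k).+1 + fcost (nset 5 (cell_idx D j) walk))%N.
have ccm k : (k < G)%N -> (cc k <= cc k.+1)%N.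
  by case: k => // k hk; apply: cell_monotone => //=.
apply: (@tri_weaken _ _ _ _ _ (fcost (nset 10 (NNum 0) (NNum 0)) +
   (\sum_(k < G) (for_const + T k) + for_const * G.+1)) _ (fun s' => P G s' /\ digits t s')).
- apply: tri_seq; apply: tri_nset => //; rewrite ![neval _ _]/=.
  apply: (@forP R D n inp G m j _ P T t) => //.
  + split; first exact: line_inv_setN.
      by move=> k' /andP[]; lia.
    by rewrite min0n.
  + by move=> k s' [[/be_face/fe_env]].
  + move=> k s' l y [[be h1] h2 h3].
    have [b1 b2] := bucket_env_stable l y be.
    by split; split.
  + move=> k s' hk [li' h2 h3] dg'.
    have be := li'.1; have kg : axis_point t j k.+1 \in grid by apply: tg.
    rewrite (minn_idPl (ltnW hk)) in h3.
    apply: tri_seq; apply: tri_weaken (walkP be dg' kg hj h3 (ccm k hk)) (leqnn _) _.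
    move=> s'' [e1 e2 e3 e4]; apply: tri_nset => //.
    have dg'' : digits (axis_point t j k.+1) s'' by apply: digits_frame dg' => [l|]; rewrite e2.
    have -> : neval (conc s'') (cell_idx D j) = (D * flat (axis_point t j k.+1) + j)%N.
      by rewrite /cell_idx /= neval_nmul; ev; rewrite (dg''.2).
    rewrite neval_nget // [neval _ _]/= e1.
    have li'' : line_inv s0 j done s''.
      case: li' => be' h; split.
        apply: bucket_env_frame be' _ _ _ => // r.
        by rewrite !inE => /or4P[| | |/orP[]] /eqP ->; rewrite e2.
      by move=> t' tg' tD; rewrite /cell_ok e2 //; apply: h.
    split; last by apply: digits_frame dg''.
    split; first exact: line_inv_cell.
    * move=> k'; case/andP=> k'0; rewrite leq_eqVlt => k'k.
      apply: cell_ok_setN => //.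
        by apply: tg; rewrite k'0 /=; case/orP: k'k => [/eqP -> //|h]; apply: leq_trans (ltnW h) hk.
      case/orP: k'k => [/eqP ->|k'k]; first by right.
      by left; rewrite /cell_ok e2 //; apply: h2; rewrite k'0.
    * by rewrite /= (minn_idPl hk) e1.
- have := telescope_le ccm; rewrite addn0 => tele.
  have ccK : (cc G <= K)%N.
    rewrite -(prednK G0) /cc; apply/ltnW/cell_lt => //; apply: tg.
    by rewrite prednK // leqnn andbT.
  rewrite /T /line_cost /line_const big_split sum_nat_const card_ord big_split.
  rewrite sum_nat_const card_ord; under eq_bigr do rewrite mulnS.
  rewrite big_split sum_nat_const card_ord -big_distrr /= tele.
  move: (fcost (nset 10 _ _)) for_const (walk_const j) (fcost (nset 5 _ _))
    (cc G) K ccK => /= b c e f g h gh.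
  nia.
- move=> s' [[[be h1] h2 h3] dg']; split=> //; split=> // t' tg'.
  rewrite mem_rcons inE => /predU1P[E|]; last exact: h1.
  have [_ ->] := grid_axis hj tg'; rewrite E; apply: h2.
  by have [_ /(_ j hj)] := gridP _ tg'.
Qed.

Lemma bucket_cmdP s0 j s : (j < D)%N -> bucket_env s0 j s -> digits origin s ->
  tri (bucket_cmd D i j) (nest_cost G (line_cost j) D.-1)
    (fun s' => bucket_env s0 j.+1 s' /\ digits origin s') s.
Proof.
move=> hj be dg.
have := @nestP R D n inp G m (rem j (iota 0 D)) (line_cmd D i j) (line_cost j)
  (line_inv s0 j) [::] origin s.
rewrite size_rem ?mem_iota // size_iota => H.
apply: tri_weaken (H _ _ _ _ _ _ _ _ _) (leqnn _) _ => {H} //.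
- by rewrite rem_uniq // iota_uniq.
- by apply/allP => l; rewrite mem_rem_iota => /andP[].
- by rewrite size_nseq.
- by move=> l _; rewrite nth_nseq if_same.
- by move=> l s' [/be_face/fe_env].
- move=> l s' k y [be' h]; have [b1 b2] := bucket_env_stable k y be'.
  by split; split.
- by move=> l t s' tb li dg'; apply: line_cmdP.
- move=> s' [[[fe hp ho] h] dg']; split=> //; split=> // l t.
  rewrite ltnS leq_eqVlt => /predU1P[->|hl] tg; last exact: ho.
  by apply: h => //; have [] := grid_axis hj tg.
Qed.

Definition key t : nat := radix D K (cell^~ t).

Lemma key_lt t : t \in grid -> (key t < K ^ D)%N.
Proof. by move=> tg; apply: radix_lt => l hl; apply: cell_lt. Qed.

Lemma key_inj t t' : t \in grid -> t' \in grid -> key t = key t' ->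
  forall l, (l < D)%N -> cell l t = cell l t'.
Proof.
by move=> tg tg' E l hl; apply: (radix_inj _ _ E) => // k hk; apply: cell_lt.
Qed.

(** The base state fixes just the tape and the marks, which are what the selection changes, so the
    base moves along with the state. *)
Lemma bucket_env_rebase s0 s : bucket_env s0 D s -> bucket_env s D s.
Proof. by move=> [[h1 h2 h3 h4] hp ho]; split. Qed.

Lemma neval_key s t : bucket_env s D s -> digits t s -> t \in grid ->
  neval (conc s) (key_expr D) = key t.
Proof.
move=> [_ _ ho] dg tg; rewrite neval_nsum; apply: eq_bigr => l _.
rewrite neval_nget //.
have -> : neval (conc s) (cell_idx D l) = (D * flat t + l)%N.
  by rewrite /cell_idx /= neval_nmul; ev; rewrite (dg.2).
exact: ho.
Qed.

(** [outs] holds the grid points whose samples were written, one per key met. Their marks are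
    exactly those equal to [i.+1], since earlier faces left smaller ones. *)
Definition select_inv s1 (done : seq (seq nat)) s : Prop := exists outs : seq (seq nat),
  [/\ bucket_env s D s, {subset outs <= grid} /\ uniq (map key outs),
      tp s = tp s1 ++ coordinates (antipodal (map x outs)),
      forall k, (nm s 6 k <= i.+1)%N /\ (nm s 6 k == i.+1) = (k \in map key outs) &
      forall t, t \in done -> key t \in map key outs].

Lemma select_bodyP s1 done t s : t \in grid -> select_inv s1 done s -> digits t s ->
  tri (select_body D i) (fcost (select_body D i))
    (fun s' => select_inv s1 (rcons done t) s' /\ digits t s') s.
Proof.
move=> tg [outs [be [sub un] tpE mk hd]] dg.
have kE := neval_key be dg tg.
apply: tri_if; rewrite [teval _ _]/= neval_nget // kE; last first.
  have [mle mE] := mk (key t).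
  move=> /negbT; rewrite -leqNgt => mge; apply: tri_skip => //; split=> //.
  exists outs; split=> // t'; rewrite mem_rcons inE => /predU1P[->|]; last exact: hd.
  by rewrite -mE eqn_leq mle mge.
move=> lt; have ko : key t \notin map key outs.
  by have [_ <-] := mk (key t); rewrite ltn_eqF.
apply: tri_seq; apply: tri_nset => //; rewrite kE [neval _ _]/=.
set s2 := setN _ _ _ _.
have be2 : bucket_env s2 D s2.
  apply: bucket_env_rebase; case: be => fe hp ho.
  split; last first.
  - by move=> l t' hl tg'; apply: ho.
  - by move=> t' /hp.
  - by case: fe => [[e1 e2 e3 e4] h2 h3 h4]; split=> //; split.
have dg2 : digits t s2 by apply: digits_frame dg.
have val s' k : (k < d)%N -> nm s' = nm s2 -> rm s' = rm s2 ->
    reval (conc s') (rget d 6 (NAdd (point_base D) (NNum k))) = x t 0 (inord k).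
  move=> hk en er; have dg' : digits t s' by apply: digits_frame dg2; rewrite en.
  rewrite reval_rget // [neval _ _]/= (neval_point_base dg') er.
  by rewrite -(be_point be2 tg) mxE inordK.
apply: tri_seq; apply: (@tri_writes _ _ _ _ _ _ (fun k => (2^-1 *: x t) 0 (inord k))).
  move=> k s' hk en er; rewrite [LHS]/= (val s') // mxE mulrC.
  by [].
apply: (@tri_writes _ _ _ _ _ _ (fun k => (- (2^-1 *: x t)) 0 (inord k))).
  move=> k s' hk en er; rewrite [LHS]/= (val s') // sub0r !mxE mulNr mulrC.
  by [].
rewrite !mkseq_row; split; last by apply: digits_frame dg2.
exists (rcons outs t); split.
- apply: bucket_env_rebase; case: be2 => fe hp ho.
  split; last first.
  + by move=> l t' hl tg'; apply: ho.
  + by move=> t' /hp.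
  + by case: fe => [[e1 e2 e3 e4] h2 h3 h4]; split=> //; split.
- split; last by rewrite map_rcons rcons_uniq ko.
  by move=> t'; rewrite mem_rcons inE => /predU1P[->|/sub].
- rewrite /= tpE map_rcons -cats1 antipodal_cat coordinates_cat -!catA.
  by congr (_ ++ (_ ++ _)); rewrite /coordinates /= cats0.
- move=> k; rewrite map_rcons mem_rcons inE /=; case: eqVneq => [->|_].
    by rewrite eqxx leqnn.
  exact: mk.
- move=> t'; rewrite map_rcons !mem_rcons !inE => /predU1P[->|/hd ->].
    by rewrite eqxx.
  by rewrite orbT.
Qed.

Lemma digit_stable_select s1 done : digit_stable (select_inv s1 done).
Proof.
move=> s l y [outs [be h1 h2 h3 h4]].
have [b1 b2] := bucket_env_stable l y be.
by split; exists outs; split=> //; apply: bucket_env_rebase; eassumption.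
Qed.

Lemma select_cmdP s : bucket_env s D s -> digits origin s ->
  (forall k, (nm s 6 k <= i)%N) ->
  tri (select_cmd D i) (nest_cost G (fcost (select_body D i)) D)
    (fun s' => select_inv s grid s' /\ digits origin s') s.
Proof.
move=> be dg mk.
have := @nestP R D n inp G m (iota 0 D) (select_body D i) (fcost (select_body D i))
  (select_inv s) [::] origin s.
rewrite size_iota => H; apply: tri_weaken (H _ _ _ _ _ _ _ _ _) (leqnn _) _ => {H} //.
- exact: iota_uniq.
- exact: iotaD_lt.
- by rewrite size_nseq.
- by move=> l _; rewrite nth_nseq if_same.
- exists [::]; split=> //; first by rewrite /= cats0.
  by move=> k; rewrite leqW ?mk // ltn_eqF ?ltnS ?mk.
- by move=> l s' [outs [/be_face/fe_env]].
- by move=> l; apply: digit_stable_select.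
- by move=> l t s' tg inv dg'; apply: select_bodyP.
Qed.

(** The sample kept for the same key has the same cell number on every axis. Equal ceilings put the
    heights within distance 1, and the common shift cancels in their difference. *)
Lemma select_cover outs g : (forall l, (l < D)%N -> (0 < g l <= G)%N) ->
  {subset outs <= grid} -> (forall t, t \in grid -> key t \in map key outs) ->
  exists2 x', x' \in map x outs &
  exists2 y, extreme w (face_dir a i (fun l => grid_val R G (g l))) y &
    dotp (face_dir a i (fun l => grid_val R G (g l))) (y - x') <= D%:R / (4 * m%:R ^+ 2).
Proof.
move=> gG sub cov; pose t := mkseq g D.
have tg : t \in grid.
  apply/gridP; split; first by rewrite size_mkseq.
  by move=> l hl; rewrite nth_mkseq //; apply: gG.
have dirE : face_dir a i (fun l => grid_val R G (g l)) = grid_dir t.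
  by congr (_ + _); apply: eq_bigr => l _; rewrite nth_mkseq.
have /mapP[t' t'o kE] := cov t tg; exists (x t'); first exact: map_f.
have tg' := sub _ t'o; rewrite dirE; exists (x t); first exact: xP.
apply: same_cell_error (xP tg) (xP tg') _; first by rewrite ltr0n.
move=> l hl; have := key_inj tg tg' kE hl.
have /andP[h1 _] := height_bounds tg hl; have /andP[h2 _] := height_bounds tg' hl.
move=> /(ceiln_close h1 h2); rewrite /height -!mulrBr => h; apply: le_trans h.
by rewrite le_eqVlt; apply/orP; left; apply/eqP; congr (`|_ * _|); ring.
Qed.

End Buckets.

Definition face_cost := (nest_cost G sample_cost D +
  (\sum_(j <- iota 0 D) nest_cost G (line_cost j) D.-1 + 1 +
   nest_cost G (fcost (select_body D i)) D))%N.

Lemma face_cmdP s : face_env s s -> digits origin s -> (forall k, (nm s 6 k <= i)%N) ->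
  tri (face_cmd D i) face_cost (fun s' =>
    [/\ env D G m s', forall k, (k < d)%N -> dual_row s' k = a k, digits origin s',
       forall k, (nm s' 6 k <= i.+1)%N &
     exists X, [/\ tp s' = tp s ++ coordinates (antipodal X),
       (size X <= cells D m ^ D)%N, forall x, x \in X -> in_body w x &
       forall g, (forall l, (l < D)%N -> (0 < g l <= G)%N) ->
         exists2 x', x' \in X &
         exists2 y, extreme w (face_dir a i (fun l => grid_val R G (g l))) y &
           dotp (face_dir a i (fun l => grid_val R G (g l))) (y - x')
             <= D%:R / (4 * m%:R ^+ 2)]]) s.
Proof.
move=> fe dg mk; apply: tri_seq.
apply: tri_weaken (sample_cmdP fe dg) (leqnn _) _ => s1 [fe1 dg1 ex1].
pose x := point s1.
have be1 : bucket_env x s 0 s1 by split.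
apply: tri_seq; apply: tri_weaken (tri_seqc (k := D) (f := bucket_cmd D i)
   (T := fun j => nest_cost G (line_cost j) D.-1)
   (P := fun j s' => bucket_env x s j s' /\ digits origin s') _ _) (leqnn _) _ => //.
  by move=> j s' hj [be dg']; apply: bucket_cmdP.
move=> s2 [be2 dg2].
have mk2 k : (nm s2 6 k <= i)%N by rewrite (fe_mark (be_face be2)).
apply: tri_weaken (select_cmdP (bucket_env_rebase be2) dg2 mk2) (leqnn _) _.
move=> s3 [[outs [be3 [sub un] tp3 mk3 cov]] dg3]; split=> //.
- by case: be3 => /fe_env.
- by case: be3 => /fe_basis.
- by move=> k; have [] := mk3 k.
exists (map x outs); split.
- by rewrite tp3 (fe_tp (be_face be2)).
(* The samples kept have distinct keys, all below [cells D m ^ D]. *)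
- rewrite size_map -(size_map (key x)) -(size_iota 0 (_ ^ _)).
  apply: uniq_leq_size => // k /mapP[t /sub tg ->].
  by rewrite mem_iota /= add0n key_lt.
- by move=> y /mapP[t /sub/ex1[h _] ->].
- by move=> g gG; apply: select_cover.
Qed.

End FaceCorrect.

(** * The algorithm *)

Section Program.
Variable D : nat.
Local Notation d := D.+1.

Definition kernel_body : cmd :=
  Seq (basis_cmd d) (Seq (setup D) (seqc d (face_cmd D))).
Definition eps_test : test := RLt (RLoad (NNum 0)) (RNat (NNum 1)).
Definition size_test : test := NLt (NNum 1) (NLoad (NNum 0)).
(** For [eps >= 1] or at most one point the empty set is a kernel and nothing is written. Otherwise
    [1 / eps ^+ D] and [n ln n] are both at least 1 and absorb constants. *)
Definition kernel_cmd : cmd :=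
  If eps_test (If size_test kernel_body Skip) Skip.

Definition kernel_cost n G m : nat :=
  (basis_cost D n + (setup_cost D G m +
    (\sum_(i <- iota 0 d) face_cost D n G m i + 1)))%N.

Variables (R : realType) (n : nat) (eps : R).
Variables (v : 'I_n -> 'rV[R]_d) (p : 'I_n -> R).
Hypothesis p01 : forall i, 0 < p i < 1.
Local Notation w := (expected_width v p).

Definition zero_state : astate R := AState (fun _ _ => 0%N) (fun _ _ => 0) [::].

Lemma initial_stateE : initial_state eps v p = conc d n (input eps v p) zero_state.
Proof.
congr State; apply/funext => k; first by case: k.
by case: ltnP => // h; rewrite nth_default // size_input.
Qed.

(** The extent of [antipodal X] is half the largest modulus of [dotp u x] over [X] and is the same
    at [u] and [- u], so its width is that modulus. *)
Lemma width_antipodal (X : seq 'rV[R]_d) : X != [::] ->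
  (forall x, x \in X -> in_body w x) ->
  (forall u, exists2 x, x \in X & (1 - eps) * w u <= `|dotp u x|) ->
  is_exp_kernel eps v p (antipodal X).
Proof.
move=> X0 XK Xcov u.
have memA q : q \in antipodal X -> exists2 x, x \in X &
    q = 2^-1 *: x \/ q = - (2^-1 *: x).
  move=> /flattenP[s /mapP[x xX ->]]; rewrite !inE => /orP[] /eqP ->.
    by exists x => //; left.
  by exists x => //; right.
have Amem x : x \in X -> 2^-1 *: x \in antipodal X /\ - (2^-1 *: x) \in antipodal X.
  by move=> xX; split; apply/flattenP; exists [:: 2^-1 *: x; - (2^-1 *: x)];
    rewrite ?(map_f (fun x => [:: 2^-1 *: x; - (2^-1 *: x)])) // !inE eqxx ?orbT.
have A0 : antipodal X != [::] by case: (X) X0.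
have wN := expected_widthN v p.
have up u' : extent (antipodal X) u' <= w u' / 2.
  apply: extent_le => // q /memA[x /XK xK [->|->]]; rewrite ?dotpNr dotpZr.
    by have := xK u'; lra.
  by have := xK (- u'); rewrite dotpNl wN; lra.
have lo u' x : x \in X -> `|dotp u' x| / 2 <= extent (antipodal X) u'.
  move=> /Amem[h1 h2].
  have := extent_ge u' h1; have := extent_ge u' h2; rewrite dotpNr dotpZr.
  by case: (ger0P (dotp u' x)) => _; lra.
rewrite /width; apply/andP; split; last first.
  by have := up u; have := up (- u); rewrite wN; lra.
have [x xX h] := Xcov u; have := lo u x xX; have := lo (- u) x xX.
by rewrite dotpNl normrN; lra.
Qed.

Lemma width_small (q : seq 'rV[R]_d) u : (size q <= 1)%N -> width q u = 0.
Proof.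
case: q => [|q [|//]] _; rewrite /width /=; first by rewrite addr0.
by rewrite !big_nil dotpNl subrr.
Qed.

Lemma expected_width_small u : (n <= 1)%N -> w u = 0.
Proof.
move=> n1; rewrite /expected_width big1 // => A _.
rewrite width_small ?mulr0 // size_map -cardE.
by rewrite (leq_trans (max_card _)) // card_ord.
Qed.

Lemma empty_kernel : 1 <= eps \/ (n <= 1)%N -> is_exp_kernel eps v p [::].
Proof.
move=> h u; rewrite width_small //.
have [n1|n2] := leqP n 1; first by rewrite expected_width_small // mulr0 lexx.
have n0 : (0 < n)%N by apply: ltn_trans n2.
have w0 : 0 <= w u by apply: (@w_ge0 R D); [exact: expected_width_ex|exact: expected_widthN].
case: h => [e1|]; last by rewrite leqNgt n2.
by rewrite w0 andbT mulr_le0_ge0 // subr_le0.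
Qed.

Lemma kernel_bodyP : (1 < n)%N -> 0 < eps ->
  exists G m,
  [/\ (0 < G)%N, (1 < G)%N -> G.-1%:R * eps < (grid_bound D)%:R,
      (0 < m)%N, (1 < m)%N -> m.-1%:R ^+ 2 * eps < D%:R &
  tri d n (input eps v p) kernel_body (kernel_cost n G m) (fun s => exists X,
    [/\ tp s = coordinates (antipodal X), (size X <= d * cells D m ^ D)%N &
        is_exp_kernel eps v p (antipodal X)]) zero_state].
Proof.
move=> n1 e0; have n0 : (0 < n)%N by apply: ltn_trans n1.
have ex1 := expected_width_ex eps v p01 n0; have ex2 := expected_widthN v p.
have [G [m [G0 G1 G2 [m0 m1 m2 tr]]]] := @setupP D R n (input eps v p) e0.
exists G, m; split=> //; apply: tri_seq.
apply: tri_weaken (basis_cmdP eps v p01 n0 zero_state) (leqnn _) _.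
move=> s1 [[f1 f2 f3] bi]; apply: tri_seq.
apply: tri_weaken (tr s1) (leqnn _) _ => s2 [[g1 g2 g3 g4] en].
pose a := dual_row D s1.
(* The grid takes half of [eps] and the cells a quarter. *)
have cov_error : D%:R * (2 / G%:R * (2 * 2 ^+ d)) + D%:R / (4 * m%:R ^+ 2) <= eps.
  have Gr : 0 < G%:R :> R by rewrite ltr0n.
  have mr : 0 < m%:R ^+ 2 :> R by rewrite exprn_gt0 // ltr0n.
  have e1 : D%:R * (2 / G%:R * (2 * 2 ^+ d)) <= eps / 2.
    have -> : D%:R * (2 / G%:R * (2 * 2 ^+ d)) = (4 * D%:R * 2 ^+ d) / G%:R :> R.
      by move: (2 ^+ d) (G%:R^-1) (D%:R) => z y x; ring.
    have G1' : 8 * D%:R * 2 ^+ d <= G%:R * eps by rewrite -natrX -!natrM.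
    rewrite ler_pdivrMr //; move: (2 ^+ d) G1' => z; lra.
  have e2 : D%:R / (4 * m%:R ^+ 2) <= eps / 4.
    have m1' : D%:R <= m%:R ^+ 2 * eps by [].
    have m4 : 0 < 4 * m%:R ^+ 2 :> R by apply: mulr_gt0.
    by rewrite ler_pdivrMr //; lra.
  by apply: le_trans (lerD e1 e2) _; lra.
pose Pf i s := [/\ env D G m s, forall k, (k < d)%N -> dual_row D s k = a k,
  digits D G (origin D) s, forall k, (nm s 6 k <= i)%N &
  exists X, [/\ tp s = coordinates (antipodal X), (size X <= i * cells D m ^ D)%N,
    forall x, x \in X -> in_body w x &
    forall i' g, (i' < i)%N -> (forall l, (l < D)%N -> (0 < g l <= G)%N) ->
         exists2 x', x' \in X &
         exists2 y, extreme w (face_dir a i' (fun l => grid_val R G (g l))) y &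
           dotp (face_dir a i' (fun l => grid_val R G (g l))) (y - x')
             <= D%:R / (4 * m%:R ^+ 2)]].
apply: tri_weaken (tri_seqc (k := d) (f := face_cmd D) (P := Pf)
  (T := fun i => face_cost D n G m i) _ _) (leqnn _) _.
- split=> //.
  + by move=> k hk; apply/rowP => j; rewrite !mxE g2.
  + split; last by rewrite g4 f1 // /flat /radix big1 // => l _; rewrite nth_nseq if_same.
    by move=> l hl; rewrite g1 // f1 // nth_nseq if_same.
  + by move=> k; rewrite g1 // f1.
  + by exists [::]; split=> //; rewrite g3 f3.
- move=> i s hi [en' hb dg mk [X [tX sX XK Xc]]].
  have fe : face_env G m a s s by split.
  apply: tri_weaken (face_cmdP eps p01 n0 G0 m0 bi hi fe dg mk) (leqnn _) _.
  move=> s' [en'' hb'' dg'' mk'' [Y [tY sY YK Yc]]]; split=> //.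
  exists (X ++ Y); split.
  + by rewrite tY tX antipodal_cat coordinates_cat.
  + by rewrite size_cat mulSn addnC leq_add.
  + by move=> x; rewrite mem_cat => /orP[/XK|/YK].
  + move=> i' g; rewrite ltnS leq_eqVlt => /predU1P[->|hi'] gG.
      by have [x' x'Y ?] := Yc g gG; exists x' => //; rewrite mem_cat x'Y orbT.
    by have [x' x'X ?] := Xc i' g hi' gG; exists x' => //; rewrite mem_cat x'X.
- move=> s [_ _ _ _ [X [tX sX XK Xc]]]; exists X; split=> //.
  apply: width_antipodal => //.
    have [||x' x'X _] := Xc 0%N (fun=> 1%N) => //.
    by apply/eqP => X0; rewrite X0 in x'X.
  exact: (kernel_covers ex1 ex2 bi G0 XK _ cov_error).
Qed.

End Program.

(** * Cost in terms of [n], [G] and [m] *)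

Section CostNat.
Variable D : nat.
Local Notation d := D.+1.

(** The terms stand for the oracle calls at the grid points, the searches and power tables, and the
    walks along the grid lines. For [D = 0] there are no lines, and the last term is switched
    off. *)
Definition cost_scale n G m : nat :=
  ((oracle_cost d n).+1 * G.+1 ^ D + (G.+1 + cells D m) +
   (0 < D)%N * ((G.+1 + cells D m) * G.+1 ^ D.-1))%N.

(** The factor is chosen before [n], [G] and [m], so it may depend on the dimension only. *)
Definition scaled (f : nat -> nat -> nat -> nat) : Prop :=
  exists c, forall n G m, (0 < G)%N -> (f n G m <= c * cost_scale n G m)%N.

Lemma scaled_add f g : scaled f -> scaled g -> scaled (fun n G m => f n G m + g n G m)%N.
Proof.
move=> [c hc] [c' hc']; exists (c + c')%N => n G m G0.
by rewrite mulnDl leq_add ?hc ?hc'.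
Qed.

Lemma scaled_sum (k : nat) (f : nat -> nat -> nat -> nat -> nat) :
  (forall i, (i < k)%N -> scaled (f i)) ->
  scaled (fun n G m => \sum_(i <- iota 0 k) f i n G m)%N.
Proof.
elim: k => [|k IH] h; first by exists 0%N => n G m _; rewrite big_nil.
have [c hc] : scaled (fun n G m => \sum_(i <- iota 0 k) f i n G m + f k n G m)%N.
  by apply: scaled_add; [apply: IH => i hi; apply: h; apply: ltnW|apply: h].
exists c => n G m G0; rewrite -[in iota _ _]addn1 iotaD big_cat big_seq1 /=.
exact: hc.
Qed.

Lemma scaled_le f g : scaled g -> (forall n G m, (0 < G)%N -> (f n G m <= g n G m)%N) ->
  scaled f.
Proof. by move=> [c hc] h; exists c => n G m G0; apply: leq_trans (h _ _ _ G0) (hc _ _ _ G0). Qed.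

Lemma scaled_const c : scaled (fun _ _ _ => c).
Proof.
exists c => n G m G0; rewrite leq_pmulr //.
by rewrite /cost_scale !addn_gt0 [(0 < G.+1)%N]ltn0Sn !orbT.
Qed.

Lemma scaled_oracle : scaled (fun n _ _ => oracle_cost d n).
Proof.
exists 1%N => n G m G0; rewrite mul1n /cost_scale -addnA.
apply: (@leq_trans ((oracle_cost d n).+1 * G.+1 ^ D)); last exact: leq_addr.
by apply: leq_trans (leqnSn _) _; apply: leq_pmulr; rewrite expn_gt0.
Qed.

Lemma scaled_linear c : scaled (fun _ G m => c * (G.+1 + cells D m))%N.
Proof.
exists c => n G m G0; rewrite leq_mul2l /cost_scale.
by rewrite -addnA addnCA leq_addr orbT.
Qed.

Lemma scaled_grid (f : nat -> nat -> nat -> nat) c :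
  (forall n G m, (f n G m <= oracle_cost d n + c)%N) ->
  scaled (fun n G m => nest_cost G (f n G m) D).
Proof.
move=> hf; exists (c + 3 * for_const).+1 => n G m G0.
apply: leq_trans (nest_cost_le _ _ G0) _.
apply: (@leq_trans ((c + 3 * for_const).+1 * ((oracle_cost d n).+1 * G.+1 ^ D))).
  rewrite mulnA leq_mul2r; apply/orP; right; have := hf n G m.
  by move: for_const => F; nia.
by rewrite leq_mul2l /cost_scale -addnA leq_addr orbT.
Qed.

Lemma scaled_line i j : (0 < D)%N -> scaled (fun _ G m => nest_cost G (line_cost D G m i j) D.-1).
Proof.
move=> D0; exists (3 * line_const D i j + 3 * for_const)%N => n G m G0.
apply: leq_trans (nest_cost_le _ _ G0) _.
rewrite /cost_scale D0 mul1n; apply: leq_trans (leq_mul (leqnn _) (leq_addl _ _)).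
rewrite mulnA leq_mul2r; apply/orP; right; rewrite /line_cost.
move: (line_const D i j) for_const (cells D m) => a b c; nia.
Qed.

Lemma scaled_setup : scaled (fun _ G m => setup_cost D G m).
Proof.
pose k1 := (fcost (nset 0 (NNum 2) (NNum 1)) +
  (tcost (search_test grid_test (grid_bound D)) + fcost (search_body 2)))%N.
pose k2 := (fcost (nset 0 (NNum 3) (NNum 1)) +
  (tcost (search_test cell_test D) + fcost (search_body 3)))%N.
pose k3 := (fcost (cells_set D) + (fcost (nset 8 (NNum 0) (NNum 1)) +
  fcost (nset 9 (NNum 0) (NNum 1))) + 2)%N.
pose k4 := (D * (power_const 8 grid_base + power_const 9 (nget 0 (NNum 4))))%N.
apply: (scaled_le (scaled_linear (2 * (k1 + k2 + k3 + k4)))) => n G m G0.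
have hm : (m.+1 <= cells D m)%N by rewrite /cells ltnS leq_pmull // addn_gt0.
rewrite /setup_cost /search_cost /powers_cost /k1 /k2 /k3 /k4.
move: (cells D m) hm => M hm.
move: (fcost _) (tcost _ + fcost _)%N (fcost _) (tcost _ + fcost _)%N => a1 a2 a3 a4.
move: (fcost _) (fcost _) (fcost _) (power_const _ _) (power_const _ _) => b1 b2 b3 p1 p2.
have : (D * (p1 * G.+2) <= D * p1 * (2 * G.+1))%N by rewrite mulnA leq_mul2l; lia.
have : (D * (p2 * M.+1) <= D * p2 * (2 * M))%N by rewrite mulnA leq_mul2l; lia.
rewrite mulnDr; move: (D * p1)%N (D * p2)%N (D * (p1 * G.+2))%N (D * (p2 * M.+1))%N => q1 q2 z1 z2.
nia.
Qed.

Lemma scaled_kernel : scaled (kernel_cost D).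
Proof.
apply: scaled_add; last apply: scaled_add.
- apply: scaled_add; first exact: scaled_const.
  apply: scaled_add; last exact: scaled_const.
  apply: scaled_sum => j _; apply: scaled_add; first exact: scaled_const.
  by apply: scaled_add; [exact: scaled_oracle|exact: scaled_const].
- exact: scaled_setup.
- apply: scaled_add; last exact: scaled_const.
  apply: scaled_sum => i _; apply: scaled_add; last apply: scaled_add.
  + apply: (scaled_grid (c := fcost (load_dir D i) + fcost (store_point D))) => n G m.
    by rewrite /sample_cost addnCA.
  + apply: scaled_add; last exact: scaled_const.
    by apply: scaled_sum => j hj; apply: scaled_line; apply: leq_ltn_trans hj.
  + by apply: (scaled_grid (c := fcost (select_body D i))) => n G m; rewrite leq_addl.
Qed.

End CostNat.

(** * Cost in terms of [n] and [eps] *)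

Section CostReal.
Variable R : realType.

(** This is [ln (1 + x) <= x] at [x = - 1 / (k + 1)]. *)
Lemma ln_step k : (0 < k)%N -> k.+1%:R^-1 <= ln k.+1%:R - ln k%:R :> R.
Proof.
move=> k0; have k1 : 0 < k.+1%:R :> R by [].
have hx : -1 < - k.+1%:R^-1 :> R.
  by rewrite ltrN2 invf_lt1 // ltr1n.
have := le_ln1Dx hx.
have x0 : 0 < 1 - k.+1%:R^-1 :> R by rewrite subr_gt0 -ltrN2.
have -> : ln k%:R = ln (k.+1%:R * (1 - k.+1%:R^-1)) :> R.
  by congr ln; rewrite mulrBr mulr1 divff ?gt_eqF // -natr1 addrK.
by rewrite lnM ?posrE // opprD addrA subrr sub0r lerNr.
Qed.

Lemma harmonic_le k : (0 < k)%N -> \sum_(1 <= j < k.+1) j%:R^-1 <= 1 + ln k%:R :> R.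
Proof.
elim: k => // k IH _; case: (posnP k) => [->|k0].
  by rewrite big_nat1 ln1 addr0 invr1.
rewrite big_nat_recr //=; have := lerD (IH k0) (ln_step k0).
by rewrite -!addrA [ln k%:R + _]addrC subrK.
Qed.

Lemma ln2_ge : 2^-1 <= ln 2 :> R.
Proof. by have := @ln_step 1 isT; rewrite ln1 subr0. Qed.

Lemma nlnn_ge n : (1 < n)%N -> n%:R <= 2 * (n%:R * ln n%:R) :> R.
Proof.
move=> n1; have n2 : 2 <= n%:R :> R by rewrite ler_nat.
have : ln 2 <= ln n%:R :> R by rewrite ler_ln ?posrE //; lra.
have := ln2_ge; nra.
Qed.

(** The harmonic bound gives [n + 2 n (1 + ln n)], where the [3 n] are at most [6 n ln n]. *)
Lemma sort_cost_le n : (1 < n)%N -> (sort_cost n)%:R <= 8 * (n%:R * ln n%:R) :> R.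
Proof.
move=> n1; have n0 : (0 < n)%N by apply: ltn_trans n1.
have h1 : (\sum_(1 <= k < n) ((n + n) %/ k))%N%:R <= (n + n)%:R * (1 + ln n%:R) :> R.
  apply: le_trans (ler_wpM2l _ (harmonic_le n0)); last by [].
  rewrite natr_sum mulr_sumr big_nat_recr //= -[leLHS]addr0 lerD //; last first.
    by rewrite mulr_ge0 // invr_ge0.
  rewrite big_nat [leRHS]big_nat; apply: ler_sum => k /andP[k0 _].
  by rewrite ler_pdivlMr ?ltr0n // -natrM ler_nat leq_divM.
have := nlnn_ge n1; rewrite /sort_cost natrD; move: h1; rewrite natrD.
set X := (\sum_(_ <= _ < _) _)%N%:R; set l := ln _; nra.
Qed.

Lemma oracle_cost_le d : exists2 A : R, 0 <= A & forall n, (1 < n)%N ->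
  (oracle_cost d n).+1%:R <= A * (n%:R * ln n%:R).
Proof.
pose c := (oracle_const d)%:R : R; have c0 : 0 <= c by [].
(* Of the 18, twice the bound 8 comes from sorting and 2 from the additive constant, since
   [n ln n >= 1]; the final 1 pays for the successor. *)
exists (18 * c + 1) => [|n n1]; first by lra.
rewrite -natr1 natrM -/c -natr1 -natr1 natrM.
have n2 : 2 <= n%:R :> R by rewrite ler_nat.
have := sort_cost_le n1; have := nlnn_ge n1.
set S := (sort_cost n)%:R; set L := _ * ln _ => h1 h2.
have L1 : 1 <= L by lra.
have : c * (2 * S + 1 + 1) <= c * (18 * L) by rewrite ler_wpM2l //; lra.
lra.
Qed.

Variable D : nat.
Local Notation d := D.+1.

(** Obtained from [(m - 1) * sqrt eps <= D] and [sqrt eps <= 1] in the formula for [cells]. *)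
Definition cell_factor : R := (2 + 2 * 2 ^ d)%N%:R * (1 + D%:R) + 1.

(** In dimension one [1 / eps ^+ D] is 1 and cannot absorb a factor [1 / sqrt eps]; there the search
    stops at once, and the second bound is free of [eps]. The same holds for [grid_le]. *)
Lemma cells_le (eps : R) m : 0 < eps < 1 -> (0 < m)%N ->
  ((1 < m)%N -> m.-1%:R ^+ 2 * eps < D%:R) ->
  (cells D m)%:R <= cell_factor * (Num.sqrt eps)^-1 /\
  (D = 0%N -> (cells D m)%:R <= cell_factor).
Proof.
move=> /andP[e0 e1] m0 hm.
have q0 : 0 < Num.sqrt eps by rewrite sqrtr_gt0.
have q2 : Num.sqrt eps ^+ 2 = eps by rewrite sqr_sqrtr // ltW.
have q1 : Num.sqrt eps <= 1 by rewrite -[leRHS]sqrtr1 ler_sqrt // ltW.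
set q := Num.sqrt eps in q0 q1 q2 *.
(* Square roots are avoided by weakening [D] to [D ^ 2], which holds for naturals. *)
have m1q : m.-1%:R * q <= D%:R.
  have [m1|m1] := leqP m 1.
    have -> : m.-1 = 0%N by lia.
    by rewrite mul0r.
  have h : (m.-1%:R * q) ^+ 2 < D%:R by rewrite exprMn q2 hm.
  have h2 : D%:R <= D%:R ^+ 2 :> R.
    by rewrite -natrX ler_nat; case: (D) => // k; rewrite expnS expn1 leq_pmulr.
  have : (m.-1%:R * q) ^+ 2 <= D%:R ^+ 2 by rewrite (le_trans _ h2) // ltW.
  by rewrite ler_pXn2r ?nnegrE ?mulr_ge0 ?(ltW q0).
have mE : m%:R = m.-1%:R + 1 :> R by rewrite natr1 prednK.
have cE : (cells D m)%:R = (2 + 2 * 2 ^ d)%N%:R * m%:R + 1 :> R by rewrite -natrM natr1.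
rewrite cE /cell_factor; set k := (2 + 2 * 2 ^ d)%N%:R.
have k0 : 0 <= k :> R by [].
split; last first.
  move=> D0; have -> : m = 1%N.
    move: hm m0; rewrite D0; case: (m) => [//|[//|m']] /= /(_ isT).
    by rewrite ltNge mulr_ge0 // ?exprn_ge0 // ltW.
  by rewrite D0 addr0.
rewrite ler_pdivlMr // mE.
have : k * (m.-1%:R * q) <= k * D%:R by rewrite ler_wpM2l.
have : k * q <= k by rewrite -[leRHS]mulr1 ler_wpM2l.
nra.
Qed.

Lemma grid_le (eps : R) G : 0 < eps < 1 -> (0 < G)%N ->
  ((1 < G)%N -> G.-1%:R * eps < (grid_bound D)%:R) ->
  G.+1%:R <= ((grid_bound D)%:R + 2) * eps^-1 /\
  (D = 0%N -> G.+1%:R <= (grid_bound D)%:R + 2 :> R).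
Proof.
move=> /andP[e0 e1] G0 hG; have GE : G.+1%:R = G.-1%:R + 2 :> R.
  by rewrite -natrD addn2 prednK.
have c0 : 0 <= (grid_bound D)%:R :> R by [].
split; last first.
  move=> D0; move: hG G0; rewrite /grid_bound D0; case: (G) => [//|[//|G']].
    by move=> _ _; rewrite muln0 mul0n add0r.
  by move=> /(_ isT); rewrite muln0 mul0n ltNge mulr_ge0 // ltW.
rewrite ler_pdivlMr // GE mulrDl.
suff : G.-1%:R * eps <= (grid_bound D)%:R by lra.
have [G1|G1] := leqP G 1; last exact/ltW/hG.
by have -> : G.-1 = 0%N by [lia]; rewrite mul0r.
Qed.

Lemma cost_scale_le : exists2 C : R, 0 <= C & forall n G m (eps : R),
  (1 < n)%N -> 0 < eps < 1 -> (0 < G)%N ->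
  ((1 < G)%N -> G.-1%:R * eps < (grid_bound D)%:R) -> (0 < m)%N ->
  ((1 < m)%N -> m.-1%:R ^+ 2 * eps < D%:R) ->
  (cost_scale D n G m)%:R <= C * (1 / eps ^+ D * (n%:R * ln n%:R)).
Proof.
have [A A0 hA] := oracle_cost_le d.
pose B := (grid_bound D)%:R + 2 + cell_factor : R.
have c0 : 0 <= (grid_bound D)%:R :> R by [].
have f0 : 0 <= cell_factor by rewrite addr_ge0 // mulr_ge0 // addr_ge0.
have B1 : 1 <= B by rewrite /B; lra.
have BD : 0 <= B ^+ D by rewrite exprn_ge0 //; lra.
exists (A * B ^+ D + 2 * B + 2 * B ^+ D).
  by rewrite !addr_ge0 ?mulr_ge0 //; lra.
move=> n G m eps n1 e01 G0 hG m0 hm; have /andP[e0 e1] := e01.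
have [g1 g2] := grid_le e01 G0 hG; have [s1 s2] := cells_le e01 m0 hm.
have q0 : 0 < Num.sqrt eps by rewrite sqrtr_gt0.
have q2 : Num.sqrt eps ^+ 2 = eps by rewrite sqr_sqrtr // ltW.
have q1 : Num.sqrt eps <= 1 by rewrite -[leRHS]sqrtr1 ler_sqrt // ltW.
set L := n%:R * ln n%:R; have L1 : 1 <= L.
  have n2 : 2 <= n%:R :> R by rewrite ler_nat.
  by have := nlnn_ge n1; rewrite -/L; lra.
set y := eps^-1; have y1 : 1 <= y by rewrite invf_ge1 // ltW.
have {}s1 : (cells D m)%:R <= B * y.
  apply: le_trans s1 _; apply: (@le_trans _ _ (cell_factor * y)).
    rewrite ler_wpM2l // /y lef_pV2 ?posrE // -{1}q2 expr2.
    by rewrite -[leRHS]mul1r ler_wpM2r // ltW.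
  by rewrite ler_wpM2r ?(le_trans ler01) // /B; lra.
have {}g1 : G.+1%:R <= B * y.
  apply: le_trans g1 _; rewrite ler_wpM2r ?(le_trans ler01) // /B; lra.
have {}g2 : D = 0%N -> G.+1%:R <= B by move=> /g2; rewrite /B; lra.
have {}s2 : D = 0%N -> (cells D m)%:R <= B by move=> /s2; rewrite /B; lra.
set g := G.+1%:R in g1 g2 *; set M := (cells D m)%:R in s1 s2 *.
have gp : 0 <= g by [].
have Mp : 0 <= M by [].
have -> : 1 / eps ^+ D = y ^+ D by rewrite div1r exprVn.
have E1 : 1 <= y ^+ D by rewrite exprn_ege1.
have By : 0 <= B * y by rewrite mulr_ge0 //; lra.
have gD : g ^+ D <= B ^+ D * y ^+ D by rewrite -exprMn; apply: lerXn2r; rewrite ?nnegrE.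
have E0 : 0 <= y ^+ D by apply: le_trans E1.
have t1 : (oracle_cost d n).+1%:R * g ^+ D <= A * B ^+ D * (y ^+ D * L).
  have -> : A * B ^+ D * (y ^+ D * L) = (A * L) * (B ^+ D * y ^+ D).
    by move: (B ^+ D) (y ^+ D) => b e; ring.
  by apply: ler_pM => //; [exact: exprn_ge0|exact: hA].
have yE : (0 < D)%N -> y <= y ^+ D by move=> D0; rewrite -[leLHS]expr1 ler_weXn2l.
have B0 : 0 <= B by apply: le_trans B1.
have t2 : g + M <= 2 * B * (y ^+ D * L).
  apply: (@le_trans _ _ (2 * B * y ^+ D)); last first.
    rewrite ler_wpM2l ?mulr_ge0 // -[leLHS]mulr1 ler_wpM2l //.
  (* For [D = 0] the bounds free of [eps] are used; otherwise [y <= y ^+ D]. *)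
  case: (posnP D) => [D0|D0].
    rewrite D0 expr0 mulr1; have := g2 D0; have := s2 D0; lra.
  apply: (@le_trans _ _ (2 * B * y)); first lra.
  by rewrite ler_wpM2l ?mulr_ge0 // yE.
have t3 : (0 < D)%N%:R * ((g + M) * g ^+ D.-1) <= 2 * B ^+ D * (y ^+ D * L).
  apply: (@le_trans _ _ (2 * B ^+ D * y ^+ D)); last first.
    rewrite ler_wpM2l ?mulr_ge0 // -[leLHS]mulr1 ler_wpM2l //.
  case: (posnP D) => [D0|D0]; first by rewrite mul0r !mulr_ge0.
  have ED : (B * y) ^+ D = B * y * (B * y) ^+ D.-1 by rewrite -exprS prednK.
  rewrite mul1r -[leRHS]mulrA -exprMn ED [leRHS]mulrA.
  apply: ler_pM; rewrite ?addr_ge0 ?exprn_ge0 //; first lra.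
  by apply: lerXn2r; rewrite ?nnegrE.
have castE (o x z b : nat) : (o * x ^ D + (x + z) + b * ((x + z) * x ^ D.-1))%N%:R =
    o%:R * x%:R ^+ D + (x%:R + z%:R) + b%:R * ((x%:R + z%:R) * x%:R ^+ D.-1) :> R.
  by rewrite !(natrD, natrM, natrX).
rewrite /cost_scale castE [leRHS]mulrDl [X in _ <= X + _]mulrDl.
by apply: lerD => //; apply: lerD.
Qed.

End CostReal.

Lemma powR_half (R : realType) (eps : R) (D : nat) : 0 < eps ->
  1 / eps `^ (D%:R / 2) = (Num.sqrt eps)^-1 ^+ D.
Proof.
move=> e0; rewrite (mulrC D%:R) powRrM powR12_sqrt ?ltW // powR_mulrn ?sqrtr_ge0 //.
by rewrite div1r exprVn.
Qed.

Theorem mainTheorem6 (R : realType) (d : nat) (hd : (0 < d)%N) :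
  exists (prog : cmd) (C : R),
    forall (n : nat) (v : 'I_n -> 'rV[R]_d) (p : 'I_n -> R) (eps : R),
      general_position v ->
      (forall i, 0 < p i < 1) ->
      0 < eps ->
      exists (S : seq 'rV[R]_d) (t : nat),
        [/\ outputs_in prog eps v p S t,
            is_exp_kernel eps v p S,
            (size S)%:R <= C * (1 / eps `^ (d.-1%:R / 2))
          & t%:R <= C * Num.max 1 (1 / eps ^+ d.-1 * (n%:R * ln n%:R))].
Proof.
case: d hd => // D _.
have [B B0 hB] := cost_scale_le R D; have [c hc] := scaled_kernel D.
pose c1 := (tcost eps_test + (tcost size_test + 2))%N.
have f0 : 0 <= cell_factor R D by rewrite addr_ge0 // mulr_ge0 // addr_ge0.
(* Two antipodal points for each sample, on [D.+1] faces. *)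
pose C1 := (2 * D.+1)%N%:R * cell_factor R D ^+ D.
have C10 : 0 <= C1 by rewrite mulr_ge0 // exprn_ge0.
have cB : 0 <= c%:R * B by rewrite mulr_ge0.
exists (kernel_cmd D), (C1 + (c%:R * B + c1%:R)).
have C0 : 0 <= C1 + (c%:R * B + c1%:R) by rewrite !addr_ge0.
move=> n v p eps _ p01 e0.
have max1 (z : R) : 1 <= Num.max 1 z by rewrite le_max lexx.
have [/andP[e1 n1]|triv] := boolP ((eps < 1) && (1 < n)%N); last first.
  have [s [t [ex tc tp0]]] : tri D.+1 n (input eps v p) (kernel_cmd D) c1
      (fun s => tp s = [::]) (zero_state R).
    rewrite /c1 -(addn1 1).
    apply: (@tri_weaken _ _ _ _ _ (tcost eps_test + (tcost size_test + (0 + 1) + 1))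
      _ _ _ _ _ _ (fun _ h => h)); last by lia.
    apply: tri_if => [h1|_]; last exact: tri_skip.
    apply: tri_if => [h2|_]; last exact: tri_skip.
    by case/negP: triv; apply/andP; split; [exact: h1|exact: h2].
  exists [::], t; split.
  - by exists (conc D.+1 n (input eps v p) s); rewrite ?initial_stateE.
  - apply: empty_kernel => //; move: triv; rewrite negb_and -leNgt -leqNgt.
    by case/orP; [left|right].
  - by rewrite mulr_ge0 // div1r invr_ge0 powR_ge0.
  (* The maximum with 1 pays for the tests here, as [n ln n] vanishes for [n <= 1]. *)
  - apply: (@le_trans _ _ (C1 + (c%:R * B + c1%:R))); last by rewrite ler_peMr.
    apply: (@le_trans _ _ c1%:R); first by rewrite ler_nat.
    by rewrite addrA lerDr addr_ge0.
have e01 : 0 < eps < 1 by rewrite e0.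
have [G [m [G0 hG m0 hm tr]]] := kernel_bodyP v p01 n1 e0.
have [s [t [ex tc [X [tX sX kX]]]]] : tri D.+1 n (input eps v p) (kernel_cmd D)
    (kernel_cost D n G m + c1) (fun s => exists X,
    [/\ tp s = coordinates (antipodal X), (size X <= D.+1 * cells D m ^ D)%N &
        is_exp_kernel eps v p (antipodal X)]) (zero_state R).
  apply: (@tri_weaken _ _ _ _ _
    (tcost eps_test + (tcost size_test + (kernel_cost D n G m + 0) + 0))
    _ _ _ _ _ _ (fun _ h => h)); last by rewrite /c1; lia.
  apply: tri_if => [_|]; last by rewrite /= e1.
  by apply: tri_if => [_|]; last rewrite /= n1.
exists (antipodal X), t; split=> //.
- by exists (conc D.+1 n (input eps v p) s); rewrite ?initial_stateE.
- rewrite powR_half //; apply: (@le_trans _ _ (C1 * (Num.sqrt eps)^-1 ^+ D)); last first.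
    by rewrite ler_wpM2r ?exprn_ge0 ?invr_ge0 ?sqrtr_ge0 // lerDl addr_ge0.
  apply: (@le_trans _ _ (2 * (D.+1 * cells D m ^ D))%N%:R).
    by rewrite ler_nat size_antipodal leq_mul2l sX.
  rewrite mulnA natrM natrX /C1 -mulrA ler_wpM2l // -exprMn.
  have [h _] := cells_le e01 m0 hm; apply: lerXn2r; rewrite ?nnegrE //.
  by rewrite mulr_ge0 // invr_ge0 sqrtr_ge0.
- set W := 1 / eps ^+ D * (n%:R * ln n%:R).
  have h := hB n G m eps n1 e01 G0 hG m0 hm; rewrite -/W in h.
  have h1 : t%:R <= c%:R * B * Num.max 1 W + c1%:R.
    apply: (@le_trans _ _ (kernel_cost D n G m + c1)%N%:R); first by rewrite ler_nat.
    rewrite natrD lerD2r; apply: (@le_trans _ _ (c * cost_scale D n G m)%N%:R).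
      by rewrite ler_nat hc.
    rewrite natrM -mulrA ler_wpM2l //; apply: le_trans h _.
    by rewrite ler_wpM2l // le_max lexx orbT.
  apply: le_trans h1 _; rewrite mulrDl [X in _ <= _ + X]mulrDl -[leLHS]add0r.
  apply: lerD; first by rewrite mulr_ge0 // (le_trans ler01 (max1 _)).
  by rewrite lerD2l ler_peMr.
Qed.
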